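(* Let $G:\mathbb{R}^d\to[0,\infty)$, let $\bm\mu_0,\bm\mu\in\mathbb{R}^d$, let $\bm\Sigma_0=\bm I_d$, let $\bm\Sigma$ be a $d\times d$ (symmetric positive definite) covariance matrix, and let $\bm L$ be a $d\times d$ matrix with $\bm L\bm L^T=\bm\Sigma$. If all the eigenvalues of the matrix $\bm\Sigma$ are not smaller than $1$ and $\tilde G(\bm z)=G(\bm\mu+\bm L\bm z)$ satisfies the ''QMC-friendly'' boundary growth condition, then for arbitrarily small $\epsilon>0$, $$\sqrt{\mathbb{E}\left[(\hat I_N(G_{\mathrm{IS}})-I(G_{\mathrm{IS}}))^2\right]}=O(N^{-1+\epsilon}),$$ where $G_{\mathrm{IS}}(\bm z)=G(\bm\mu+\bm L\bm z)W(\bm z)$ and $$W(\bm z)=\det(\bm\Sigma)^{1/2}\exp\left\{\frac12\bm z^T\bm z-\frac12(\bm\mu-\bm\mu_0+\bm L\bm z)^T(\bm\mu-\bm\mu_0+\bm L\bm z)\right\}.$$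
   Context: For $v\subseteq\{1,\dots,d\}$, $D_vG$ denotes the mixed partial derivative of a function $G$ taken once with respect to each $z_j$, $j\in v$, with $D_\emptyset G=G$; integrands are assumed smooth enough that these derivatives exist and are continuous. $\Phi$ is the standard normal CDF and $\Phi^{-1}$ its inverse (applied componentwise to vectors). QMC-friendly boundary growth condition for $G:\mathbb{R}^d\to\mathbb{R}$: for arbitrarily small $B_1,\dots,B_d>0$ there exists a constant $B>0$ (depending on the $B_i$) such that for every $v\subseteq\{1,\dots,d\}$ and all $\bm z\in\mathbb{R}^d$, $$|(D_vG)(\bm z)|\le B\prod_{i=1}^d[1-\Phi(|z_i|)]^{-B_i}.$$ For $H:\mathbb{R}^d\to\mathbb{R}$: $I(H)=\int_{\mathbb{R}^d}H(\bm z)p(\bm z;\bm 0,\bm I_d)\,d\bm z$, where $p(\cdot;\bm\mu,\bm\Sigma)$ is the density of the $d$-dimensional normal distribution $N(\bm\mu,\bm\Sigma)$, and $\hat I_N(H)=\frac1N\sum_{i=1}^NH(\Phi^{-1}(\bm u_i))$, where $\bm u_1,\dots,\bm u_N$ are a scrambled $(t,m,d)$-net in base $b\ge2$ with $N=b^m$. (Then $I(G_{\mathrm{IS}})=\int_{\mathbb{R}^d}G(\bm z)p(\bm z;\bm\mu_0,\bm I_d)\,d\bm z$.) Nets: an elementary interval in base $b$ is a set $\prod_{j=1}^d[a_jb^{-k_j},(a_j+1)b^{-k_j})$ with integers $k_j\ge0$, $0\le a_j<b^{k_j}$. A collection of $b^m$ points of $[0,1)^d$ is a $(t,m,d)$-net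 in base $b$ (integers $0\le t\le m$) if every elementary interval in base $b$ of volume $b^{t-m}$ contains exactly $b^t$ of the points. Scrambled net (Owen's nested uniform scrambling): given a (deterministic) $(t,m,d)$-net $\bm a_1,\dots,\bm a_N$ with base-$b$ digits $a_i^j=\sum_{k\ge1}a_{ijk}b^{-k}$ of the $j$-th coordinate of $\bm a_i$, the scrambled points $\bm u_i$ have coordinates $u_i^j=\sum_{k\ge1}u_{ijk}b^{-k}$ with $u_{ij1}=\pi_j(a_{ij1})$ and $u_{ijk}=\pi_{j;a_{ij1},\dots,a_{ij,k-1}}(a_{ijk})$ for $k\ge2$, where all the permutations $\pi_\cdot$ are mutually independent and uniformly distributed over the permutations of $\{0,\dots,b-1\}$. The $O(\cdot)$ statement is as $N=b^m\to\infty$ with $t,b,d$ fixed; its implied constant may depend on $\epsilon$. *)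

(* Defs.v *)
From HB Require Import structures.
From mathcomp Require Import all_boot all_order all_algebra all_fingroup.
From mathcomp Require Import all_classical all_reals all_analysis.

Set Implicit Arguments.
Unset Strict Implicit.
Unset Printing Implicit Defensive.

Import Order.TTheory GRing.Theory Num.Theory.
Import numFieldNormedType.Exports.

Local Open Scope classical_set_scope.
Local Open Scope ring_scope.

Definition tuple_cons {T : Type} n (p : T * n.-tuple T) : n.+1.-tuple T :=
  [the n.+1.-tuple T of p.1 :: p.2].

(* Lebesgue measure on R^n, carried by n.-tuple R because matrices have no
   measurable structure in the library: the n-fold product of the
   one-dimensional Lebesgue measure. *)
Fixpoint lebesgue_tuple (R : realType) (n : nat) :
    set (n.-tuple (measurableTypeR R)) -> \bar R :=
  match n with
  | 0 => \d_ ([tuple] : 0.-tuple (measurableTypeR R))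
  | n'.+1 => pushforward (@lebesgue_measure R \x @lebesgue_tuple R n')%E
               (@tuple_cons (measurableTypeR R) n')
  end.

Section lebesgue_tuple_measure.
Context (R : realType).
Local Open Scope ereal_scope.
Notation RT := (measurableTypeR R).

Let measurable_tuple_cons n :
  measurable_fun [set: RT * n.-tuple RT] (@tuple_cons RT n).
Proof. exact: measurable_cons. Qed.

Let uncons n (t : n.+1.-tuple RT) : RT * n.-tuple RT :=
  (thead t, [tuple of behead t]).

Let measurable_uncons n : measurable_fun [set: n.+1.-tuple RT] (@uncons n).
Proof.
apply/measurable_fun_pairP; split; first exact: measurable_tnth.
exact: measurable_behead.
Qed.

Let tuple_consK n : cancel (@tuple_cons RT n) (@uncons n).
Proof. by move=> [x t]; congr pair; exact/val_inj. Qed.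

Section step.
Context n (mu : {sigma_finite_measure set (n.-tuple RT) -> \bar R}).

Let nu := pushforward (@lebesgue_measure R \x mu) (@tuple_cons RT n).

Let nu_measure : {measure set (n.+1.-tuple RT) -> \bar R} :=
  measure_function_pushforward__canonical__measure_function_Measure
    (@lebesgue_measure R \x mu) (@measurable_tuple_cons n).

HB.instance Definition _ := isMeasure.Build _ _ _ nu
  (measure0 nu_measure) (measure_ge0 nu_measure)
  (@measure_semi_sigma_additive _ _ _ nu_measure).

Let nu_sigma_finite : sigma_finite setT nu.
Proof.
have /sigma_finiteP[F [TF ndF Foo]] := sigma_finiteT (@lebesgue_measure R).
have /sigma_finiteP[G [TG ndG Goo]] := sigma_finiteT mu.
exists (fun k => @uncons n @^-1` (F k `*` G k)).
  apply/esym; rewrite -subTset => t _.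
  have [i _ Fi] : (\bigcup_i F i) (uncons t).1 by rewrite -TF.
  have [j _ Gj] : (\bigcup_i G i) (uncons t).2 by rewrite -TG.
  exists (maxn i j) => //; split.
    by move: Fi; exact/subsetPset/ndF/leq_maxl.
  by move: Gj; exact/subsetPset/ndG/leq_maxr.
move=> k; have [mF Fk] := Foo k; have [mG Gk] := Goo k; split.
  by rewrite -[X in measurable X]setTI; apply: measurable_uncons => //;
    exact: measurableX.
rewrite /nu /pushforward -comp_preimage (_ : _ \o _ = id); last first.
  by apply/funext => p /=; rewrite tuple_consK.
by rewrite preimage_id product_measure1E// lte_mul_pinfty// ge0_fin_numE.
Qed.

HB.instance Definition _ := Measure_isSigmaFinite.Build _ _ _ nu nu_sigma_finite.

Definition lebesgue_tuple_step :
  {sigma_finite_measure set (n.+1.-tuple RT) -> \bar R} := nu.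

End step.

Let lebesgue_tuple_packed n :
  { mu : {sigma_finite_measure set (n.-tuple RT) -> \bar R} |
    mu = @lebesgue_tuple R n :> (set _ -> \bar R) }.
Proof.
elim: n => [|n [mu muE]]; first by exists \d_ ([tuple] : 0.-tuple RT).
by exists (lebesgue_tuple_step mu); rewrite /= -muE.
Qed.

Let lebesgue_tuple0 n : @lebesgue_tuple R n set0 = 0.
Proof. by have [mu <-] := lebesgue_tuple_packed n; exact: measure0. Qed.

Let lebesgue_tuple_ge0 n A : 0 <= @lebesgue_tuple R n A.
Proof. by have [mu <-] := lebesgue_tuple_packed n; exact: measure_ge0. Qed.

Let lebesgue_tuple_additive n : semi_sigma_additive (@lebesgue_tuple R n).
Proof.
have [mu <-] := lebesgue_tuple_packed n; exact: measure_semi_sigma_additive.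
Qed.

HB.instance Definition _ n := isMeasure.Build _ _ _ (@lebesgue_tuple R n)
  (@lebesgue_tuple0 n) (@lebesgue_tuple_ge0 n) (@lebesgue_tuple_additive n).

Let lebesgue_tuple_sigma_finite n : sigma_finite setT (@lebesgue_tuple R n).
Proof. have [mu <-] := lebesgue_tuple_packed n; exact: sigma_finiteT. Qed.

HB.instance Definition _ n := Measure_isSigmaFinite.Build _ _ _
  (@lebesgue_tuple R n) (@lebesgue_tuple_sigma_finite n).

End lebesgue_tuple_measure.

Section gaussian.
Context (R : realType).

Definition Phi (x : R) : R := fine (normal_prob 0 1 `]-oo, x]).

(* The value off ]0, 1[ is junk (0); scrambled points avoid it almost surely. *)
Definition Phi_inv (u : R) : R := xget 0 [set x | Phi x = u].

Definition normal_density d (mu : 'cV[R]_d) (Sigma : 'M[R]_d) (z : 'cV[R]_d) : R :=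
  expR (- 2^-1 * ((z - mu)^T *m invmx Sigma *m (z - mu)) 0 0) /
  Num.sqrt ((2 * pi) ^+ d * \det Sigma).

Definition gaussian_integral d (H : 'cV[R]_d -> R) : R :=
  \int[@lebesgue_tuple R d]_x
    (H (\col_j tnth x j) * normal_density 0 1%:M (\col_j tnth x j)).

Definition covariance_matrix d (Sigma : 'M[R]_d) :=
  Sigma^T = Sigma /\
  forall x : 'cV[R]_d, x != 0 -> 0 < (x^T *m Sigma *m x) 0 0.

End gaussian.

Section mixed_derivatives.
Context (R : realType) (d : nat).
Implicit Types (G : 'cV[R]_d -> R) (s : seq 'I_d) (v : {set 'I_d}).

Definition partial (j : 'I_d) G (z : 'cV[R]_d) : R := 'D_(delta_mx j 0) G z.

Definition mixed_partial s G : 'cV[R]_d -> R := foldr partial G s.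

(* All mixed partial derivatives of order at most one in each variable exist
   and are continuous, in whichever order they are taken; in particular, they
   do not depend on that order. *)
Definition mixed_smooth G :=
  forall s, uniq s ->
    continuous (mixed_partial s G) /\
    forall j z, j \notin s -> derivable (mixed_partial s G) z (delta_mx j 0).

Definition D_ v G := mixed_partial (enum v) G.

Definition QMC_friendly G :=
  forall B_ : 'I_d -> R, (forall i, 0 < B_ i) ->
  exists2 B : R, 0 < B & forall v (z : 'cV[R]_d),
    `|D_ v G z| <= B * \prod_(i < d) (1 - Phi `|z i 0|) `^ (- B_ i).

End mixed_derivatives.

Section nets.
Context (R : realType) (d b : nat).

Definition in_elementary_interval (k a : 'I_d -> nat) (x : 'cV[R]_d) : bool :=
  [forall j, (a j)%:R / b%:R ^+ k j <= x j 0 < (a j).+1%:R / b%:R ^+ k j].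

Definition is_net (t m : nat) (x : 'I_(b ^ m) -> 'cV[R]_d) :=
  [/\ (t <= m)%N,
      forall i j, 0 <= x i j 0 < 1 &
      forall k a : 'I_d -> nat, (forall j, (a j < b ^ k j)%N) ->
        \prod_(j < d) b%:R ^- k j = b%:R ^ (t%:Z - m%:Z) :> R ->
        #|[set i | in_elementary_interval k a (x i)]%SET| = (b ^ t)%N].

(* [digit b0 x k] is the coefficient of b^-(k+1) in the base-b expansion of x,
   the one that is not eventually b-1; digits are numbered from 0. *)
Definition digit (b0 : (0 < b)%N) (x : R) (k : nat) : 'I_b :=
  Ordinal (ltn_pmod (Num.truncn (x * b%:R ^+ k.+1)) b0).

Definition of_digits (u : nat -> 'I_b) : R :=
  limn (series (fun k => (u k)%:R / b%:R ^+ k.+1 : R)).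

(* [Pi j s] permutes the digit of coordinate j that follows the digits s. *)
Definition scramble (b0 : (0 < b)%N) (Pi : 'I_d -> seq 'I_b -> {perm 'I_b})
    (a : 'cV[R]_d) : 'cV[R]_d :=
  \col_j of_digits (fun k =>
    Pi j (mkseq (digit b0 (a j 0)) k) (digit b0 (a j 0) k)).

Definition QMC_estimate N (u : 'I_N -> 'cV[R]_d) (H : 'cV[R]_d -> R) : R :=
  N%:R^-1 * \sum_(i < N) H (map_mx (@Phi_inv R) (u i)).

End nets.

Section nested_uniform_scrambling.
Context (R : realType) (d b : nat).
Context (disp : measure_display) (Omega : measurableType disp).
Context (P : probability Omega R).

Definition nested_uniform (Pi : 'I_d -> seq 'I_b -> Omega -> {perm 'I_b}) :=
  [/\ forall j s (sigma : {perm 'I_b}),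
        measurable (Pi j s @^-1` [set sigma]),
      forall j s (sigma : {perm 'I_b}),
        P (Pi j s @^-1` [set sigma]) = ((b`!)%:R^-1)%:E &
      forall (S : seq ('I_d * seq 'I_b))
             (A : 'I_d * seq 'I_b -> set {perm 'I_b}), uniq S ->
        P (\bigcap_(i in [set` S]) (Pi i.1 i.2 @^-1` A i)) =
        (\prod_(i <- S) P (Pi i.1 i.2 @^-1` A i))%E].

End nested_uniform_scrambling.

Section importance_sampling.
Context (R : realType) (d : nat).

Definition IS_weight (mu0 mu : 'cV[R]_d) (Sigma L : 'M[R]_d) (z : 'cV[R]_d) : R :=
  let y := mu - mu0 + L *m z in
  (\det Sigma) `^ 2^-1 *
  expR (2^-1 * (z^T *m z) 0 0 - 2^-1 * (y^T *m y) 0 0).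

Definition IS_integrand (G : 'cV[R]_d -> R) (mu0 mu : 'cV[R]_d)
    (Sigma L : 'M[R]_d) (z : 'cV[R]_d) : R :=
  G (mu + L *m z) * IS_weight mu0 mu Sigma L z.

End importance_sampling.

(* Main.v *)
(** Since the eigenvalues of [Sigma] are at least 1, [|L z| >= |z|], so the
    weight is dominated by the exponential of a linear form; hence every mixed
    derivative of the integrand [f] is at most [C * prod_i tail (z_i) ^ (- a)]
    for each [a > 0], where [tail s = 1 - Phi |s|].

    Evaluate [f] on the nested grids of Gaussian [b]-adic quantiles.  The
    Smolyak (hyperbolic cross) combination of level [m - t] is a step function
    over elementary intervals of volume at least [b ^ (t - m)], so the net and
    the Gaussian measure integrate it to the same value, whatever the
    scrambling.  The rest of [f] is a sum of mixed differences, and a mixed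
    difference is at most the mixed derivative bound times the side lengths of
    a box; on the part of the space where all [tail (z_i)] exceed
    [b ^ (t - m)] this is [N ^ (- 1 + o(1))].

    In the remaining extreme cells the growth of [f] is only controlled in mean
    square.  At most [2 d b ^ t] net points fall there, for every scrambling,
    so Cauchy-Schwarz reduces their contribution to the second moment of [f]
    at single points, which are uniformly distributed. *)
From HB Require Import structures.
Require Import Defs.
From mathcomp Require Import all_boot all_order all_algebra all_fingroup.
From mathcomp Require Import all_classical all_reals all_analysis.
From mathcomp Require Import measurable_realfun ring lra zify.

Set Implicit Arguments.
Unset Strict Implicit.
Unset Printing Implicit Defensive.

Import Order.TTheory GRing.Theory Num.Theory.
Import numFieldNormedType.Exports.

Local Open Scope classical_set_scope.
Local Open Scope ring_scope.

(** Where the exponents come from: put [beta = b ^ (a d)] and [M = m - t]. The averaged Smolyak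
    remainder is of order [(beta ^ 3 / b) ^ M]. One factor [beta ^ M] is the derivative bound on the
    box of the grid, one absorbs the number of levels in each coordinate, and one the width of the
    grid, which grows with [M]. In the extreme cells, square integrability asks for [beta ^ 2 < b].
    Hence [a d <= eps / 3] and [a d < 1 / 2].

    The obstacle is that quantile cells have unequal lengths and become long near the ends, so no
    single length has a useful bound. Cells of one level do carry equal weight, however; lengths are
    therefore summed over a level, where they telescope to the width of the grid.

    Measurability of the integrand and of the squared error is never established. Their integrals
    are compared with those of measurable functions through monotonicity alone, which accounts for
    the dominating functions and for the care taken to keep integrands nonnegative. *)

Section gaussian_cdf.

(** * The standard normal distribution function *)

Context (R : realType).
Implicit Types x y p : R.

Notation gauss := (@normal_prob R 0 1).
Notation pdf := (@normal_pdf R 0 1).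
Notation leb := (@lebesgue_measure R).

Lemma Phi_prob x : (Phi x)%:E = gauss `]-oo, x].
Proof. by rewrite /Phi fineK// fin_num_measure. Qed.

Let pdfE x : pdf x = normal_peak 1 * expR (- x ^+ 2 / 2).
Proof.
by rewrite normal_pdfE ?oner_eq0// /normal_fun subr0 expr1n.
Qed.

Let measurable_pdf (A : set (measurableTypeR R)) : measurable_fun A (fun x => (pdf x)%:E).
Proof. by apply: measurable_funTS; apply/measurable_EFinP; exact: measurable_normal_pdf. Qed.

Lemma gauss_itvoc x y : x <= y -> gauss `]x, y] = (Phi y - Phi x)%:E.
Proof.
move=> xy; rewrite EFinB !Phi_prob.
have -> : `]-oo, y]%classic = `]-oo, x] `|` `]x, y] :> set R.
  by rewrite -itv_bndbnd_setU// bnd_simp.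
rewrite measureU//; last first.
  by apply/seteqP; split=> // z /= []; rewrite !in_itv/= => h /andP[]; rewrite ltNge h.
by rewrite [X in (X - _)%E]addeC addeK// fin_num_measure.
Qed.

Lemma Phi_ge0 x : 0 <= Phi x. Proof. by rewrite -lee_fin Phi_prob. Qed.

Lemma Phi_le1 x : Phi x <= 1.
Proof. by rewrite -lee_fin Phi_prob; exact: probability_le1. Qed.

Lemma ler_Phi x y : x <= y -> Phi x <= Phi y.
Proof.
by move=> xy; rewrite -subr_ge0 -lee_fin -gauss_itvoc.
Qed.

Let peak0 : 0 < normal_peak (1 : R).
Proof. exact: normal_peak_gt0 (oner_neq0 _). Qed.

Lemma ltr_Phi x y : x < y -> Phi x < Phi y.
Proof.
move=> xy; rewrite -subr_gt0 -lte_fin -gauss_itvoc ?ltW//.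
(* The density decreases in [|z|], and [|z| <= M] on the interval, so its value [c] at [M] bounds it
   below there. *)
pose M := Num.max `|x| `|y|.
pose c : R := normal_peak 1 * expR (- M ^+ 2 / 2).
have c0 : 0 < c by rewrite mulr_gt0 ?expR_gt0.
apply: (@lt_le_trans _ _ (\int[leb]_(z in `]x, y]) c%:E)%E).
  rewrite integral_cst//= lebesgue_measure_itv/= lte_fin xy.
  by rewrite -EFinB -EFinM lte_fin mulr_gt0// subr_gt0.
apply: ge0_le_integral; [exact: measurable_itv|..].
- by move=> z _; rewrite lee_fin ltW.
- exact: measurable_cst.
- exact: measurable_pdf.
move=> z /=; rewrite in_itv/= => /andP[xz zy].
rewrite lee_fin pdfE /c ler_pM2l// ler_expR !mulNr lerN2 ler_pM2r ?invr_gt0//.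
rewrite -[z ^+ 2]real_normK ?num_real// ler_sqr ?nnegrE ?le_max ?normr_ge0//.
have [z0|z0] := leP 0 z.
  by apply/orP; right; rewrite (ger0_norm z0) (le_trans zy)// ler_norm.
apply/orP; left; rewrite (ltr0_norm z0) -[`|x|]normrN.
by rewrite (le_trans _ (ler_norm (- x)))// lerN2 ltW.
Qed.

Lemma Phi_gt0 x : 0 < Phi x.
Proof. by apply: (le_lt_trans (Phi_ge0 (x - 1))); apply: ltr_Phi; lra. Qed.

Lemma Phi_lt1 x : Phi x < 1.
Proof. by apply: (lt_le_trans _ (Phi_le1 (x + 1))); apply: ltr_Phi; lra. Qed.

Lemma ler_PhiE x y : (Phi x <= Phi y) = (x <= y).
Proof.
by have [/ler_Phi//|/ltr_Phi] := leP x y; rewrite leNgt => ->.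
Qed.

Lemma ltr_PhiE x y : (Phi x < Phi y) = (x < y).
Proof. by rewrite !ltNge ler_PhiE. Qed.

Lemma Phi_lipschitz x y : x <= y -> Phi y - Phi x <= normal_peak 1 * (y - x).
Proof.
move=> xy; rewrite -lee_fin -gauss_itvoc//.
rewrite (@le_trans _ _ (\int[leb]_(z in `]x, y]) (normal_peak 1)%:E)%E)//.
  apply: ge0_le_integral; [exact: measurable_itv|..].
  - by move=> z _; rewrite lee_fin normal_pdf_ge0.
  - exact: measurable_pdf.
  - exact: measurable_cst.
  by move=> z _; rewrite lee_fin normal_pdf_ub// oner_eq0.
rewrite integral_cst//= lebesgue_measure_itv/= lte_fin.
case: ltP => [_|yx]; first by rewrite -EFinB -EFinM.
by rewrite mule0 lee_fin mulr_ge0 ?subr_ge0// ltW.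
Qed.

Lemma continuous_Phi : continuous (@Phi R).
Proof.
move=> x; apply/cvgrPdist_le => e e0; near=> y.
have pk := peak0; rewrite (@le_trans _ _ (normal_peak 1 * `|x - y|))//.
  have [xy|/ltW yx] := leP x y.
    rewrite distrC (distrC x) !ger0_norm ?subr_ge0 ?ler_Phi//.
    exact: Phi_lipschitz.
  by rewrite !ger0_norm ?subr_ge0 ?ler_Phi//; exact: Phi_lipschitz.
rewrite -ler_pdivlMl//; near: y.
by apply: cvgr_dist_le; [exact: cvg_id|rewrite mulr_gt0// invr_gt0].
Unshelve. all: by end_near. Qed.

(** Under the Gaussian law the identity is a random variable whose [cdf] is [Phi]; the limits of a
    [cdf] at both infinities thus apply to [Phi]. *)
Let idTR : measurableTypeR R -> R := idfun.

#[local] HB.instance Definition _ :=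
  @isMeasurableFun.Build _ _ _ _ idTR (@measurable_id _ _ setT).

Let idRV : {RV gauss >-> R} := idTR.

Let cdfE x : cdf idRV x = (Phi x)%:E.
Proof. by rewrite Phi_prob /cdf/= /distribution /pushforward/= preimage_id. Qed.

Lemma Phi_surj p : 0 < p < 1 -> exists x, Phi x = p.
Proof.
move=> /andP[p0 p1].
have [a pa] : exists a, Phi a < p.
  have /(_ [set z | z < p%:E]%E) := cvg_cdfNy0 idRV.
  have : nbhs (0%E : \bar R) [set z | z < p%:E]%E.
    by apply: open_nbhs_nbhs; split; [exact: open_ereal_lt_ereal|rewrite /= lte_fin].
  move=> N0 /(_ N0) [M [_ HM]]; exists (M - 1).
  by rewrite -lte_fin -cdfE; apply: HM; lra.
have [c pc] : exists a, p < Phi a.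
  have /(_ [set z | p%:E < z]%E) := cvg_cdfy1 idRV.
  have : nbhs (1%E : \bar R) [set z | p%:E < z]%E.
    by apply: open_nbhs_nbhs; split; [exact: open_ereal_gt_ereal|rewrite /= lte_fin].
  move=> N0 /(_ N0) [M [_ HM]]; exists (M + 1).
  by rewrite -lte_fin -cdfE; apply: HM; lra.
have ac : a <= c by rewrite -ler_PhiE; lra.
have [||z _ <-] := @IVT _ (@Phi R) a c p ac; last by exists z.
  exact/continuous_subspaceT/continuous_Phi.
by rewrite ge_min (ltW pa) le_max (ltW pc) orbT.
Qed.

Lemma Phi_invK p : 0 < p < 1 -> Phi (Phi_inv p) = p.
Proof.
move=> /Phi_surj[x xp]; rewrite /Phi_inv.
by case: xgetP => [y -> //|/(_ x)]; rewrite /= xp.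
Qed.

(* Scrambled coordinates equal to 0 or 1 are sent to the origin. *)
Lemma Phi_inv_junk p : ~~ (0 < p < 1) -> Phi_inv p = 0.
Proof.
move=> pN; rewrite /Phi_inv; case: xgetP => // x _ /= xp.
by move: pN; rewrite -xp Phi_gt0 Phi_lt1.
Qed.

Lemma gauss_itvNyo x : gauss `]-oo, x[ = (Phi x)%:E.
Proof.
rewrite Phi_prob /normal_prob -integral_itv_bndo_bndc//; exact: measurable_pdf.
Qed.

Lemma PhiN x : Phi (- x) = 1 - Phi x.
Proof.
apply: (@EFin_inj R); rewrite Phi_prob EFinB Phi_prob.
have -> : gauss `]-oo, (- x)] = gauss `[x, +oo[.
  rewrite /normal_prob ge0_integration_by_substitutionNy.
  - apply: eq_integral => z _; congr EFin => /=.
    by rewrite !pdfE sqrrN.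
  - exact/continuous_subspaceT/continuous_normal_pdf/oner_neq0.
  - by move=> z _; exact: normal_pdf_ge0.
rewrite (_ : `[x, +oo[%classic = ~` `]-oo, x[ :> set R); last by rewrite setCitvl.
have -> : gauss (~` `]-oo, x[) = (1 - gauss `]-oo, x[)%E by exact: probability_setC.
by rewrite gauss_itvNyo -Phi_prob.
Qed.

Lemma Phi0 : Phi (0 : R) = 2^-1.
Proof. by have := PhiN 0; rewrite oppr0; lra. Qed.

Lemma gauss_Phi_lt p : 0 <= p <= 1 -> gauss [set x | Phi x < p] = p%:E.
Proof.
move=> /andP[]; rewrite le_eqVlt => /predU1P[<- _|p0].
  rewrite (_ : [set _ | _] = set0) ?measure0//.
  by apply/seteqP; split=> // x /=; rewrite ltNge Phi_ge0.
rewrite le_eqVlt => /predU1P[->|p1].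
  rewrite (_ : [set _ | _] = setT) ?probability_setT//.
  by apply/seteqP; split=> // x /=; rewrite Phi_lt1.
have pE := @Phi_invK p; rewrite p0 p1 in pE.
rewrite -[in RHS]pE// -gauss_itvNyo; congr (gauss _).
by apply/seteqP; split=> x /=; rewrite in_itv/= -[x < _]ltr_PhiE pE.
Qed.

Lemma measurable_Phi : measurable_fun [set: R] (@Phi R).
Proof. by apply: nondecreasing_measurable => // x y; exact: ler_Phi. Qed.

Lemma gauss_Phi_ge p : 0 <= p <= 1 -> gauss [set x | p <= Phi x] = (1 - p)%:E.
Proof.
move=> p01; rewrite (_ : [set _ | _] = ~` [set x | Phi x < p]).
  set A := [set x | Phi x < p].
  have -> : gauss (~` A) = (1 - gauss A)%E.
    apply: probability_setC; rewrite -[X in measurable X]setTI.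
    have -> : A = @Phi R @^-1` `]-oo, p[.
      by apply/seteqP; split=> x /=; rewrite in_itv.
    exact: measurable_Phi.
  by rewrite gauss_Phi_lt.
by apply/seteqP; split=> x /=; rewrite leNgt => /negP.
Qed.

(** Exponential tilting: the densities of [N(0, 1)] and [N(lam, 1)] have ratio
    [exp (lam ^ 2 / 2 - lam z)] at [z], which for [z > x] is at most the right-hand side because
    [lam >= 0]; the tilted law has mass at most 1. *)
Lemma Phi_chernoff x lam : 0 <= lam -> 1 - Phi x <= expR (lam ^+ 2 / 2 - lam * x).
Proof.
move=> l0; rewrite -lee_fin EFinB Phi_prob -probability_setC//.
rewrite setCitvl; set c := expR _.
rewrite (@le_trans _ _ (\int[leb]_(z in `]x, +oo[) (c%:E * (normal_pdf lam 1 z)%:E))%E)//.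
  apply: ge0_le_integral; [exact: measurable_itv|..].
  - by move=> z _; rewrite lee_fin normal_pdf_ge0.
  - exact: measurable_pdf.
  - apply: measurable_funeM; apply: measurable_funTS.
    by apply/measurable_EFinP; exact: measurable_normal_pdf.
  move=> z /=; rewrite in_itv/= andbT => xz.
  rewrite -EFinM lee_fin pdfE normal_pdfE ?oner_eq0// /normal_fun expr1n.
  rewrite mulrCA ler_pM2l// /c -expRD ler_expR.
  have : lam * x <= lam * z by rewrite ler_wpM2l// ltW.
  nra.
rewrite ge0_integralZl//=.
- rewrite -[leRHS]mule1 lee_wpmul2l ?lee_fin ?expR_ge0//.
  exact: (probability_le1 (normal_prob lam 1)).
- apply: measurable_funTS; apply/measurable_EFinP.
  exact: measurable_normal_pdf.
- by move=> z _; rewrite lee_fin normal_pdf_ge0.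
- by rewrite lee_fin expR_ge0.
Qed.

End gaussian_cdf.

(** * Eigenvalues at least 1 and expansion by [L] *)

Section rayleigh.
Context (R : realType) (d : nat).
Implicit Types (v w : 'rV[R]_d) (A : 'M[R]_d).

Let Q A v : R := (v *m A *m v^T) 0 0.

Let QE A v : Q A v = \sum_i (\sum_k v 0 k * A k i) * v 0 i.
Proof. by rewrite /Q mxE; apply: eq_bigr => i _; rewrite !mxE. Qed.

Let QI v : Q 1%:M v = \sum_i v 0 i ^+ 2.
Proof.
by rewrite /Q mulmx1 mxE; apply: eq_bigr => i _; rewrite mxE expr2.
Qed.

Let QZ A c v : Q A (c *: v) = c ^+ 2 * Q A v.
Proof. by rewrite /Q !linearZ/= -!scalemxAl !mxE; ring. Qed.

Let continuous_Q A : continuous (Q A).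
Proof.
rewrite (_ : Q A = fun v => \sum_i (\sum_k v 0 k * A k i) * v 0 i); last first.
  by apply/funext => v; exact: QE.
apply: continuous_big => [|i _]; first exact: add_continuous.
have cA : continuous (fun v : 'rV[R]_d => \sum_k v 0 k * A k i).
  apply: continuous_big => [|k _]; first exact: add_continuous.
  move=> v; have cv : (fun w : 'rV[R]_d => w 0 k) @ v --> v 0 k.
    exact: coord_continuous.
  exact: (cvgM cv (cvg_cst _)).
move=> v; have cv : (fun w : 'rV[R]_d => w 0 i) @ v --> v 0 i.
  exact: coord_continuous.
exact: (cvgM (cA v) cv).
Qed.

Let Q1_gt0 v : v != 0 -> 0 < Q 1%:M v.
Proof.
move=> v0; rewrite lt0r QI sumr_ge0 ?andbT; last by move=> i _; exact: sqr_ge0.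
apply: contra v0 => /eqP s0; apply/eqP/rowP => i; apply/eqP.
rewrite mxE -sqrf_eq0 eq_le sqr_ge0 andbT -s0 (bigD1 i)//= lerDl.
by apply: sumr_ge0 => k _; exact: sqr_ge0.
Qed.

Let QD A v w : A^T = A -> Q A (v + w) = Q A v + 2 * (v *m A *m w^T) 0 0 + Q A w.
Proof.
move=> AT; rewrite /Q; have -> : (v + w)^T = v^T + w^T by rewrite linearD.
rewrite mulmxDl mulmxDr 2!mulmxDl.
have -> : w *m A *m v^T = (v *m A *m w^T)^T by rewrite !trmx_mul trmxK AT mulmxA.
by rewrite !mxE; ring.
Qed.

(** Minimisation replaces diagonalisation: on the compact unit sphere the form attains a minimum
    [lam], which homogeneity turns into a global bound, and the minimiser is an eigenvector, so
    [lam >= 1]. *)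
Lemma rayleigh_lower_bound A : A^T = A ->
  (forall lambda, eigenvalue A lambda -> 1 <= lambda) ->
  forall v, (v *m v^T) 0 0 <= (v *m A *m v^T) 0 0.
Proof.
move=> AT A1 v; have -> : (v *m v^T) 0 0 = Q 1%:M v by rewrite /Q mulmx1.
rewrite -/(Q A v).
have [->|v0] := eqVneq v 0; first by rewrite /Q !mul0mx.
pose S := [set v | Q 1%:M v = 1].
have normS w : w != 0 -> S ((Num.sqrt (Q 1%:M w))^-1 *: w).
  move=> w0; rewrite /S/= QZ exprVn sqr_sqrtr ?mulVf ?gt_eqF ?Q1_gt0//.
  by rewrite ltW ?Q1_gt0.
have cS : compact S.
  apply: bounded_closed_compact.
    exists 1; split=> // M M1 w Sw; rewrite /= -[`|w|]/(mx_norm w) mx_normrE.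
    apply/bigmax_leP; split=> [|[i k] _ /=]; first exact: ltW (lt_trans _ M1).
    apply: le_trans (ltW M1); rewrite ord1 -(@ler_pXn2r _ 2)// ?nnegrE//.
    rewrite expr1n real_normK ?num_real// -Sw QI (bigD1 k)//= lerDl sumr_ge0//.
    by move=> l _; exact: sqr_ge0.
  rewrite (_ : S = Q 1%:M @^-1` [set 1])//.
  by apply: preimage_closed => [? _|]; [exact: continuous_Q|exact: closed_eq].
have [u Su Qu] : exists2 c, c \in S & forall t, t \in S -> Q A c <= Q A t.
  apply: compact_EVT_min => //; first by exists ((Num.sqrt (Q 1%:M v))^-1 *: v); exact: normS.
  exact/continuous_subspaceT/continuous_Q.
rewrite inE in Su; set lam := Q A u in Qu.
have minQ w : lam * Q 1%:M w <= Q A w.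
  have [->|w0] := eqVneq w 0; first by rewrite /Q !mul0mx !mxE mulr0.
  have := Qu _ (mem_set (normS w w0)); rewrite QZ exprVn (sqr_sqrtr (ltW (Q1_gt0 w0))).
  by move=> H; rewrite -ler_pdivlMr ?Q1_gt0// mulrC.
pose B := A - lam%:M.
have BT : B^T = B by rewrite /B linearB/= tr_scalar_mx AT.
have BE w : Q B w = Q A w - lam * Q 1%:M w.
  by rewrite /Q /B mulmxBr mul_mx_scalar mulmxBl -scalemxAl mulmx1 !mxE.
have B0 w : 0 <= Q B w by rewrite BE subr_ge0.
have Bu : Q B u = 0 by rewrite BE Su mulr1 subrr.
(* A semidefinite form vanishing at [u] has [u] in its kernel. Along [u + x w] with [w = u B] the
   form equals [2 x n + x ^ 2 c], and [x = - n / (c + 1)] would make it negative; the 1 covers the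
   case [c = 0]. *)
have uB : u *m B = 0.
  apply/eqP; apply: contraT => uB0.
  pose w := u *m B; pose n := Q 1%:M w; pose c := Q B w.
  have n0 : 0 < n by exact: Q1_gt0.
  have c0 : 0 <= c by exact: B0.
  have H x : 0 <= 2 * x * n + x ^+ 2 * c.
    have := B0 (u + x *: w); rewrite QD// Bu add0r QZ.
    rewrite linearZ/= -scalemxAr mxE -/w.
    by rewrite (_ : (w *m w^T) 0 0 = n) ?mulrA// /n /Q mulmx1.
  have := H (- (n / (c + 1))).
  have -> : 2 * - (n / (c + 1)) * n + (- (n / (c + 1))) ^+ 2 * c =
     - (n ^+ 2 * (c + 2) / (c + 1) ^+ 2) by field; rewrite gt_eqF// ltr_wpDl.
  rewrite oppr_ge0 leNgt => /negP[]; rewrite divr_gt0 ?exprn_gt0 ?ltr_wpDl//.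
  by rewrite mulr_gt0 ?exprn_gt0// ltr_wpDl.
have /A1 lam1 : eigenvalue A lam.
  apply/eigenvalueP; exists u; last first.
    by apply/eqP => u0; move: Su; rewrite u0 /S /Q/= !mul0mx mxE => /eqP; rewrite eq_sym oner_eq0.
  by apply/eqP; rewrite -subr_eq0 -mul_mx_scalar -mulmxBr uB.
by apply: le_trans (minQ v); rewrite ler_peMl// ltW// Q1_gt0.
Qed.

(** The Rayleigh bound is wanted for [L^T L], while the hypothesis is on [L L^T]. An eigenvector [v]
    of the former gives the eigenvector [v L^T] of the latter for the same eigenvalue. It is
    nonzero, since otherwise [L L^T] would be singular and have the eigenvalue 0. *)
Lemma expansive_of_eigenvalues (L : 'M[R]_d) :
  (forall lambda, eigenvalue (L *m L^T) lambda -> 1 <= lambda) ->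
  forall z : 'cV[R]_d, (z^T *m z) 0 0 <= ((L *m z)^T *m (L *m z)) 0 0.
Proof.
move=> E z.
have /rayleigh_lower_bound : (L^T *m L)^T = L^T *m L by rewrite trmx_mul trmxK.
move=> /(_ _ z^T); rewrite trmxK trmx_mul !mulmxA; apply.
move=> lam /eigenvalueP[v vE v0]; apply: (E); apply/eigenvalueP.
exists (v *m L^T); first by rewrite mulmxA -(mulmxA v) vE -scalemxAl.
apply/eqP => vL0.
have : eigenvalue (L *m L^T) 0.
  have /det0P[w w0 wL] : \det (L *m L^T) == 0.
    rewrite det_mulmx mulf_eq0; apply/orP; right; apply/det0P; exists v => //.
  by apply/eigenvalueP; exists w => //; rewrite scale0r.
by move/E; rewrite ler10.
Qed.

End rayleigh.

(** * Freezing one coordinate, and mixed derivatives *)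

Section coordinate_updates.
Context (R : realType) (d : nat).
Implicit Types (f g : 'cV[R]_d -> R) (z : 'cV[R]_d) (j : 'I_d) (s w : seq 'I_d).

Definition upd z j (x : R) : 'cV[R]_d := \col_i (if i == j then x else z i 0).

Lemma upd_id z j : upd z j (z j 0) = z.
Proof. by apply/colP => i; rewrite mxE; case: eqP => // ->. Qed.

Lemma upd_shift z j x h : upd z j (h + x) = h *: delta_mx j 0 + upd z j x.
Proof.
by apply/colP => i; rewrite !mxE eqxx andbT; case: eqP => _; rewrite ?mulr1 ?mulr0 ?add0r.
Qed.

Lemma upd_addC z j i x h : i != j ->
  upd (h *: delta_mx i 0 + z) j x = h *: delta_mx i 0 + upd z j x.
Proof.
move=> ij; apply/colP => k; rewrite !mxE eqxx andbT; case: (eqVneq k j) => [->|//].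
by rewrite eq_sym (negbTE ij) mulr0 add0r.
Qed.

Let upd_quotient f z j x :
  (fun h : R => h^-1 *: (((fun x : R => f (upd z j x)) \o shift x) (h *: 1) -
    f (upd z j x))) =
  (fun h : R => h^-1 *: ((f \o shift (upd z j x)) (h *: delta_mx j 0) -
    f (upd z j x))).
Proof.
by apply/funext => h /=; rewrite -upd_shift -[h *: 1]/(h * 1) mulr1.
Qed.

Let comp_upd_quotient f z i j x : i != j ->
  (fun h : R => h^-1 *: (((fun z => f (upd z j x)) \o shift z)
    (h *: delta_mx i 0) - f (upd z j x))) =
  (fun h : R => h^-1 *: ((f \o shift (upd z j x)) (h *: delta_mx i 0) -
    f (upd z j x))).
Proof. by move=> ij; apply/funext => h /=; rewrite upd_addC. Qed.

Lemma derivable_upd f z j x :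
  derivable f (upd z j x) (delta_mx j 0) -> derivable (fun x => f (upd z j x)) x 1.
Proof.
by rewrite /derivable -upd_quotient.
Qed.

Lemma derive_upd f z j x :
  'D_1 (fun x => f (upd z j x)) x = partial j f (upd z j x).
Proof.
by rewrite /partial /derive -upd_quotient.
Qed.

Lemma derivable_comp_upd f z i j x : i != j ->
  derivable f (upd z j x) (delta_mx i 0) ->
  derivable (fun z => f (upd z j x)) z (delta_mx i 0).
Proof.
by move=> ij; rewrite /derivable -comp_upd_quotient.
Qed.

Lemma partial_comp_upd f i j x : i != j ->
  partial i (fun z => f (upd z j x)) = fun z => partial i f (upd z j x).
Proof.
by move=> ij; apply/funext => z; rewrite /partial /derive -comp_upd_quotient.
Qed.

Lemma mixed_partial_comp_upd f w j x : j \notin w ->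
  mixed_partial w (fun z => f (upd z j x)) =
  fun z => mixed_partial w f (upd z j x).
Proof.
elim: w => [//|i w IH]; rewrite inE negb_or => /andP[ji jw] /=.
by rewrite IH// partial_comp_upd// eq_sym.
Qed.

(** Only subsequences of [s] occur, always in the order of [s], so partial derivatives never have to
    be commuted. *)
Definition mixed_derivable s f := forall i w, subseq (i :: w) s ->
  forall z, derivable (mixed_partial w f) z (delta_mx i 0).

Lemma mixed_partialB s f g w : mixed_derivable s f -> mixed_derivable s g ->
  subseq w s ->
  mixed_partial w (fun z => f z - g z) =
  fun z => mixed_partial w f z - mixed_partial w g z.
Proof.
move=> df dg; elim: w => [//|i w IH] iws /=.
rewrite IH; last exact: subseq_trans (subseq_cons w i) iws.
by apply/funext => z; rewrite /partial deriveB//; [exact: df|exact: dg].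
Qed.

Definition inbox (lo hi : R) z := forall i, lo <= z i 0 <= hi.

Lemma inbox_upd lo hi z j x : inbox lo hi z -> lo <= x <= hi ->
  inbox lo hi (upd z j x).
Proof. by move=> zb xb i; rewrite mxE; case: ifP. Qed.

Definition mixed_bounded (lo hi : R) s f (B : R) :=
  mixed_derivable s f /\ forall w, subseq w s ->
  forall z, inbox lo hi z -> `|mixed_partial w f z| <= B.

Lemma mean_value_upd lo hi f j B z x x' :
  (forall z, derivable f z (delta_mx j 0)) ->
  (forall z, inbox lo hi z -> `|partial j f z| <= B) ->
  inbox lo hi z -> lo <= x <= hi -> lo <= x' <= hi ->
  `|f (upd z j x) - f (upd z j x')| <= B * `|x - x'|.
Proof.
move=> df Bf zb.
wlog xx' : x x' / x' <= x => [H xb x'b|xb x'b].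
  have [|/ltW] := leP x' x => h; first exact: H.
  by rewrite distrC [X in _ <= _ * X]distrC; exact: H.
have dg y : derivable (fun x => f (upd z j x)) y 1 by exact: derivable_upd.
have [||y yx ->] := @MVT_segment _ (fun x => f (upd z j x))
    (fun y => partial j f (upd z j y)) x' x xx'.
- by move=> y _; apply: DeriveDef; [exact: dg|exact: derive_upd].
- apply: continuous_subspaceT => y.
  exact/differentiable_continuous/derivable1_diffP.
rewrite normrM ler_wpM2r// Bf//; apply: inbox_upd => //.
move: yx xb x'b; rewrite in_itv/= => /andP[? ?] /andP[? ?] /andP[? ?].
by apply/andP; split; lra.
Qed.

End coordinate_updates.

(** * The Smolyak combination and its pointwise error *)

Section smolyak.
Context (R : realType) (d : nat).
Implicit Types (f g : 'cV[R]_d -> R) (z : 'cV[R]_d) (j : 'I_d) (s w : seq 'I_d).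
Implicit Types (y l : 'I_d -> nat -> R).

(** Level 0 has no previous node ([None]), and its difference is plain evaluation. *)
Definition level_diff (j : 'I_d) (x : R) (x' : option R) f : 'cV[R]_d -> R :=
  fun z => f (upd z j x) - (if x' is Some x' then f (upd z j x') else 0).

Definition prev_node y j k := if k is k'.+1 then Some (y j k') else None.

(** The hyperbolic cross: the sum, over level vectors of total at most [M], of the tensor products
    of one-dimensional differences between consecutive nodes. *)
Fixpoint smolyak y s M f : 'cV[R]_d -> R :=
  if s is j :: s' then fun z => \sum_(k < M.+1)
    smolyak y s' (M - k)%N (level_diff j (y j k) (prev_node y j k) f) z
  else f.

(** The error recursion for derivative bound 1, when [l j k] bounds the step to the node of level
    [k]. *)
Fixpoint smolyak_rem l s M : R :=
  if s is j :: s' then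
    \sum_(k < M.+1) l j k * smolyak_rem l s' (M - k)%N + l j M.+1
  else 0.

Lemma smolyak_rem_ge0 l s M : (forall j k, 0 <= l j k) -> 0 <= smolyak_rem l s M.
Proof.
move=> l0; elim: s M => [//|j s IH] M /=.
by rewrite addr_ge0// sumr_ge0// => k _; rewrite mulr_ge0.
Qed.

Lemma smolyak_ext y s M f z z' :
  (forall z z', (forall j, j \in s -> z j 0 = z' j 0) -> f z = f z') ->
  smolyak y s M f z = smolyak y s M f z'.
Proof.
elim: s M f => [|j s IH] M f fE /=; first exact: fE.
apply: eq_bigr => k _; apply: IH => u v uv; rewrite /level_diff.
have updE x : f (upd u j x) = f (upd v j x).
  apply: fE => i; rewrite inE => /predU1P[->|/uv E]; rewrite !mxE ?eqxx//.
  by rewrite E.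
by rewrite updE; case: prev_node => [x|]; rewrite ?updE.
Qed.

(** A difference in [j] spends the one derivative available in that coordinate and gains the factor
    [e]; at level 0 nothing is gained and [e = 1]. *)
Lemma level_diff_mixed_bounded lo hi j s f B x x' (e : R) :
  j \notin s -> 0 <= B -> 
  mixed_bounded lo hi (j :: s) f B -> lo <= x <= hi ->
  (if x' is Some x' then (lo <= x' <= hi) /\ `|x - x'| <= e else e = 1) ->
  mixed_bounded lo hi s (level_diff j x x' f) (B * e).
Proof.
move=> js B0 [df Bf] xb.
have sub w : subseq w s -> subseq w (j :: s).
  by move=> ws; exact: subseq_trans ws (subseq_cons s j).
have nin w : subseq w s -> j \notin w.
  by move=> ws; apply: contra js; exact: mem_subseq.
have du x1 : mixed_derivable s (fun z => f (upd z j x1)).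
  move=> i w iws z; have := nin _ iws; rewrite inE negb_or => /andP[ji jw].
  rewrite mixed_partial_comp_upd//; apply: derivable_comp_upd; first by rewrite eq_sym.
  by apply: df; exact: sub.
case: x' => [x'|] /=; last first.
  move=> ->; rewrite mulr1.
  have -> : level_diff j x None f = fun z => f (upd z j x).
    by apply/funext => z; rewrite /level_diff subr0.
  split=> // w ws z zb; rewrite mixed_partial_comp_upd ?nin//.
  by apply: Bf; [exact: sub|exact: inbox_upd].
move=> [x'b xx'].
have mpE w : subseq w s -> mixed_partial w (level_diff j x (Some x') f) =
    fun z => mixed_partial w f (upd z j x) - mixed_partial w f (upd z j x').
  move=> ws; rewrite /level_diff (mixed_partialB (du x) (du x') ws).
  by rewrite !mixed_partial_comp_upd ?nin.
split=> [i w iws z|w ws z zb].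
  rewrite mpE; last exact: subseq_trans (subseq_cons w i) iws.
  have := nin _ iws; rewrite inE negb_or => /andP[ji jw].
  apply: derivableB; apply: derivable_comp_upd; rewrite 1?eq_sym//;
    by apply: df; exact: sub.
rewrite mpE//; apply: le_trans (ler_wpM2l B0 xx').
apply: (@mean_value_upd _ _ lo hi) => //.
  by apply: df; rewrite /= eqxx.
by apply: (Bf (j :: w)); rewrite /= eqxx.
Qed.

(** Induction on the coordinates. The differences in [j] telescope to [f] with coordinate [j] frozen
    at its node of level [M], which costs [l j M.+1]. The difference of level [k] is approximated
    with the remaining budget [M - k], its derivative bound having been multiplied by [l j k]. *)
Lemma smolyak_error lo hi y l s M N f B z :
  uniq s -> 0 <= B -> mixed_bounded lo hi s f B -> inbox lo hi z -> (M <= N)%N ->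
  (forall j k, (k <= N)%N -> lo <= y j k <= hi) ->
  (forall j, l j 0 = 1) -> (forall j k, 0 <= l j k) ->
  (forall j k, (k < N)%N -> `|y j k.+1 - y j k| <= l j k.+1) ->
  (forall j k, (k <= N)%N -> `|z j 0 - y j k| <= l j k.+1) ->
  `|f z - smolyak y s M f z| <= B * smolyak_rem l s M.
Proof.
move=> us B0 Bf zb MN yb l1 l0 yl zl.
elim: s M f B us B0 Bf MN => [|j s IH] M f B /=.
  by rewrite subrr normr0 mulr0.
move=> /andP[js us] B0 Bf MN.
pose D k := level_diff j (y j k) (prev_node y j k) f.
have telD : \sum_(k < M.+1) D k z = f (upd z j (y j M)).
  elim: M {MN} => [|M IHM]; rewrite big_ord_recr/=.
    by rewrite big_ord0 add0r /D /level_diff /= subr0.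
  by rewrite IHM /D /level_diff /= addrC subrK.
rewrite -[X in `|f z - X|]/(\sum_(k < M.+1) smolyak y s (M - k)%N (D k) z).
have -> : f z - \sum_(k < M.+1) smolyak y s (M - k)%N (D k) z =
    \sum_(k < M.+1) (D k z - smolyak y s (M - k)%N (D k) z) +
    (f (upd z j (z j 0)) - f (upd z j (y j M))).
  by rewrite sumrB telD upd_id; ring.
rewrite (le_trans (ler_normD _ _))// mulrDr lerD//.
  rewrite (le_trans (ler_norm_sum _ _ _))// mulr_sumr ler_sum// => k _.
  have kM : (k <= M)%N by rewrite -ltnS.
  rewrite mulrA; apply: IH => //; first by rewrite mulr_ge0.
    apply: level_diff_mixed_bounded => //.
      by apply: yb; exact: leq_trans MN.
    case: k kM => [[|k] /= kM1] kM //; split.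
      by apply: yb; apply: leq_trans MN; exact: ltnW.
    by apply: yl; exact: leq_trans MN.
  by rewrite (leq_trans (leq_subr _ _)).
have [df dB] := Bf.
apply: le_trans (ler_wpM2l B0 (zl j M MN)).
apply: (@mean_value_upd _ _ lo hi) => //.
- by apply: (df j [::]); rewrite /= eqxx sub0seq.
- by apply: (dB [:: j]); rewrite /= eqxx sub0seq.
- exact: yb.
Qed.

End smolyak.

(** * Weighted families that give elementary intervals their volume *)

Section net_families.
Context (R : realType) (d b M : nat) (b1 : (1 < b)%N).
Implicit Types (r a : 'I_d -> nat) (f : 'cV[R]_d -> R) (j : 'I_d) (s : seq 'I_d).

(** Finest cells are numbered by [M] base-[b] digits; dropping the last [M - k] of them numbers the
    enclosing cell of level [k]. *)
Definition coarse (k c : nat) : nat := (c %/ b ^ (M - k))%N.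

Definition in_cell (c : 'I_d -> nat) r a := [forall j, coarse (r j) (c j) == a j].

(* Common abstraction of the empirical measure of a net and of the uniform
   measure on the finest cells. *)
Definition net_weights (I : finType) (w : I -> R) (c : I -> 'I_d -> nat) :=
  (forall i j, (c i j < b ^ M)%N) /\
  forall r a, (\sum_j r j <= M)%N -> (forall j, (a j < b ^ r j)%N) ->
    \sum_(i | in_cell (c i) r a) w i = b%:R ^- (\sum_j r j).

Definition set_at r j (k : nat) : 'I_d -> nat := fun i => if i == j then k else r i.

Lemma sum_set_at r j k : r j = 0%N -> (\sum_i set_at r j k i = \sum_i r i + k)%N.
Proof.
move=> rj; rewrite (bigD1 j)//= [X in (_ = X + _)%N](bigD1 j)//= rj add0n.
rewrite {1}/set_at eqxx addnC; congr (_ + _)%N.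
by apply: eq_bigr => i ij; rewrite /set_at (negbTE ij).
Qed.

Lemma coarse_lt k c : (k <= M)%N -> (c < b ^ M)%N -> (coarse k c < b ^ k)%N.
Proof.
move=> kM cM; rewrite /coarse ltn_divLR ?expn_gt0 ?(ltnW b1)//.
by rewrite -expnD subnKC.
Qed.

Lemma coarse_mul_le k c : (coarse k c * b ^ (M - k) <= c)%N.
Proof. exact: leq_divM. Qed.

Lemma lt_coarse_mul k c : (c < (coarse k c).+1 * b ^ (M - k))%N.
Proof. by apply: ltn_ceil; rewrite expn_gt0 (ltnW b1). Qed.

Lemma coarse_pred k c : (k < M)%N -> coarse k c = (coarse k.+1 c %/ b)%N.
Proof.
by move=> kM; rewrite /coarse -divnMA -expnSr -[in RHS]subSn// subSS.
Qed.

Lemma cell_partition (I : finType) (c : I -> 'I_d -> nat) (F : I -> R) r a j k :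
  (forall i j, (c i j < b ^ M)%N) -> (k <= M)%N -> r j = 0%N -> a j = 0%N ->
  \sum_(i | in_cell (c i) r a) F i =
  \sum_(h < b ^ k) \sum_(i | in_cell (c i) (set_at r j k) (set_at a j h)) F i.
Proof.
move=> cM kM rj aj.
have bk0 : (0 < b ^ k)%N by rewrite expn_gt0 (ltnW b1).
pose q i : 'I_(b ^ k) := Ordinal (coarse_lt kM (cM i j)).
rewrite (partition_big q xpredT)//=; apply: eq_bigr => h _; apply: eq_bigl => i.
apply/andP/forallP => [[/forallP ia /eqP <-] j'|ih].
  by rewrite /set_at; case: (eqVneq j' j) => [->//|_]; exact: ia.
split; last by apply/eqP/val_inj/eqP; have := ih j; rewrite /set_at eqxx.
apply/forallP => j'; have := ih j'; rewrite /set_at.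
case: (eqVneq j' j) => [->|//] _.
by rewrite rj aj /coarse subn0 divn_small.
Qed.

Section nodes.
Context (tau : nat -> R).

(** The left end of the enclosing cell of level [k]. It depends on [coarse k c] only, so that
    elementary intervals resolve it. *)
Definition node (c : nat) (k : nat) : R := tau (coarse k c * b ^ (M - k))%N.

Definition prev_cell_node (k h : nat) : option R :=
  if k is k'.+1 then Some (tau (h %/ b * b ^ (M - k'))%N) else None.

Fixpoint smolyak_quad s m f : 'cV[R]_d -> R :=
  if s is j :: s' then fun z => \sum_(k < m.+1) \sum_(h < b ^ k)
    b%:R ^- k * smolyak_quad s' (m - k)%N
      (level_diff j (tau (h * b ^ (M - k))%N) (prev_cell_node k h) f) z
  else f.

(** A term with levels of total at most [M] is constant on boxes of total depth at most [M], and
    [net_weights] prescribes their weights. The induction carries in [r] and [a] the box already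
    fixed by the coordinates treated. *)
Lemma smolyak_exact (I : finType) (w : I -> R) (c : I -> 'I_d -> nat) s m f z r a :
  net_weights w c -> uniq s -> (\sum_j r j + m <= M)%N ->
  (forall j, (a j < b ^ r j)%N) -> (forall j, j \in s -> r j = 0%N /\ a j = 0%N) ->
  \sum_(i | in_cell (c i) r a) w i * smolyak (fun j => node (c i j)) s m f z =
  b%:R ^- (\sum_j r j) * smolyak_quad s m f z.
Proof.
move=> [cM wc]; elim: s m f r a => [|j s IH] m f r a /=.
  by move=> _ rM ab _; rewrite -mulr_suml wc// (leq_trans _ rM) ?leq_addr.
move=> /andP[js us] rM ab ra0.
under eq_bigr do rewrite mulr_sumr.
rewrite exchange_big/= mulr_sumr; apply: eq_bigr => k _.
have km : (k <= m)%N by rewrite -ltnS.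
have kM : (k <= M)%N by rewrite (leq_trans km)// (leq_trans _ rM) ?leq_addl.
have [rj aj] := ra0 j (mem_head _ _).
rewrite (cell_partition _ cM kM rj aj) mulr_sumr; apply: eq_bigr => h _.
rewrite mulrA -invfM -exprD -(sum_set_at k rj).
rewrite -(IH _ _ (set_at r j k) (set_at a j h))//.
- apply: eq_bigr => i /forallP/(_ j); rewrite /set_at eqxx => /eqP ih.
  have -> : prev_node (fun j => node (c i j)) j k = prev_cell_node k h.
    case: {km} (nat_of_ord k) h ih kM => [//|k'] h /= ih kM.
    by rewrite /node coarse_pred// ih.
  by rewrite /node ih.
- by rewrite sum_set_at// -addnA subnKC.
- by move=> i; rewrite /set_at; case: eqP.
- move=> i si; rewrite /set_at; case: eqP => [ij|_]; last by apply: ra0; rewrite inE si orbT.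
  by rewrite -ij si in js.
Qed.

Context (tau_mono : forall c c', (c <= c' <= b ^ M)%N -> tau c <= tau c').

Definition cell_length (k h : nat) : R :=
  tau (h.+1 * b ^ (M - k))%N - tau (h * b ^ (M - k))%N.

(** The shift of index: the nodes of levels [k] and [k.+1] and the point itself all lie in one cell
    of level [k], whose length thus bounds the step to level [k.+1] as well as the distance from the
    node of level [k]. *)
Definition level_length (c : nat) (k : nat) : R :=
  if k is k'.+1 then cell_length k' (coarse k' c) else 1.

Lemma cell_length_ge0 k h : (k <= M)%N -> (h < b ^ k)%N -> 0 <= cell_length k h.
Proof.
move=> kM hk; rewrite subr_ge0 tau_mono// leq_mul2r leqnSn orbT/=.
by rewrite -{2}(subnKC kM) expnD leq_mul2r hk orbT.
Qed.

Lemma sum_cell_length k : (k <= M)%N ->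
  \sum_(h < b ^ k) cell_length k h = tau (b ^ M)%N - tau 0%N.
Proof.
move=> kM; rewrite -(big_mkord xpredT (cell_length k)).
have := telescope_sumr (fun h => tau (h * b ^ (M - k))%N) (leq0n (b ^ k)).
by rewrite mul0n -expnD subnKC// => <-.
Qed.

Lemma node_range k c : (c < b ^ M)%N -> tau 0%N <= node c k <= tau (b ^ M)%N.
Proof.
move=> cM; rewrite /node; have := coarse_mul_le k c => h.
have h' := leq_trans h (ltnW cM).
by rewrite !tau_mono ?leq0n ?leqnn ?h'.
Qed.

Lemma node_step k c : (k < M)%N -> (c < b ^ M)%N ->
  `|node c k.+1 - node c k| <= level_length c k.+1.
Proof.
move=> kM cM; rewrite /level_length /cell_length /node.
set h := coarse k c.
have hb : (h * b ^ (M - k) <= coarse k.+1 c * b ^ (M - k.+1))%N.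
  rewrite /h coarse_pred// -(subnSK kM).
  rewrite expnS mulnA leq_mul2r; apply/orP; right; exact: leq_divM.
have cb := coarse_mul_le k.+1 c.
have ch := lt_coarse_mul k c; rewrite -/h in ch.
have hM : (h.+1 * b ^ (M - k) <= b ^ M)%N.
  by rewrite -{2}(subnKC (ltnW kM)) expnD leq_mul2r coarse_lt ?orbT// ltnW.
have t1 : tau (h * b ^ (M - k))%N <= tau (coarse k.+1 c * b ^ (M - k.+1))%N.
  by apply: tau_mono; rewrite hb/= (leq_trans cb) ?(ltnW cM).
have t2 : tau (coarse k.+1 c * b ^ (M - k.+1))%N <= tau (h.+1 * b ^ (M - k))%N.
  by apply: tau_mono; rewrite hM andbT (leq_trans cb) ?(ltnW ch).
by rewrite ger0_norm ?subr_ge0// lerD2r.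
Qed.

Lemma node_dist k c x : (k <= M)%N -> (c < b ^ M)%N -> tau c <= x <= tau c.+1 ->
  `|x - node c k| <= level_length c k.+1.
Proof.
move=> kM cM /andP[cx xc]; rewrite /level_length /cell_length /node.
set h := coarse k c.
have cb := coarse_mul_le k c; rewrite -/h in cb.
have ch := lt_coarse_mul k c; rewrite -/h in ch.
have hM : (h.+1 * b ^ (M - k) <= b ^ M)%N.
  by rewrite -{2}(subnKC kM) expnD leq_mul2r coarse_lt ?orbT.
have t1 : tau (h * b ^ (M - k))%N <= tau c.
  by apply: tau_mono; rewrite cb ltnW.
have t2 : tau c.+1 <= tau (h.+1 * b ^ (M - k))%N.
  by apply: tau_mono; rewrite hM andbT.
rewrite ger0_norm ?subr_ge0 ?(le_trans t1)//.
by rewrite lerD2r (le_trans xc).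
Qed.

Context (Lam : R) (Lam1 : 1 <= Lam) (tauLam : tau (b ^ M)%N - tau 0%N <= Lam).

Let b_gt0 : 0 < b%:R :> R. Proof. by rewrite ltr0n ltnW. Qed.
Let b_ge1 : 1 <= b%:R :> R. Proof. by rewrite ler1n ltnW. Qed.
Let Lam_gt0 : 0 < Lam. Proof. exact: lt_le_trans Lam1. Qed.

(** Each cell of the previous level is counted once per subcell, hence the factor [b]; the lengths
    themselves telescope. *)
Let level_sum k : (k <= M)%N ->
  \sum_(h < b ^ k) (if k is k'.+1 then cell_length k' (h %/ b) else 1) <= b%:R * Lam.
Proof.
case: k => [_|k kM].
  by rewrite expn0 big_ord1 -[leLHS]mul1r ler_pM// ler1n ltnW.
rewrite -(big_mkord xpredT (fun h => cell_length k (h %/ b))) expnSr.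
have -> : \sum_(0 <= h < b ^ k * b) cell_length k (h %/ b) =
    \sum_(0 <= h < b ^ k) b%:R * cell_length k h.
  elim: (b ^ k)%N => [|n IH]; first by rewrite mul0n !big_geq.
  rewrite mulSn addnC (@big_cat_nat _ _ _ (n * b))//= ?leq_addr//.
  rewrite IH big_nat_recr//=; congr (_ + _).
  rewrite (eq_big_nat _ _ (F2 := fun=> cell_length k n)); last first.
    move=> h /andP[h1 h2]; congr (cell_length k _).
    rewrite -(subnKC h1) divnMDl ?(ltnW b1)// divn_small ?addn0//.
    by move: h1 h2; lia.
  by rewrite sumr_const_nat addKn mulr_natl.
rewrite -mulr_sumr big_mkord sum_cell_length ?(ltnW kM)//.
by rewrite ler_pM2l.
Qed.

(** Lengths are averaged rather than maximised: the cells of one level have equal weight and their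
    lengths add up to at most [Lam]. A coordinate contributes the levels 0 to [m] and the final
    term, at most [M.+2] sums; each of them completes the depth to [m], whence the common power of
    [b]. *)
Lemma smolyak_rem_sum (I : finType) (w : I -> R) (c : I -> 'I_d -> nat) s m r a :
  net_weights w c -> uniq s -> (\sum_j r j + m <= M)%N ->
  (forall j, (a j < b ^ r j)%N) -> (forall j, j \in s -> r j = 0%N /\ a j = 0%N) ->
  \sum_(i | in_cell (c i) r a) w i * smolyak_rem (fun j => level_length (c i j)) s m
  <= b%:R ^- (\sum_j r j + m) * (M.+2%:R * b%:R * Lam) ^+ size s.
Proof.
move=> nw; have [cM wc] := nw; elim: s m r a => [|j s IH] m r a /=.
  move=> _ _ _ _; rewrite big1 => [|i _]; last by rewrite mulr0.
  by rewrite mulr_ge0 ?expr0// invr_ge0 exprn_ge0// ltW.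
move=> /andP[js us] rM ab ra0.
have [rj aj] := ra0 j (mem_head _ _).
set X := (M.+2%:R * b%:R * Lam).
have X0 : 0 <= X by rewrite !mulr_ge0// ltW.
have X1 : 1 <= X.
  by rewrite /X !mulr_ege1// ler1n.
set p := b%:R ^- (\sum_j r j + m).
have p0 : 0 <= p by rewrite invr_ge0 exprn_ge0// ltW.
have mM : (m <= M)%N by rewrite (leq_trans _ rM) ?leq_addl.
have sub_r0 k h : (k <= m)%N -> (h < b ^ k)%N ->
    (forall j0, (set_at a j h j0 < b ^ set_at r j k j0)%N) /\
    (forall j0, j0 \in s -> set_at r j k j0 = 0%N /\ set_at a j h j0 = 0%N).
  move=> km hk; split=> [i|i si]; rewrite /set_at; first by case: eqP.
  by case: eqP => [ij|_]; [rewrite -ij si in js|apply: ra0; rewrite inE si orbT].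
under eq_bigr do rewrite mulrDr mulr_sumr.
rewrite big_split/= exchange_big/=.
have main k : (k <= m)%N ->
    \sum_(i | in_cell (c i) r a)
      w i * (level_length (c i j) k *
             smolyak_rem (fun j => level_length (c i j)) s (m - k)%N) <=
    (b%:R * Lam) * (p * X ^+ size s).
  move=> km; have kM := leq_trans km mM.
  rewrite (cell_partition _ cM kM rj aj).
  apply: le_trans (ler_wpM2r _ (level_sum kM)); last by rewrite mulr_ge0 ?exprn_ge0.
  rewrite mulr_suml; apply: ler_sum => h _.
  have [h1 h2] := sub_r0 k h km (ltn_ord h).
  have := IH (m - k)%N (set_at r j k) (set_at a j h) us.
  rewrite sum_set_at// -addnA subnKC// -/p -/X => /(_ rM h1 h2) IHh.
  have l0 : 0 <= (if k is k'.+1 then cell_length k' (h %/ b) else 1).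
    case: k h {km h1 h2 IHh} kM => [//|k'] h kM.
    apply: cell_length_ge0; first exact: ltnW.
    by rewrite ltn_divLR ?(ltnW b1)// -expnSr.
  apply: le_trans (ler_wpM2l l0 IHh).
  rewrite mulr_sumr; rewrite le_eqVlt; apply/orP; left; apply/eqP/eq_bigr => i /forallP/(_ j).
  rewrite /set_at eqxx => /eqP ih; rewrite mulrCA; congr (_ * _).
  case: k h {km h1 h2 IHh l0} kM ih => [//|k'] h kM /= ih.
  by rewrite coarse_pred// ih.
have last : \sum_(i | in_cell (c i) r a) w i * level_length (c i j) m.+1 <= p * Lam.
  rewrite (cell_partition _ cM mM rj aj).
  apply: le_trans (ler_wpM2l p0 tauLam).
  rewrite -(sum_cell_length mM) mulr_sumr; apply: ler_sum => h _.
  have [h1 h2] := sub_r0 m h (leqnn _) (ltn_ord h).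
  have := wc (set_at r j m) (set_at a j h); rewrite sum_set_at// => /(_ rM h1) wE.
  rewrite /p -wE mulr_suml; rewrite le_eqVlt; apply/orP; left; apply/eqP/eq_bigr => i /forallP/(_ j).
  by rewrite /set_at eqxx => /eqP /= ->.
apply: (@le_trans _ _
    (\sum_(k < m.+1) (b%:R * Lam) * (p * X ^+ size s) + p * Lam)).
  by apply: lerD => //; apply: ler_sum => k _; apply: main; rewrite -ltnS.
rewrite sumr_const card_ord -[X in X + _]mulr_natl exprS.
set Y := X ^+ size s.
have Y1 : 1 <= Y by exact: exprn_ege1.
have bL : Lam <= b%:R * Lam by rewrite ler_peMl// ltW.
have bL0 : 0 <= b%:R * Lam by rewrite mulr_ge0// ltW.
have -> : p * (X * Y) = M.+1%:R * (b%:R * Lam * (p * Y)) + b%:R * Lam * (p * Y).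
  by rewrite /X -[M.+2]addn1 natrD; ring.
apply: lerD.
  rewrite ler_wpM2r ?ler_nat//; first by rewrite mulr_ge0// mulr_ge0// (le_trans _ Y1).
rewrite mulrC (mulrC p) mulrA ler_wpM2r// -[leLHS]mulr1 ler_pM// ltW//.
Qed.

End nodes.

End net_families.

Lemma le_powRN (R : realType) (a x y : R) : 0 <= a -> 0 < x -> x <= y ->
  y `^ (- a) <= x `^ (- a).
Proof.
move=> a_ge0 x_gt0 xy; have y_gt0 := lt_le_trans x_gt0 xy.
rewrite !powRN lef_pV2 ?posrE ?powR_gt0//.
by rewrite ge0_ler_powR ?nnegrE// ltW.
Qed.

(** * Functions of slow growth and their derivatives *)

Section slow_growth.
Context (R : realType) (d : nat).
Implicit Types (f g : 'cV[R]_d -> R) (z : 'cV[R]_d) (j : 'I_d) (s w : seq 'I_d).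

Definition tail (x : R) : R := 1 - Phi `|x|.

Lemma tail_gt0 x : 0 < tail x. Proof. by rewrite subr_gt0 Phi_lt1. Qed.

Lemma tail_le_half x : tail x <= 2^-1.
Proof. by have := ler_Phi (normr_ge0 x); rewrite Phi0 /tail; lra. Qed.

Lemma tail_le1 x : tail x <= 1.
Proof. by have := tail_le_half x; lra. Qed.

Lemma tail_powR_ge1 x (a : R) : 0 <= a -> 1 <= tail x `^ (- a).
Proof.
move=> a0; rewrite powRN -[leLHS]invr1 lef_pV2 ?posrE ?powR_gt0 ?tail_gt0//.
have E : 1 `^ a = 1 :> R by rewrite powR1.
by rewrite -[leRHS]E ge0_ler_powR ?nnegrE ?tail_le1// ltW// tail_gt0.
Qed.

(** Chernoff's bound at [lam = c / a], raised to the power [a], has exactly [c |x|] as its linear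
    term. *)
Lemma expR_le_tail (c a x : R) : 0 <= c -> 0 < a ->
  expR (c * `|x|) <= expR (c ^+ 2 / (2 * a)) * tail x `^ (- a).
Proof.
move=> c0 a0.
have l0 : 0 <= c / a by rewrite divr_ge0// ltW.
have := Phi_chernoff `|x| l0; rewrite -/(tail x) => H.
have : tail x `^ a <= expR (c ^+ 2 / (2 * a) - c * `|x|).
  rewrite (_ : expR _ = expR ((c / a) ^+ 2 / 2 - c / a * `|x|) `^ a).
    by rewrite ge0_ler_powR ?nnegrE ?expR_ge0// ltW// tail_gt0.
  by rewrite -expRM; congr expR; field; rewrite gt_eqF.
rewrite expRB powRN => H'.
by rewrite ler_pdivlMr ?powR_gt0 ?tail_gt0// mulrC -ler_pdivlMr ?expR_gt0.
Qed.

(** Every exponent [a] is allowed, with its own constant. This makes the class stable under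
    products: each factor takes half of the exponent. *)
Definition slow f := forall a : R, 0 < a ->
  exists2 C : R, 0 < C & forall z, `|f z| <= C * \prod_(i < d) tail (z i 0) `^ (- a).

Let prod_ge1 z (a : R) : 0 <= a -> 1 <= \prod_(i < d) tail (z i 0) `^ (- a).
Proof.
move=> a0; elim/big_rec: _ => // i x _ x1.
by rewrite mulr_ege1// tail_powR_ge1.
Qed.

Lemma slow_cst (c : R) : slow (fun=> c).
Proof.
move=> a a0; exists (`|c| + 1) => [|z]; first by rewrite ltr_wpDl.
apply: (@le_trans _ _ (`|c| + 1)); first by rewrite lerDl.
by rewrite ler_peMr ?addr_ge0// prod_ge1// ltW.
Qed.

Lemma slowD f g : slow f -> slow g -> slow (fun z => f z + g z).
Proof.
move=> sf sg a a0; have [C C0 fC] := sf a a0; have [D D0 gD] := sg a a0.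
exists (C + D) => [|z]; first by rewrite addr_gt0.
by rewrite mulrDl (le_trans (ler_normD _ _))// lerD.
Qed.

Lemma slowM f g : slow f -> slow g -> slow (fun z => f z * g z).
Proof.
move=> sf sg a a0; have a20 : 0 < a / 2 by rewrite divr_gt0.
have [C C0 fC] := sf _ a20; have [D D0 gD] := sg _ a20.
exists (C * D) => [|z]; first by rewrite mulr_gt0.
have -> : \prod_(i < d) tail (z i 0) `^ (- a) =
    \prod_(i < d) tail (z i 0) `^ (- (a / 2)) * \prod_(i < d) tail (z i 0) `^ (- (a / 2)).
  rewrite -big_split/=; apply: eq_bigr => i _.
  rewrite -powRD; last by rewrite (gt_eqF (tail_gt0 _)) implybT.
  by congr powR; lra.
by rewrite normrM mulrACA ler_pM.
Qed.

Lemma slow_exp (c K : R) f : 0 <= c ->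
  (forall z, `|f z| <= K * expR (\sum_(i < d) c * `|z i 0|)) -> slow f.
Proof.
move=> c0 fK a a0.
exists ((`|K| + 1) * \prod_(i < d) expR (c ^+ 2 / (2 * a))) => [|z].
  by rewrite mulr_gt0 ?ltr_wpDl// prodr_gt0// => i _; exact: expR_gt0.
rewrite (le_trans (fK z))//.
have K0 : 0 <= `|K| + 1 by rewrite addr_ge0.
apply: (@le_trans _ _ ((`|K| + 1) * expR (\sum_(i < d) c * `|z i 0|))).
  by rewrite ler_wpM2r ?expR_ge0// (le_trans (ler_norm _))// lerDl.
rewrite -mulrA -big_split/= expR_sum ler_wpM2l//.
by apply: ler_prod => i _; rewrite expR_ge0 expR_le_tail.
Qed.

(** Here the head of [s] is differentiated first, whereas [mixed_partial] differentiates along it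
    last; hence the [rev] in later statements. In this recursive form the Leibniz rule is a plain
    induction. *)
Fixpoint mslow s f : Prop :=
  if s is j :: s' then [/\ mslow s' f,
    forall z, derivable f z (delta_mx j 0) & mslow s' (partial j f)]
  else slow f.

Lemma mslowD s f g : mslow s f -> mslow s g -> mslow s (fun z => f z + g z).
Proof.
elim: s f g => [|j s IH] f g /=; first exact: slowD.
move=> [sf df pf] [sg dg pg]; split; first exact: IH.
  by move=> z; apply: derivableD.
rewrite (_ : partial j _ = fun z => partial j f z + partial j g z); first exact: IH.
by apply/funext => z; rewrite /partial deriveD.
Qed.

Lemma mslowM s f g : mslow s f -> mslow s g -> mslow s (fun z => f z * g z).
Proof.
elim: s f g => [|j s IH] f g /=; first exact: slowM.
move=> [sf df pf] [sg dg pg]; split; first exact: IH.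
  by move=> z; apply: derivableM.
rewrite (_ : partial j _ = fun z => f z * partial j g z + g z * partial j f z).
  by apply: mslowD; exact: IH.
by apply/funext => z; rewrite /partial deriveM.
Qed.

Lemma derive_line f j z (h : R -> R) (D : R) :
  (forall x, f (x *: delta_mx j 0 + z) = h x) -> is_derive (0 : R) 1 h D ->
  derivable f z (delta_mx j 0) /\ partial j f z = D.
Proof.
move=> fh hD.
have qE : (fun x : R => x^-1 *: ((f \o shift z) (x *: delta_mx j 0) - f z)) =
          (fun x : R => x^-1 *: ((h \o shift 0) (x *: 1) - h 0)).
  by apply/funext => x /=; rewrite -!fh addr0 scale0r add0r -[x *: 1]/(x * 1) mulr1.
split; first by rewrite /derivable qE; by have [] := hD.
by rewrite /partial /derive qE; exact: (@derive_val _ _ _ _ _ _ _ hD).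
Qed.

Lemma mslow_cst s (c : R) : mslow s (fun=> c).
Proof.
elim: s c => [|j s IH] c /=; first exact: slow_cst.
have dl z : derivable (fun=> c) z (delta_mx j 0) /\ partial j (fun=> c) z = 0.
  by apply: (derive_line (h := fun=> c)) => // ; exact: is_derive_cst.
split; [exact: IH|by move=> z; case: (dl z)|].
rewrite (_ : partial j _ = fun=> 0); first exact: IH.
by apply/funext => z; case: (dl z).
Qed.

Lemma mslow_affine s f (k : 'I_d -> R) : slow f ->
  (forall j z x, f (x *: delta_mx j 0 + z) = f z + x * k j) -> mslow s f.
Proof.
move=> sf fk; elim: s => [//|j s IH] /=.
have dl z : derivable f z (delta_mx j 0) /\ partial j f z = k j.
  apply: (derive_line (h := fun x => f z + x * k j)) => //.
  by apply: is_derive_eq; rewrite /GRing.scale /=; ring.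
split; [exact: IH|by move=> z; case: (dl z)|].
rewrite (_ : partial j _ = fun=> k j); first exact: mslow_cst.
by apply/funext => z; case: (dl z).
Qed.

(** The hypothesis describes [f] along coordinate lines and yields [partial j f = f * l j], so
    differentiation stays among products of [f] with the functions [l j] and their derivatives. *)
Lemma mslow_exp_quadratic s f (l : 'I_d -> 'cV[R]_d -> R) (k : 'I_d -> R) :
  slow f -> (forall j, mslow s (l j)) ->
  (forall j z x, f (x *: delta_mx j 0 + z) = f z * expR (x * l j z + x ^+ 2 * k j)) ->
  mslow s f.
Proof.
move=> sf; elim: s => [//|j s IH] /= ml fk.
have dl z : derivable f z (delta_mx j 0) /\ partial j f z = f z * l j z.
  apply: (derive_line (h := fun x => f z * expR (x * l j z + x ^+ 2 * k j))) => //.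
  apply: is_derive_eq; rewrite /GRing.scale /=.
  by rewrite expr0n /= !mul0r addr0 expR0; ring.
split.
- by apply: IH => // i; case: (ml i).
- by move=> z; case: (dl z).
rewrite (_ : partial j _ = fun z => f z * l j z).
  by apply: mslowM; [apply: IH => // i; case: (ml i)|case: (ml j)].
by apply/funext => z; case: (dl z).
Qed.

Lemma subseq_rconsP w s j : subseq w (rcons s j) ->
  subseq w s \/ exists2 w', w = rcons w' j & subseq w' s.
Proof.
rewrite -subseq_rev rev_rcons; case: (lastP w) => [_|w' i]; first by left; exact: sub0seq.
rewrite rev_rcons /=; case: eqP => [->|_].
  by rewrite subseq_rev; right; exists w'.
by rewrite -rev_rcons subseq_rev; left.
Qed.

Lemma mslow_mixed_partial s f : mslow (rev s) f ->
  mixed_derivable s f /\ forall w, subseq w s -> slow (mixed_partial w f).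
Proof.
elim/last_ind: s f => [|s j IH] f.
  by move=> sf; split=> [i w|w]; rewrite subseq0// => /eqP ->.
rewrite rev_rcons /= => -[/IH[df sf] dj /IH[dpf spf]].
split=> [i w /subseq_rconsP[/df//|[w']]|w /subseq_rconsP[/sf//|[w' -> /spf]]].
  case: w' => [|i' w'] /= [-> ->]; first by [].
  by move=> /dpf H z; rewrite /mixed_partial foldr_rcons; exact: H.
by rewrite /mixed_partial foldr_rcons.
Qed.

(** The growth condition speaks of sets of variables, in the order of [enum]; a subsequence of
    [enum 'I_d] is the enumeration of its own set, so it covers every word met. *)
Lemma QMC_friendly_mslow f : mixed_smooth f -> QMC_friendly f ->
  mslow (rev (enum 'I_d)) f.
Proof.
move=> smf qf.
have base w : subseq w (enum 'I_d) -> slow (mixed_partial w f).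
  move=> we a a0; have [B B0 fB] := qf (fun=> a) (fun=> a0).
  exists B => // z; have := fB [set x in w]%SET z; rewrite /D_.
  suff -> : enum [set x in w]%SET = w by [].
  rewrite [RHS](elimT (subseq_uniqP (enum_uniq 'I_d)) we).
  rewrite {1}/enum_mem -enumT; apply: eq_filter => x.
  by rewrite /= inE.
suff H s w : subseq (s ++ w) (enum 'I_d) -> mslow (rev s) (mixed_partial w f).
  by have := H (enum 'I_d) [::]; rewrite cats0; apply.
elim/last_ind: s w => [|s j IH] w sw; first exact: base.
have jw : subseq (j :: w) (enum 'I_d).
  by apply: subseq_trans sw; rewrite cat_rcons; exact: suffix_subseq.
have ujw := subseq_uniq jw (enum_uniq _).
rewrite rev_rcons /=; split.
- apply: IH; apply: subseq_trans sw; rewrite cat_rcons.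
  by apply: cat_subseq => //; exact: subseq_cons.
- move=> z; move: ujw => /= /andP[jNw uw].
  by have [_ H] := smf w uw; exact: H.
- by apply: (IH (j :: w)); rewrite -cat_rcons.
Qed.

End slow_growth.

(** * Growth of the importance weight *)

Section importance_weight.
Context (R : realType) (d : nat).
Implicit Types (u v z : 'cV[R]_d) (j : 'I_d) (L : 'M[R]_d).

Let dp u v : R := (u^T *m v) 0 0.

Let dpE u v : dp u v = \sum_i u i 0 * v i 0.
Proof. by rewrite /dp mxE; apply: eq_bigr => i _; rewrite mxE. Qed.

Let dpC u v : dp u v = dp v u.
Proof. by rewrite !dpE; apply: eq_bigr => i _; rewrite mulrC. Qed.

Let dpDr u v z : dp u (v + z) = dp u v + dp u z.
Proof. by rewrite /dp mulmxDr mxE. Qed.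

Let dpZr u c z : dp u (c *: z) = c * dp u z.
Proof. by rewrite /dp -scalemxAr mxE. Qed.

Let dpDl u v z : dp (u + v) z = dp u z + dp v z.
Proof. by rewrite dpC dpDr !(dpC z). Qed.

Let dpZl c u z : dp (c *: u) z = c * dp u z.
Proof. by rewrite dpC dpZr dpC. Qed.

Lemma slow_coord i : slow (fun z : 'cV[R]_d => z i 0).
Proof.
apply: (@slow_exp _ _ 1 1) => // z; rewrite mul1r (bigD1 i)//= mul1r.
apply: (@le_trans _ _ (expR `|z i 0|)).
  by rewrite (le_trans _ (expR_ge1Dx _))// lerDr.
by rewrite ler_expR lerDl sumr_ge0// => k _; rewrite mul1r.
Qed.

Lemma slow_sum (I : Type) (r : seq I) (f : I -> 'cV[R]_d -> R) :
  (forall i, slow (f i)) -> slow (fun z => \sum_(i <- r) f i z).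
Proof.
move=> sf; elim: r => [|i r IH].
  rewrite (_ : (fun _ => _) = fun=> 0); first exact: slow_cst.
  by apply/funext => z; rewrite big_nil.
rewrite (_ : (fun _ => _) = fun z => f i z + \sum_(i <- r) f i z).
  exact: slowD.
by apply/funext => z; rewrite big_cons.
Qed.

Let slow_dp u : slow (dp u).
Proof.
rewrite (_ : dp u = fun z => \sum_i u i 0 * z i 0); last first.
  by apply/funext => z; exact: dpE.
by apply: slow_sum => i; apply: slowM; [exact: slow_cst|exact: slow_coord].
Qed.

Context (nu : 'cV[R]_d) (D : R) (L : 'M[R]_d) (D0 : 0 <= D).
Context (expL : forall z, (z^T *m z) 0 0 <= ((L *m z)^T *m (L *m z)) 0 0).

Let W z : R := D * expR (2^-1 * (z^T *m z) 0 0 -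
  2^-1 * ((nu + L *m z)^T *m (nu + L *m z)) 0 0).

Let WE z : W z =
  D * expR (2^-1 * dp z z - 2^-1 * dp (nu + L *m z) (nu + L *m z)).
Proof. by []. Qed.

Let dpL u z : dp u (L *m z) = dp (L^T *m u) z.
Proof. by rewrite /dp trmx_mul trmxK mulmxA. Qed.

Let slowW : slow W.
Proof.
pose u := L^T *m nu; pose c := \sum_i `|u i 0|.
have c0 : 0 <= c by apply: sumr_ge0.
apply: (@slow_exp _ _ c D) => // z.
rewrite WE ger0_norm ?mulr_ge0 ?expR_ge0//.
rewrite ler_wpM2l// ler_expR.
have := expL z; rewrite -/(dp _ _) -/(dp _ _) => Lz.
have nu0 : 0 <= dp nu nu by rewrite dpE sumr_ge0// => i _; rewrite -expr2 sqr_ge0.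
have : - dp nu (L *m z) <= \sum_i c * `|z i 0|.
  rewrite dpL -/u dpE; apply: le_trans (ler_norm _) _.
  rewrite normrN; apply: le_trans (ler_norm_sum _ _ _) _.
  apply: ler_sum => i _; rewrite normrM ler_wpM2r// /c (bigD1 i)//= lerDl.
  by apply: sumr_ge0.
rewrite !(dpDl, dpDr) (dpC (L *m z) nu); lra.
Qed.

Let e j : 'cV[R]_d := delta_mx j 0.
(** The derivative in coordinate [j] of the exponent of [W]. *)
Let l j z : R := dp (e j) z - dp (L *m e j) (nu + L *m z).

Let mslow_l s j : mslow s (l j).
Proof.
apply: (@mslow_affine _ _ _ _ (fun i => dp (e j) (e i) - dp (L *m e j) (L *m e i))).
  rewrite (_ : l j = fun z => dp (e j) z + (- dp (L *m e j) nu +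
      dp (- (L^T *m (L *m e j))) z)).
    by apply: slowD => //; apply: slowD => //; exact: slow_cst.
  apply/funext => z; rewrite /l dpDr dpL -[- (L^T *m _)]scaleN1r dpZl; ring.
move=> i z x; rewrite /l mulmxDr -scalemxAr !(dpDr, dpZr); ring.
Qed.

Lemma mslow_gaussian_weight s : mslow s W.
Proof.
apply: (@mslow_exp_quadratic _ _ _ _ l
  (fun j => 2^-1 * (dp (e j) (e j) - dp (L *m e j) (L *m e j))));
  [exact: slowW|by move=> j; exact: mslow_l|].
move=> j z x; rewrite !WE -mulrA -expRD; congr (_ * expR _).
rewrite /l mulmxDr -scalemxAr !(dpDr, dpDl, dpZr, dpZl).
rewrite (dpC z (e j)) (dpC (L *m z) (L *m e j)) (dpC nu (L *m e j)); by field.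
Qed.

End importance_weight.

Lemma IS_integrand_mslow (R : realType) (d : nat) (G : 'cV[R]_d -> R)
    (mu0 mu : 'cV[R]_d) (Sigma L : 'M[R]_d) :
  L *m L^T = Sigma ->
  (forall lambda : R, eigenvalue Sigma lambda -> 1 <= lambda) ->
  mixed_smooth (fun z => G (mu + L *m z)) ->
  QMC_friendly (fun z => G (mu + L *m z)) ->
  mslow (rev (enum 'I_d)) (IS_integrand G mu0 mu Sigma L).
Proof.
move=> LS S1 sG qG; apply: mslowM; first exact: QMC_friendly_mslow.
apply: mslow_gaussian_weight; first exact: powR_ge0.
by apply: expansive_of_eigenvalues; rewrite LS.
Qed.

(** * Base-[b] words, their scrambling, and the reals they denote *)

Section digit_words.
Context (b : nat) (b1 : (1 < b)%N).
Implicit Types (u v : nat -> 'I_b) (k l : nat).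

Let b0 : (0 < b)%N. Proof. exact: ltnW. Qed.

Fixpoint word_value u k : nat :=
  if k is k'.+1 then (word_value u k' * b + u k')%N else 0%N.

Lemma word_value_lt u k : (word_value u k < b ^ k)%N.
Proof.
elim: k => [|k IH] //=; have := ltn_ord (u k); rewrite expnSr.
by move: IH; nia.
Qed.

Lemma word_valueS_eq u k al :
  (word_value u k.+1 == al) = (word_value u k == al %/ b)%N && (u k == al %% b :> nat)%N.
Proof.
apply/eqP/andP => [<- /=|[/eqP ud /eqP um]]; last by rewrite /= ud um -divn_eq.
by rewrite divnMDl// modnMDl modn_small// divn_small// addn0.
Qed.

Let iotaSr k : iota 0 k.+1 = rcons (iota 0 k) k.
Proof. by rewrite -cats1 -[[:: k]]/(iota (0 + k) 1) -iotaD addn1. Qed.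

Lemma word_value_eq u v k :
  (word_value u k == word_value v k) = all (fun l => u l == v l) (iota 0 k).
Proof.
elim: k => [//|k IH]; rewrite iotaSr all_rcons -IH andbC word_valueS_eq.
by rewrite [word_value v k.+1]/= divnMDl// modnMDl modn_small ?divn_small ?addn0 ?ltn_ord.
Qed.

Lemma word_value_div u k l : (k <= l)%N ->
  word_value u k = (word_value u l %/ b ^ (l - k))%N.
Proof.
move=> /subnKC <-; rewrite addKn; elim: (l - k)%N => [|n IH].
  by rewrite addn0 expn0 divn1.
by rewrite addnS /= expnS divnMA divnMDl// (divn_small (ltn_ord _)) addn0.
Qed.

Lemma word_value_const0 k : word_value (fun=> Ordinal b0) k = 0%N.
Proof. by elim: k => //= k ->; rewrite mul0n. Qed.

Let bp : (b.-1 < b)%N. Proof. by rewrite prednK. Qed.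

Lemma word_value_constp k : word_value (fun=> Ordinal bp) k = (b ^ k).-1.
Proof.
elim: k => //= k ->; rewrite expnSr.
have := expn_gt0 b k; rewrite b0 /= => bk.
by move: b1 bk; nia.
Qed.

Definition scramble_digits (pi : seq 'I_b -> {perm 'I_b}) u : nat -> 'I_b :=
  fun k => pi (mkseq u k) (u k).

(** Scrambling pulls a cell back to a single cell of the same level: once the prefix is known, so is
    the permutation acting on the next digit, and it can be inverted. *)
Lemma scramble_digits_bij pi k al : (al < b ^ k)%N -> exists s : nat -> 'I_b,
  forall u, (word_value (scramble_digits pi u) k == al) =
            (word_value u k == word_value s k).
Proof.
elim: k al => [|k IH] al.
  by rewrite expn0 ltnS leqn0 => /eqP ->; exists (fun=> Ordinal b0).
move=> alb; have [|s sP] := IH (al %/ b)%N; first by rewrite ltn_divLR// -expnSr.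
have eb : (al %% b < b)%N by rewrite ltn_mod.
pose e := Ordinal eb.
exists (fun l => if (l < k)%N then s l else (pi (mkseq s k))^-1%g e) => u.
rewrite word_valueS_eq sP !word_value_eq iotaSr all_rcons ltnn [RHS]andbC.
rewrite (@eq_in_all _ (fun l => u l == (if (l < k)%N then _ else _))
  (fun l => u l == s l)); last by move=> l; rewrite mem_iota/= => ->.
have [/allP us|//] := boolP (all _ _); rewrite !andTb.
have -> : mkseq s k = mkseq u k.
  apply/eq_in_map => l lk; exact/esym/eqP/us.
rewrite /scramble_digits -[RHS](inj_eq (@perm_inj _ (pi (mkseq u k)))) permKV.
by rewrite -[RHS]val_eqE.
Qed.

Section real_value.
Context (R : realType).

Let bR : 0 < b%:R :> R. Proof. by rewrite ltr0n. Qed.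

Let v u k : R := (u k)%:R / b%:R ^+ k.+1.

Lemma series_word_value u k : series (v u) k = (word_value u k)%:R / b%:R ^+ k.
Proof.
elim: k => [|k IH]; first by rewrite /series/= big_geq// mul0r.
rewrite seriesSr IH /v [word_value u k.+1]/= natrD natrM exprSr.
by field; rewrite ?expf_neq0// gt_eqF.
Qed.

Let word_ge u k l : (k <= l)%N ->
  (word_value u k)%:R / b%:R ^+ k <= (word_value u l)%:R / b%:R ^+ l :> R.
Proof.
move=> kl; rewrite (word_value_div u kl).
have -> : b%:R ^+ l = b%:R ^+ k * b%:R ^+ (l - k) :> R by rewrite -exprD subnKC.
rewrite ler_pdivlMr ?mulr_gt0 ?exprn_gt0// mulrA divfK ?expf_neq0 ?gt_eqF//.
by rewrite -natrX -natrM ler_nat leq_divM.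
Qed.

Let word_le u k l : (k <= l)%N ->
  (word_value u l)%:R / b%:R ^+ l <= (word_value u k).+1%:R / b%:R ^+ k :> R.
Proof.
move=> kl; rewrite (word_value_div u kl).
have -> : b%:R ^+ l = b%:R ^+ k * b%:R ^+ (l - k) :> R by rewrite -exprD subnKC.
rewrite ler_pdivrMr ?mulr_gt0 ?exprn_gt0// mulrA divfK ?expf_neq0 ?gt_eqF//.
by rewrite -natrX -natrM ler_nat ltnW// ltn_ceil// expn_gt0 b0.
Qed.

Let cvg_digits u : cvgn (series (v u)).
Proof.
apply: nondecreasing_is_cvgn.
  by move=> k l kl; rewrite !series_word_value; exact: word_ge.
exists 1 => _ [k _ <-]; rewrite series_word_value.
rewrite ler_pdivrMr ?exprn_gt0// mul1r -natrX ler_nat ltnW//.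
exact: word_value_lt.
Qed.

Lemma of_digits_ge u k : (word_value u k)%:R / b%:R ^+ k <= of_digits R u.
Proof.
apply: limr_ge; first exact: cvg_digits.
near=> l; rewrite -/(series (v u) l) series_word_value; apply: word_ge.
by near: l; exact: nbhs_infty_ge.
Unshelve. all: by end_near. Qed.

(** Not strict: if all scrambled digits from some place on are [b - 1], the point is the right end
    of its cell. Cells of scrambled points are therefore read off their words, not off their
    values. *)
Lemma of_digits_le u k : of_digits R u <= (word_value u k).+1%:R / b%:R ^+ k.
Proof.
apply: limr_le; first exact: cvg_digits.
near=> l; rewrite -/(series (v u) l) series_word_value; apply: word_le.
by near: l; exact: nbhs_infty_ge.
Unshelve. all: by end_near. Qed.

Lemma word_value_digit (x : R) k : 0 <= x < 1 ->
  word_value (digit (ltnW b1) x) k = Num.truncn (x * b%:R ^+ k).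
Proof.
move=> /andP[x0 x1]; elim: k => [|k IH].
  by rewrite expr0 mulr1; apply/esym/eqP; rewrite truncn_eq// x0.
rewrite /= IH; set T := Num.truncn (x * _ ^+ k.+1).
have y0 : 0 <= x * b%:R ^+ k.+1 by rewrite mulr_ge0// exprn_ge0// ltW.
have /andP[T1 T2] := truncn_itv y0; rewrite -/T in T1 T2.
suff -> : Num.truncn (x * b%:R ^+ k) = (T %/ b)%N by rewrite -divn_eq.
apply: truncn_def; apply/andP; split.
  rewrite -(ler_pM2r bR) -mulrA -exprSr (le_trans _ T1)//.
  by rewrite -natrM ler_nat leq_divM.
rewrite -(ltr_pM2r bR) -mulrA -exprSr (lt_le_trans T2)//.
by rewrite -natrM ler_nat ltn_ceil.
Qed.

Lemma word_value_digit_eq (x : R) k al : 0 <= x < 1 ->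
  (word_value (digit (ltnW b1) x) k == al) =
  (al%:R / b%:R ^+ k <= x < al.+1%:R / b%:R ^+ k).
Proof.
move=> x01; rewrite word_value_digit// truncn_eq; last first.
  by case/andP: x01 => ? _; rewrite mulr_ge0// exprn_ge0// ltW.
by rewrite ler_pdivrMr ?exprn_gt0// ltr_pdivlMr ?exprn_gt0.
Qed.

End real_value.
End digit_words.

(** * Scrambled nets keep the weights of a net *)

Section scrambled_nets.
Context (R : realType) (d b t m : nat) (b1 : (1 < b)%N) (d0 : (0 < d)%N).
Implicit Types (r al : 'I_d -> nat) (j : 'I_d).

Notation M := (m - t)%N.

Let b0 : (0 < b)%N. Proof. exact: ltnW. Qed.
Let bR : 0 < b%:R :> R. Proof. by rewrite ltr0n. Qed.

(** Total depth exactly [M] suffices: a shallower box is cut along one coordinate, available by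
    [d0], into [b ^ e] boxes of depth [M]. *)
Lemma refine_net_weights (I : finType) (w : I -> R) (c : I -> 'I_d -> nat) :
  (forall i j, (c i j < b ^ M)%N) ->
  (forall r al, (\sum_j r j = M)%N -> (forall j, (al j < b ^ r j)%N) ->
    \sum_(i | in_cell b M (c i) r al) w i = b%:R ^- M) ->
  net_weights b M w c.
Proof.
move=> cM wc; split=> // r al rM alb.
pose j := Ordinal d0; pose e := (M - \sum_j r j)%N.
have be0 : (0 < b ^ e)%N by rewrite expn_gt0 b0.
pose r' := set_at r j (r j + e).
have r'M : (\sum_j r' j = M)%N.
  rewrite (bigD1 j)//= {1}/r' /set_at eqxx (eq_bigr r); last first.
    by move=> i ij; rewrite /r' /set_at (negbTE ij).
  by rewrite addnAC -(@bigD1 _ _ _ _ j xpredT)// subnKC.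
have rjM : (r j + e <= M)%N.
  by rewrite -r'M (bigD1 j)//= {1}/r' /set_at eqxx leq_addr.
pose q i : 'I_(b ^ e) := Ordinal (ltn_pmod (coarse b M (r j + e) (c i j)) be0).
have coarseE i : coarse b M (r j) (c i j) = (coarse b M (r j + e) (c i j) %/ b ^ e)%N.
  rewrite /coarse -divnMA -expnD; congr (_ %/ b ^ _)%N.
  by rewrite subnDA subnK// leq_subRL ?(leq_trans (leq_addr e _) rjM).
rewrite (partition_big q xpredT)//=.
transitivity (\sum_(h < b ^ e) b%:R ^- M : R); last first.
  rewrite sumr_const card_ord -[LHS]mulr_natl natrX -(subnKC rM) -/e exprD.
  by field; rewrite !expf_neq0// gt_eqF.
apply: eq_bigr => h _.
rewrite -(wc r' (set_at al j (al j * b ^ e + h)) r'M); last first.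
  move=> i; rewrite /r' /set_at; case: eqP => [_|_]//.
  by rewrite expnD; have := alb j; have := ltn_ord h; nia.
apply: eq_bigl => i; apply/andP/forallP => [[/forallP ia /eqP ih] j'|ih].
  rewrite /r' /set_at; case: (eqVneq j' j) => [->|_]; last exact: ia.
  by rewrite (divn_eq (coarse b M (r j + e) (c i j)) (b ^ e)) -coarseE (eqP (ia j)) -ih.
have := ih j; rewrite /r' /set_at eqxx => /eqP cj.
split; last by apply/eqP/val_inj; rewrite /= cj modnMDl modn_small.
apply/forallP => j'; have := ih j'; rewrite /r' /set_at.
case: (eqVneq j' j) => [->|//] _.
by rewrite coarseE cj divnMDl// divn_small// addn0.
Qed.

Context (a : 'I_(b ^ m) -> 'cV[R]_d) (pi : 'I_d -> seq 'I_b -> {perm 'I_b}).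

Definition scrambled_digit i j : nat -> 'I_b :=
  scramble_digits (pi j) (digit (ltnW b1) (a i j 0)).

Definition scrambled_word i j (k : nat) : nat := word_value (scrambled_digit i j) k.

(** True for each fixed family of permutations: a box of depth [m - t] pulls back to a box of the
    same shape, which holds [b ^ t] of the [b ^ m] points. *)
Lemma scramble_net_weights : is_net t a ->
  net_weights b M (fun=> b%:R ^- m : R) (fun i j => scrambled_word i j M).
Proof.
move=> [tm a01 aN]; apply: refine_net_weights => [i j|r al rM alb].
  exact: word_value_lt.
have /choice[s sP] j : exists s : nat -> 'I_b, forall u,
    (word_value (scramble_digits (pi j) u) (r j) == al j) =
    (word_value u (r j) == word_value s (r j)).
  exact: scramble_digits_bij.
pose al' j := word_value (s j) (r j).
have := aN r al' (fun j => word_value_lt b1 (s j) (r j)).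
have -> : \prod_(j < d) b%:R ^- r j = b%:R ^ (t%:Z - m%:Z) :> R.
  by rewrite prodfV prodrXr rM -opprB subzn// -exprnN.
move=> /(_ erefl) cardN.
rewrite (eq_bigl (fun i => i \in [set i | in_elementary_interval b r al' (a i)]%SET)).
  rewrite sumr_const cardN -[LHS]mulr_natl natrX.
  have -> : b%:R ^+ m = b%:R ^+ M * b%:R ^+ t :> R by rewrite -exprD subnK.
  by field; rewrite !expf_neq0// gt_eqF.
move=> i; rewrite inE /in_cell /in_elementary_interval; apply: eq_forallb => j.
have rjM : (r j <= M)%N by rewrite -rM (bigD1 j)//= leq_addr.
by rewrite /coarse -word_value_div// sP word_value_digit_eq.
Qed.

End scrambled_nets.

(** * Gaussian integrals over tuples *)

Section gaussian_tuples.
Context (R : realType).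
Local Open Scope ereal_scope.
Notation RT := (measurableTypeR R).
Notation leb := (@lebesgue_measure R).
Notation pdf := (@normal_pdf R 0 1).

(* Monotonicity holds without measurability because the integral of a
   nonnegative function is a supremum over simple functions below it. *)
Lemma ge0_le_lower_integral (dd : measure_display) (T : measurableType dd)
    (mu : {measure set T -> \bar R}) (f g : T -> \bar R) :
  (forall x, 0 <= f x) -> (forall x, f x <= g x) ->
  \int[mu]_x f x <= \int[mu]_x g x.
Proof.
move=> f0 fg; have g0 x : 0 <= g x := le_trans (f0 x) (fg x).
rewrite !ge0_integralTE//; apply: ereal_sup_le => _ [h hf <-].
by exists h => // x; exact: le_trans (fg x).
Qed.

Lemma ge0_integral_lebesgue_tuple n (g : 'I_n -> RT -> \bar R) :
  (forall i, measurable_fun setT (g i)) -> (forall i x, 0 <= g i x) ->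
  measurable_fun setT (fun x : n.-tuple RT => \prod_(i < n) g i (tnth x i)) /\
  \int[@lebesgue_tuple R n]_x (\prod_(i < n) g i (tnth x i)) =
  \prod_(i < n) \int[leb]_x g i x.
Proof.
elim: n g => [|n IH] g mg g0.
  split; first by under eq_fun do rewrite big_ord0; exact: measurable_cst.
  rewrite [RHS]big_ord0; under eq_integral do rewrite big_ord0.
  by rewrite integral_cst//= mul1e diracT.
have [mIH intIH] := IH (fun i => g (lift ord0 i)) (fun i => mg _) (fun i => g0 _).
have mprod : measurable_fun setT
    (fun x : n.+1.-tuple RT => \prod_(i < n.+1) g i (tnth x i)).
  rewrite (_ : (fun _ => _) = fun x : n.+1.-tuple RT => g ord0 (thead x) *
      \prod_(i < n) g (lift ord0 i) (tnth [tuple of behead x] i)).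
    apply: emeasurable_funM.
      apply: (measurableT_comp (mg ord0)); exact: measurable_tnth.
    apply: (@measurableT_comp _ _ _ _ _ _
      (fun t : n.-tuple RT => \prod_(i < n) g (lift ord0 i) (tnth t i))) => //.
    exact: measurable_behead.
  apply/funext => x; rewrite big_ord_recl; congr (_ * _).
  by apply: eq_bigr => i _; rewrite [in LHS](tuple_eta x) tnthS.
split => //.
rewrite [X in integral X](_ : _ = pushforward (leb \x @lebesgue_tuple R n)
  (@tuple_cons RT n))//.
rewrite ge0_integral_pushforward//; last 2 first.
- exact: measurable_cons.
- by move=> y _; rewrite prode_ge0.
rewrite preimage_setT fubini_tonelli1//; last 2 first.
- by apply: measurableT_comp => //; exact: measurable_cons.
- by move=> y; rewrite /= prode_ge0.
have E x (y : n.-tuple RT) : \prod_(i < n.+1) g i (tnth (tuple_cons (x, y)) i) =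
    g ord0 x * \prod_(i < n) g (lift ord0 i) (tnth y i).
  rewrite big_ord_recl; congr (_ * _); apply: eq_bigr => i _.
  by rewrite /tuple_cons tnthS.
rewrite big_ord_recl -intIH /fubini_F /=.
under eq_integral => x _.
  under eq_integral => y _ do rewrite E.
  rewrite ge0_integralZl//; last by move=> y _; exact: prode_ge0.
  over.
rewrite ge0_integralZr//.
by apply: integral_ge0 => y _; exact: prode_ge0.
Qed.

Definition gauss_pdf n (x : n.-tuple RT) : R := (\prod_(i < n) pdf (tnth x i))%R.

Lemma gauss_pdf_ge0 n (x : n.-tuple RT) : (0 <= gauss_pdf x)%R.
Proof. by apply: prodr_ge0 => i _; exact: normal_pdf_ge0. Qed.

Lemma measurable_gauss_pdf n : measurable_fun setT (@gauss_pdf n).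
Proof.
apply: measurable_prod => i _; apply: measurableT_comp.
  exact: measurable_normal_pdf.
exact: measurable_tnth.
Qed.

Lemma normal_densityE n (x : n.-tuple RT) :
  normal_density 0 1%:M (\col_j tnth x j : 'cV[R]_n) = gauss_pdf x.
Proof.
rewrite /normal_density subr0 invmx1 mulmx1 det1 mulr1.
rewrite mxE (eq_bigr (fun i => tnth x i ^+ 2)%R); last first.
  by move=> i _; rewrite !mxE expr2.
rewrite /gauss_pdf [RHS](eq_bigr (fun i => (Num.sqrt (2 * pi))^-1%R *
   expR (- 2^-1 * tnth x i ^+ 2))%R); last first.
  move=> i _; rewrite normal_pdfE ?oner_eq0// /normal_peak /normal_fun.
  rewrite subr0 expr1n mul1r; congr (_ * expR _)%R.
    by rewrite -[(pi *+ 2)%R]mulr_natl.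
  by rewrite mulr2n; field.
rewrite big_split/= prodr_const card_ord -expR_sum -mulr_sumr exprVn.
rewrite mulrC; congr (_^-1 * _)%R.
elim: n {x} => [|n IH]; first by rewrite !expr0 sqrtr1.
by rewrite !exprS sqrtrM ?IH// mulr_ge0// pi_ge0.
Qed.

Lemma integral_gauss_pdf_coord n (k : 'I_n) (psi : RT -> R) :
  measurable_fun setT psi -> (forall x, (0 <= psi x)%R) ->
  \int[@lebesgue_tuple R n]_x (psi (tnth x k) * gauss_pdf x)%:E =
  \int[leb]_x (psi x * pdf x)%:E.
Proof.
move=> mpsi psi0.
pose g i x := (if i == k then psi x * pdf x else pdf x)%R.
have mg i : measurable_fun setT (fun x : RT => (g i x)%:E).
  rewrite /g; case: (i == k); apply/measurable_EFinP; last first.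
    exact: measurable_normal_pdf.
  by apply: measurable_funM => //; exact: measurable_normal_pdf.
have g0 i x : 0 <= (g i x)%:E.
  rewrite lee_fin /g; case: ifP => _; rewrite ?mulr_ge0 ?normal_pdf_ge0//.
have [_ H] := ge0_integral_lebesgue_tuple mg g0.
transitivity (\int[@lebesgue_tuple R n]_x \prod_(i < n) (g i (tnth x i))%:E).
  apply: eq_integral => x _; rewrite prodEFin; congr EFin.
  rewrite /gauss_pdf (bigD1 k)//= [RHS](bigD1 k)//= /g eqxx mulrA; congr (_ * _)%R.
  by apply: eq_bigr => i /negbTE ->.
rewrite H (bigD1 k)//= /g eqxx big1 ?mule1// => i /negbTE ->.
exact: integral_normal_pdf.
Qed.

Section cells.
Context (b M : nat) (b1 : (1 < b)%N).

Definition cell_of (y : R) : nat := Num.truncn (Phi y * (b ^ M)%:R)%R.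

Let bM0 : (0 < (b ^ M)%:R :> R)%R.
Proof. by rewrite ltr0n expn_gt0 ltnW. Qed.

Lemma cell_of_lt y : (cell_of y < b ^ M)%N.
Proof.
rewrite truncn_lt_nat; last by rewrite mulr_ge0 ?Phi_ge0// ltW.
by rewrite -[ltRHS]mul1r ltr_pM2r// Phi_lt1.
Qed.

Lemma cell_of_eq y k : (cell_of y == k) =
  (k%:R / (b ^ M)%:R <= Phi y < k.+1%:R / (b ^ M)%:R)%R.
Proof.
rewrite truncn_eq; last by rewrite mulr_ge0 ?Phi_ge0// ltW.
by rewrite ler_pdivrMr// ltr_pdivlMr.
Qed.

Definition tuple_cell n (x : n.-tuple RT) : {ffun 'I_n -> 'I_(b ^ M)} :=
  [ffun j => Ordinal (cell_of_lt (tnth x j))].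

Let cell k : set RT := [set y | cell_of y = k].

Let mPhi_lt (p : R) : measurable [set y : RT | Phi y < p]%R.
Proof.
rewrite -[X in measurable X]setTI.
have -> : [set y : RT | Phi y < p]%R = @Phi R @^-1` `]-oo, p[%classic.
  by apply/seteqP; split=> x /=; rewrite in_itv.
exact: measurable_Phi.
Qed.

Let cellE k : cell k = [set y | Phi y < k.+1%:R / (b ^ M)%:R]%R `\`
  [set y | Phi y < k%:R / (b ^ M)%:R]%R.
Proof.
apply/seteqP; split=> y /=.
  by move=> /eqP; rewrite cell_of_eq => /andP[h1 h2]; split => //; rewrite ltNge h1.
move=> [h1 h2]; apply/eqP; rewrite cell_of_eq h1 andbT leNgt; exact/negP.
Qed.

Let mcell k : measurable (cell k).
Proof. by rewrite cellE; exact: measurableD. Qed.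

Let gauss_cell k : (k < b ^ M)%N -> normal_prob 0 1 (cell k) = (b%:R ^- M)%:E.
Proof.
move=> kb; rewrite cellE.
set A := [set y : RT | _]; set B := [set y : RT | _].
have sub : B `<=` A.
  move=> y /= /lt_le_trans; apply.
  by rewrite ler_pM2r ?invr_gt0// ler_nat.
have -> : normal_prob 0 1 (A `\` B) = normal_prob 0 1 A - normal_prob 0 1 B.
  transitivity (normal_prob 0 1 A - normal_prob 0 1 (A `&` B)).
    apply: measureD; [exact: mPhi_lt|exact: mPhi_lt|].
    by rewrite -ge0_fin_numE// fin_num_measure//; exact: mPhi_lt.
  by rewrite (setIidr sub).
rewrite !gauss_Phi_lt ?divr_ge0 ?ler_pdivrMr ?mul1r ?ler_nat ?(ltnW kb)//= ?ltW//.
rewrite -EFinB; congr EFin; rewrite -natrX -mulrBl -natrB// subSn// subnn mul1r //.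
Qed.

(** The cells lie between consecutive Gaussian quantiles, so all products of [n] of them have the
    same mass. *)
Lemma integral_tuple_cell n (h : {ffun 'I_n -> 'I_(b ^ M)} -> R) :
  (forall c, (0 <= h c)%R) ->
  measurable_fun setT (fun x : n.-tuple RT => h (tuple_cell x)) /\
  \int[@lebesgue_tuple R n]_x (h (tuple_cell x) * gauss_pdf x)%:E =
  ((\sum_c h c) * b%:R ^- M ^+ n)%:E.
Proof.
move=> h0.
have hE (x : n.-tuple RT) : h (tuple_cell x) =
    (\sum_c h c * \prod_(i < n) \1_(cell (c i)) (tnth x i))%R.
  rewrite (bigD1 (tuple_cell x))//= big1 ?mulr1 => [|i _]; last first.
    by rewrite indicE mem_set// /cell/= ffunE.
  rewrite [X in (_ + X)%R]big1 ?addr0// => c cx.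
  have [i ci] : exists i, c i != tuple_cell x i.
    apply/existsP; rewrite -negb_forall; apply: contra cx => /forallP H.
    by apply/eqP/ffunP => i; apply/eqP.
  rewrite (bigD1 i)//= indicE memNset ?mul0r ?mulr0// /cell/= => E.
  by move/eqP: ci; apply; apply/val_inj; rewrite /= ffunE /= E.
have mind k i : measurable_fun setT (fun x : n.-tuple RT => \1_(cell k) (tnth x i) : R).
  have m1 : measurable_fun setT (\1_(cell k) : RT -> R) by exact: measurable_indic.
  exact: (measurableT_comp m1 (measurable_tnth i)).
have mterm (c : {ffun 'I_n -> 'I_(b ^ M)}) : measurable_fun setT
    (fun x : n.-tuple RT => (h c * \prod_(i < n) \1_(cell (c i)) (tnth x i))%R).
  apply: measurable_funM => //; apply: measurable_prod => i _; exact: mind.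
split.
  under eq_fun do rewrite hE; apply: measurable_sum => c; exact: mterm.
under eq_integral do rewrite hE mulr_suml -sumEFin.
rewrite ge0_integral_sum//=; last 2 first.
- by move=> c; apply/measurable_EFinP; apply: measurable_funM => //; exact: measurable_gauss_pdf.
- move=> c x _; rewrite lee_fin mulr_ge0 ?gauss_pdf_ge0// mulr_ge0//.
  by apply: prodr_ge0 => i _; rewrite indicE.
rewrite mulr_suml -sumEFin; apply: eq_bigr => c _.
under eq_integral do rewrite -mulrA EFinM.
have mg i : measurable_fun setT (fun y : RT => (\1_(cell (c i)) y * pdf y)%:E).
  apply/measurable_EFinP; apply: measurable_funM; first exact: measurable_indic.
  exact: measurable_normal_pdf.
have g0 i y : 0 <= (\1_(cell (c i)) y * pdf y)%:E.
  by rewrite lee_fin mulr_ge0 ?normal_pdf_ge0// indicE.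
have [mH H] := ge0_integral_lebesgue_tuple mg g0.
have pE (x : n.-tuple RT) :
    ((\prod_(i < n) \1_(cell (c i)) (tnth x i)) * gauss_pdf x)%:E =
    \prod_(i < n) (\1_(cell (c i)) (tnth x i) * pdf (tnth x i))%:E.
  by rewrite prodEFin -big_split.
under eq_integral do rewrite pE.
rewrite ge0_integralZl_EFin//; last by move=> x _; exact: prode_ge0.
rewrite H EFinM; congr (_ * _).
rewrite (eq_bigr (fun=> (b%:R ^- M)%:E)); last first.
  move=> i _; rewrite -(gauss_cell (ltn_ord (c i))) /normal_prob.
  rewrite [RHS]integral_mkcond; apply: eq_integral => y _.
  rewrite patchE indicE; case: ifP; rewrite ?mul1r ?mul0r//.
by rewrite prodEFin prodr_const card_ord.
Qed.

End cells.

End gaussian_tuples.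

(** * Integrals bounded level by level *)

Section layers.
Context (R : realType).
Local Open Scope ereal_scope.

Lemma level_exists (b M : nat) (q : R) : (1 < b)%N -> (0 < q)%R ->
  (q <= b%:R ^- M)%R ->
  exists2 k, (M <= k)%N & (b%:R ^- k.+1 < q <= b%:R ^- k)%R.
Proof.
move=> b1 q0 qM.
have b0 : (0 < b%:R :> R)%R by rewrite ltr0n ltnW.
have bk0 k : (0 < b%:R ^+ k :> R)%R by rewrite exprn_gt0.
have exk : exists k, (b%:R ^- k.+1 < q)%R.
  exists (Num.truncn q^-1); rewrite invf_plt ?posrE ?invr_gt0//.
  apply: lt_trans (truncnS_gt _) _; rewrite -natrX ltr_nat; exact: ltn_expl.
have [k qk kmin] := ex_minnP exk.
have mono l l' : (l <= l')%N -> (b%:R ^- l' <= b%:R ^- l :> R)%R.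
  by move=> ll'; rewrite lef_pV2 ?posrE// ler_weXn2l// ler1n ltnW.
exists k.
  rewrite -ltnS ltnNge; apply/negP => kM.
  by move: (lt_le_trans qk qM); rewrite ltNge mono.
rewrite qk/=; case: k qk kmin => [_ _|k _ kmin].
  by rewrite (le_trans qM)// mono.
by rewrite leNgt; apply/negP => /kmin; rewrite ltnn.
Qed.

(* [g] need not be measurable, hence the dominating function [H]. *)
Lemma layer_cake_dominated (dd : measure_display) (T : measurableType dd)
    (mu : {measure set T -> \bar R}) (p : T -> R) (E : nat -> set T)
    (g : T -> R) (b beta c C : R) (k0 : nat) :
  (0 < beta < b)%R -> (0 <= c)%R -> (0 <= C)%R ->
  measurable_fun setT p -> (forall x, 0 <= p x)%R ->
  (forall k, measurable (E k)) ->
  (forall k, (k0 <= k)%N -> \int[mu]_x (\1_(E k) x * p x)%:E <= (c * b ^- k)%:E) ->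
  (forall x, 0 <= g x)%R ->
  (forall x, (0 < g x)%R ->
    exists k, [/\ (k0 <= k)%N, E k x & (g x <= C * beta ^+ k)%R]) ->
  exists H : T -> \bar R, [/\ measurable_fun setT H, forall x, 0 <= H x,
    forall x, (g x * p x)%:E <= H x &
    \int[mu]_x H x <= (C * c * (beta / b) ^+ k0 / (1 - beta / b))%:E].
Proof.
move=> /andP[beta0 betab] c0 C0 mp p0 mE Ec g0 gE.
have b0 : (0 < b)%R by exact: lt_trans betab.
(* At each point [g] is bounded through the one level found there; the sum over all levels is a
   measurable majorant, whose integral is a geometric series of ratio [beta / b]. *)
pose h k x := (C * beta ^+ (k0 + k) * (\1_(E (k0 + k)%N) x * p x))%:E.
have h0 k x : 0 <= h k x.
  by rewrite lee_fin !mulr_ge0 ?exprn_ge0 ?(ltW beta0)// indicE.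
have mind k : measurable_fun setT (fun x => (\1_(E (k0 + k)%N) x * p x)%:E).
  by apply/measurable_EFinP; apply: measurable_funM => //; exact: measurable_indic.
have mh k : measurable_fun setT (h k).
  rewrite (_ : h k = fun x => (C * beta ^+ (k0 + k))%:E *
    (\1_(E (k0 + k)%N) x * p x)%:E); last by apply/funext => x; rewrite -EFinM.
  exact: measurable_funeM.
exists (fun x => \sum_(k <oo) h k x); split.
- by apply: ge0_emeasurable_sum => // k x _ _; exact: h0.
- by move=> x; apply: nneseries_ge0 => k _ _; exact: h0.
- move=> x.
  have [gx|] := ltP 0%R (g x); last first.
    move=> gx; have -> : g x = 0%R by apply/eqP; rewrite eq_le gx g0.
    by rewrite mul0r; apply: nneseries_ge0 => k _ _; exact: h0.
  have [k [k0k Ekx gC]] := gE x gx.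
  apply: le_trans (nneseries_lim_ge (k - k0).+1 _); last by move=> n _ _; exact: h0.
  rewrite big_nat_recr//= ?leq0n//; apply: le_trans (leeDr _ _); last first.
    by apply: sume_ge0 => i _; exact: h0.
  by rewrite /h subnKC// lee_fin indicE mem_set// mul1r ler_wpM2r.
rewrite integral_nneseries//.
set q := (beta / b)%R.
have q0 : (0 < q)%R by rewrite divr_gt0.
have q1 : (q < 1)%R by rewrite ltr_pdivrMr ?mul1r.
pose a := (C * c * q ^+ k0)%R.
have a0 : (0 <= a)%R by rewrite !mulr_ge0// exprn_ge0// ltW.
apply: (@le_trans _ _ (\sum_(k <oo) (a * q ^+ k)%:E)).
  apply: lee_nneseries => [k _ _|k _].
    by apply: integral_ge0 => x _; exact: h0.
  rewrite (eq_integral (fun x => (C * beta ^+ (k0 + k))%:E *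
    (\1_(E (k0 + k)%N) x * p x)%:E)); last by move=> x _; rewrite -EFinM.
  rewrite ge0_integralZl_EFin//; last 2 first.
  - by move=> x _; rewrite lee_fin mulr_ge0// indicE.
  - by rewrite mulr_ge0// exprn_ge0// ltW.
  apply: (@le_trans _ _ ((C * beta ^+ (k0 + k))%:E * (c * b ^- (k0 + k))%:E)).
    by rewrite lee_wpmul2l ?Ec ?leq_addr// lee_fin mulr_ge0// exprn_ge0// (ltW beta0).
  rewrite -EFinM lee_fin le_eqVlt; apply/orP; left; apply/eqP.
  rewrite /a /q -mulrA -exprD expr_div_n; field.
  by rewrite expf_neq0// gt_eqF.
have sE n : \sum_(0 <= k < n) (a * q ^+ k)%:E = (series (geometric a q) n)%:E.
  by rewrite sumEFin.
apply: lime_le; first by apply: is_cvg_nneseries => k _ _; rewrite lee_fin mulr_ge0// exprn_ge0// ltW.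
near=> n; rewrite sE lee_fin; apply: geometric_le_lim => //.
by rewrite gtr0_norm.
Unshelve. all: by end_near. Qed.

End layers.

(** * The Gaussian integral against a sum over cells *)

Section gaussian_quadrature.
Context (R : realType) (d b M : nat) (b1 : (1 < b)%N).
Local Open Scope ereal_scope.
Notation RT := (measurableTypeR R).
Notation pdf := (@normal_pdf R 0 1).
Notation leb := (@lebesgue_measure R).

Let bR : (0 < b%:R :> R)%R. Proof. by rewrite ltr0n ltnW. Qed.

Lemma measurable_tail : measurable_fun [set: RT] (@tail R).
Proof.
apply: measurable_funB => //; apply: (measurableT_comp (@measurable_Phi R)).
exact: normr_measurable.
Qed.

Definition tail_power (kap : R) (x : R) : R :=
  if (tail x <= b%:R ^- M)%R then (tail x `^ (- kap))%R else 0%R.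

Lemma tail_power_ge0 kap x : (0 <= tail_power kap x)%R.
Proof. by rewrite /tail_power; case: ifP => // _; exact: powR_ge0. Qed.

Lemma measurable_tail_power kap : measurable_fun [set: RT] (tail_power kap).
Proof.
apply: measurable_fun_ifT => //.
  apply: measurable_fun_ler; [exact: measurable_tail|exact: measurable_cst].
exact: (measurableT_comp (measurable_powR _) measurable_tail).
Qed.

Lemma tail_leE (x p : R) : (tail x <= p)%R = (Phi x <= p)%R || (1 - p <= Phi x)%R.
Proof.
have := Phi0 R; rewrite /tail; have [x0 P0|x0 P0] := leP 0%R x.
  rewrite ger0_norm//; have := ler_Phi x0; rewrite P0 => hx.
  apply/idP/orP => [h|[h|h]]; [right; lra|lra|lra].
rewrite ltr0_norm// PhiN; have := ltr_Phi x0; rewrite P0 => hx.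
apply/idP/orP => [h|[h|h]]; [left; lra|lra|lra].
Qed.

Lemma powRV_exprn (k : nat) (kap : R) :
  ((b%:R ^- k) `^ (- kap) = (b%:R `^ kap) ^+ k :> R)%R.
Proof.
rewrite -powR_invn ?(ltW bR)// -powRrM mulrNN mulrC powRrM powR_mulrn//.
Qed.

(** The set where the tail is at most [b ^- k] has mass at most [2 b ^- k], the origin of the 2; the
    leading [b ^ kap] pays for rounding a tail to a power of [b]. *)
Lemma integral_tail_power (kap : R) : (0 < kap < 1)%R ->
  \int[leb]_x (tail_power kap x * pdf x)%:E <=
  (b%:R `^ kap * 2 * (b%:R `^ kap / b%:R) ^+ M / (1 - b%:R `^ kap / b%:R))%:E.
Proof.
move=> /andP[kap0 kap1].
have b1' : (1 < b%:R :> R)%R by rewrite ltr1n.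
have mE k : measurable [set y : RT | tail y <= b%:R ^- k]%R.
  rewrite -[X in measurable X]setTI.
  have -> : [set y : RT | tail y <= b%:R ^- k]%R = @tail R @^-1` `]-oo, (b%:R ^- k)%R]%classic.
    by apply/seteqP; split=> x /=; rewrite in_itv.
  exact: measurable_tail.
suff [H [_ _ gH]] : exists H : RT -> \bar R, [/\ measurable_fun setT H,
    forall x, 0 <= H x, forall x, (tail_power kap x * pdf x)%:E <= H x &
    \int[leb]_x H x <= (b%:R `^ kap * 2 * (b%:R `^ kap / b%:R) ^+ M /
      (1 - b%:R `^ kap / b%:R))%:E].
  apply: le_trans; apply: ge0_le_lower_integral => // x.
  by rewrite lee_fin mulr_ge0 ?tail_power_ge0 ?normal_pdf_ge0.
apply: (@layer_cake_dominated _ _ _ _ _ (fun k => [set y : RT | tail y <= b%:R ^- k]%R)) => //.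
- rewrite powR_gt0//=.
  have {2}-> : (b%:R = b%:R `^ kap * b%:R `^ (1 - kap) :> R)%R.
    rewrite -powRD ?(gt_eqF bR) ?implybT//.
    by rewrite addrC subrK powRr1// ltW.
  rewrite -[ltLHS]mulr1 ltr_pM2l ?powR_gt0//.
  have E1 : (1 `^ (1 - kap) = 1 :> R)%R by rewrite powR1.
  by rewrite -[ltLHS]E1 gt0_ltr_powR ?nnegrE ?subr_gt0// ltW.
- exact: measurable_normal_pdf.
- by move=> x; exact: normal_pdf_ge0.
- move=> k _; set p := (b%:R ^- k)%R.
  have p01 : (0 <= p <= 1)%R.
    by rewrite invr_ge0 exprn_ge0 ?(ltW bR)//= invf_le1 ?exprn_gt0// exprn_ege1// ltW.
  have -> : \int[leb]_x (\1_[set y : RT | tail y <= p]%R x * pdf x)%:E =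
      normal_prob 0 1 [set y : RT | tail y <= p]%R.
    rewrite /normal_prob [RHS]integral_mkcond; apply: eq_integral => y _.
    by rewrite patchE indicE; case: ifP; rewrite ?mul1r ?mul0r.
  pose A := [set x : RT | Phi x <= p]%R; pose B := [set x : RT | 1 - p <= Phi x]%R.
  have mA : measurable A.
    rewrite -[X in measurable X]setTI.
    have -> : A = @Phi R @^-1` `]-oo, p]%classic.
      by apply/seteqP; split=> x /=; rewrite in_itv.
    exact: measurable_Phi.
  have mB : measurable B.
    rewrite -[X in measurable X]setTI.
    have -> : B = @Phi R @^-1` `[(1 - p)%R, +oo[%classic.
      by apply/seteqP; split=> x /=; rewrite in_itv/= andbT.
    exact: measurable_Phi.
  have -> : [set y : RT | tail y <= p]%R = A `|` B.
    apply/seteqP; split=> y /=; rewrite tail_leE; first by move/orP.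
    by move=> h; apply/orP.
  have AB : normal_prob 0 1 (A `|` B) <= normal_prob 0 1 A + normal_prob 0 1 B.
    exact: measureU2.
  apply: le_trans AB _.
  have -> : normal_prob 0 1 B = p%:E.
    rewrite gauss_Phi_ge; first by congr EFin; ring.
    by case/andP: p01 => ? ?; apply/andP; split; lra.
  have -> : normal_prob 0 1 A = p%:E.
    have [p1|p1] := eqVneq p 1%R.
      rewrite (_ : A = setT) ?probability_setT ?p1//.
      by apply/seteqP; split=> // x _; rewrite /A/= p1 Phi_le1.
    have pp : (0 < p < 1)%R.
      case/andP: p01 => _ p1'; apply/andP; split; first by rewrite invr_gt0 exprn_gt0.
      by rewrite lt_neqAle p1.
    rewrite -{1}(Phi_invK pp) Phi_prob; congr (normal_prob 0 1 _).
    apply/seteqP; split=> x /=; rewrite /A/= in_itv/= -[(x <= _)%R]ler_PhiE (Phi_invK pp)//.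
  by rewrite -EFinD lee_fin; lra.
- by move=> x; exact: tail_power_ge0.
- move=> x; rewrite {1}/tail_power; case: ifPn => [tM _|_]; last by rewrite ltxx.
  have [k Mk /andP[k1 k2]] := level_exists b1 (tail_gt0 x) tM.
  exists k; split => //; rewrite /tail_power tM -exprS -powRV_exprn.
  by rewrite le_powRN ?(ltW kap0) ?invr_gt0 ?exprn_gt0// ltW.
Qed.

(** Only monotonicity is applied to the integral of [f], sandwiched between nonnegative measurable
    functions made of [A], [Rem] and [psi]; [0 <= A + Rem] keeps the upper one nonnegative. *)
Lemma gaussian_integral_quadrature (f : 'cV[R]_d -> R)
    (A Rem : {ffun 'I_d -> 'I_(b ^ M)} -> R) (psi : R -> R) (tau : R) :
  (forall z, 0 <= f z)%R -> measurable_fun [set: RT] psi ->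
  (forall x, 0 <= psi x)%R -> (forall c, 0 <= Rem c)%R ->
  (forall c, 0 <= A c + Rem c)%R ->
  (forall x : d.-tuple RT, `|f (\col_j tnth x j) - A (tuple_cell M b1 x)| <=
    Rem (tuple_cell M b1 x) + \sum_l psi (tnth x l))%R ->
  \int[leb]_x (psi x * pdf x)%:E <= tau%:E ->
  (`|gaussian_integral f - (\sum_c A c) * b%:R ^- M ^+ d| <=
    (\sum_c Rem c) * b%:R ^- M ^+ d + d%:R * tau)%R.
Proof.
move=> f0 mpsi psi0 Rem0 ARem0 fA psitau.
pose gp := @gauss_pdf R d; pose mu := @lebesgue_tuple R d.
pose c_ x := @tuple_cell R b M b1 d x.
set w := (b%:R ^- M ^+ d)%R.
pose U (x : d.-tuple RT) : R := (\sum_l psi (tnth x l))%R.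
have U0 x : (0 <= U x)%R by apply: sumr_ge0.
have gp0 x : (0 <= gp x)%R := gauss_pdf_ge0 x.
have mgp : measurable_fun setT gp := @measurable_gauss_pdf R d.
have mpsil l : measurable_fun setT (fun x : d.-tuple RT => psi (tnth x l)).
  exact: (measurableT_comp mpsi (measurable_tnth l)).
have mU : measurable_fun setT U by apply: measurable_sum => l.
have intU : \int[mu]_x (U x * gp x)%:E <= (d%:R * tau)%:E.
  rewrite (eq_integral (fun x : d.-tuple RT => \sum_l (psi (tnth x l) * gp x)%:E)); last first.
    by move=> x _; rewrite /U mulr_suml sumEFin.
  rewrite ge0_integral_sum//; last 2 first.
  - by move=> l; apply/measurable_EFinP; exact: measurable_funM.
  - by move=> l x _; rewrite lee_fin mulr_ge0.
  apply: (@le_trans _ _ (\sum_(l < d) tau%:E)).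
    by apply: lee_sum => l _; rewrite integral_gauss_pdf_coord.
  by rewrite sumEFin sumr_const card_ord lee_fin mulr_natl.
have [mARem intARem] := integral_tuple_cell b1 ARem0 (n := d).
have [mRem intRem] := integral_tuple_cell b1 Rem0 (n := d).
have mA : measurable_fun setT (fun x => A (c_ x)).
  rewrite (_ : (fun _ => _) = fun x => (A (c_ x) + Rem (c_ x) - Rem (c_ x))%R).
    exact: measurable_funB.
  by apply/funext => x; rewrite addrK.
have H0 x : 0 <= (f (\col_j tnth x j) * gp x)%:E by rewrite lee_fin mulr_ge0.
have IE : gaussian_integral f = fine (\int[mu]_x (f (\col_j tnth x j) * gp x)%:E).
  congr fine; apply: eq_integral => x _; by rewrite normal_densityE.
set I := \int[mu]_x _ in IE.
set SA := (\sum_c A c)%R; set SR := (\sum_c Rem c)%R.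
have up : I <= ((SA + SR) * w + d%:R * tau)%:E.
  apply: (@le_trans _ _ (\int[mu]_x
      (((A (c_ x) + Rem (c_ x)) * gp x)%:E + (U x * gp x)%:E))).
    apply: ge0_le_lower_integral => // x.
    rewrite -EFinD lee_fin -mulrDl ler_wpM2r//.
    by have := fA x; rewrite ler_norml /c_ /U => /andP[_]; lra.
  rewrite ge0_integralD//; last 4 first.
  - by move=> x _; rewrite lee_fin mulr_ge0.
  - by apply/measurable_EFinP; exact: measurable_funM.
  - by move=> x _; rewrite lee_fin mulr_ge0.
  - by apply/measurable_EFinP; exact: measurable_funM.
  by rewrite intARem big_split/= EFinD leeD2l.
have Ifin : I \is a fin_num.
  by rewrite ge0_fin_numE ?(le_lt_trans up) ?ltry//; exact: integral_ge0.
(* The lower envelope may be negative and is cut at 0; adding back the sum of [psi] and twice [Rem]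
   gives a majorant of [A + Rem]. *)
pose h x := (Num.max (A (c_ x) - Rem (c_ x) - U x) 0)%R.
have h0 x : (0 <= h x)%R by rewrite le_max lexx orbT.
have mh : measurable_fun setT h.
  apply: measurable_maxr => //; apply: measurable_funB => //.
  exact: measurable_funB.
have hI : \int[mu]_x (h x * gp x)%:E <= I.
  apply: ge0_le_lower_integral => x; first by rewrite lee_fin mulr_ge0.
  rewrite lee_fin ler_wpM2r// ge_max f0 andbT.
  by have := fA x; rewrite ler_norml /c_ /U => /andP[]; lra.
have low : ((SA + SR) * w)%:E <= I + (d%:R * tau + 2 * (SR * w))%:E.
  rewrite -big_split/= -intARem.
  apply: (@le_trans _ _ (\int[mu]_x ((h x * gp x)%:E +
      ((U x * gp x)%:E + 2%:E * (Rem (c_ x) * gp x)%:E)))).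
    apply: ge0_le_lower_integral => x; first by rewrite lee_fin mulr_ge0.
    rewrite -EFinM -!EFinD lee_fin mulrA -!mulrDl ler_wpM2r//.
    have : (A (c_ x) - Rem (c_ x) - U x <= h x)%R by rewrite le_max lexx.
    rewrite /c_; lra.
  have m1 : measurable_fun setT (fun x => (h x * gp x)%:E).
    by apply/measurable_EFinP; exact: measurable_funM.
  have m2 : measurable_fun setT (fun x => (U x * gp x)%:E).
    by apply/measurable_EFinP; exact: measurable_funM.
  have m3 : measurable_fun setT (fun x => (Rem (c_ x) * gp x)%:E).
    by apply/measurable_EFinP; exact: measurable_funM.
  have p1 x : 0 <= (h x * gp x)%:E by rewrite lee_fin mulr_ge0.
  have p2 x : 0 <= (U x * gp x)%:E by rewrite lee_fin mulr_ge0.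
  have p3 x : 0 <= (Rem (c_ x) * gp x)%:E by rewrite lee_fin mulr_ge0.
  have m4 : measurable_fun setT (fun x => 2%:E * (Rem (c_ x) * gp x)%:E).
    exact: measurable_funeM.
  have p4 x : 0 <= 2%:E * (Rem (c_ x) * gp x)%:E by rewrite mule_ge0.
  rewrite ge0_integralD//; last 2 first.
  - by move=> x _; rewrite adde_ge0.
  - exact: emeasurable_funD.
  rewrite ge0_integralD// ge0_integralZl_EFin//.
  by rewrite intRem -EFinM EFinD leeD// leeD2r.
rewrite IE; move: up low Ifin; case: I {hI IE} => [r| |]//=.
rewrite -EFinD !lee_fin => up low _.
by rewrite ler_norml; apply/andP; split; lra.
Qed.

End gaussian_quadrature.

(** * The grid of Gaussian quantiles *)

Section gaussian_grid.
Context (R : realType) (b M : nat) (b1 : (1 < b)%N) (M1 : (0 < M)%N).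

Let bR : 0 < b%:R :> R. Proof. by rewrite ltr0n ltnW. Qed.
Let bM : 0 < b%:R ^+ M :> R. Proof. by rewrite exprn_gt0. Qed.
Let bM1 : (1 < b ^ M)%N.
Proof. by rewrite -(exp1n M) ltn_exp2r. Qed.

Definition clamp (c : nat) : nat := maxn 1 (minn c (b ^ M).-1).

(* The first and last grid points are clamped to their neighbours, so that the
   extreme cells, which are unbounded in [R], have length 0. *)
Definition grid (c : nat) : R := Phi_inv ((clamp c)%:R / b%:R ^+ M).

Let clamp_itv c : (0 < clamp c < b ^ M)%N.
Proof. by rewrite /clamp; move: bM1; lia. Qed.

Lemma Phi_grid c : Phi (grid c) = (clamp c)%:R / b%:R ^+ M.
Proof.
rewrite Phi_invK//; have /andP[c0 cM] := clamp_itv c.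
by rewrite divr_gt0 ?ltr0n//= ltr_pdivrMr// mul1r -natrX ltr_nat.
Qed.

Lemma grid_mono c c' : (c <= c')%N -> grid c <= grid c'.
Proof.
move=> cc'; rewrite -ler_PhiE !Phi_grid ler_pM2r ?invr_gt0// ler_nat /clamp.
by move: cc'; lia.
Qed.

Let Phi_grid0 : Phi (grid 0) = b%:R ^- M.
Proof. by rewrite Phi_grid /clamp min0n maxn0 mul1r. Qed.

Let Phi_gridM : Phi (grid (b ^ M)) = 1 - b%:R ^- M.
Proof.
rewrite Phi_grid (_ : clamp _ = (b ^ M - 1)%N); last first.
  by rewrite /clamp; move: bM1; lia.
by rewrite natrB ?(ltnW bM1)// natrX mulrBl divff ?gt_eqF// mul1r.
Qed.

Lemma tail_geE (x p : R) : (p <= tail x) = (p <= Phi x <= 1 - p).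
Proof.
have := Phi0 R; rewrite /tail; have [x0 P0|x0 P0] := leP 0 x.
  rewrite ger0_norm//; have := ler_Phi x0; rewrite P0 => hx.
  by apply/idP/andP => [h|[h1 h2]]; [split; lra|lra].
rewrite ltr0_norm// PhiN; have := ltr_Phi x0; rewrite P0 => hx.
by apply/idP/andP => [h|[h1 h2]]; [split; lra|lra].
Qed.

Lemma inbox_tail d (z : 'cV[R]_d) i :
  inbox (grid 0) (grid (b ^ M)) z -> b%:R ^- M <= tail (z i 0).
Proof.
move=> /(_ i) /andP[h1 h2]; rewrite tail_geE -[X in X <= _]Phi_grid0 ler_PhiE h1/=.
by rewrite -Phi_gridM ler_PhiE.
Qed.

Lemma grid_cell c x : (0 < c < (b ^ M).-1)%N ->
  c%:R / b%:R ^+ M <= Phi x <= c.+1%:R / b%:R ^+ M ->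
  grid c <= x <= grid c.+1.
Proof.
move=> cM cx; rewrite -[grid c <= _]ler_PhiE -[_ <= grid c.+1]ler_PhiE !Phi_grid.
have -> : clamp c = c by rewrite /clamp; move: bM1 cM; lia.
by have -> : clamp c.+1 = c.+1 by rewrite /clamp; move: bM1 cM; lia.
Qed.

Lemma extreme_cell_tail (x : R) : (cell_of b M x == 0%N) || (cell_of b M x == (b ^ M).-1) ->
  tail x <= b%:R ^- M.
Proof.
rewrite tail_leE !cell_of_eq// !natrX => /orP[/andP[_ h]|/andP[h _]].
  by rewrite ltW// -[ltRHS]mul1r.
apply/orP; right; apply: le_trans h.
by rewrite -subn1 natrB ?(ltnW bM1)// natrX mulrBl divff ?gt_eqF// mul1r.
Qed.

(** The crude [|x| <= exp |x|] is enough: [expR_le_tail] with [c = 1] turns it into a power of the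
    tail, which is at least [b ^- M] at grid points. *)
Lemma grid_width (a : R) : 0 < a ->
  grid (b ^ M) - grid 0 <= 2 * expR ((2 * a)^-1) * (b%:R `^ a) ^+ M.
Proof.
move=> a0.
have bound c : (c <= b ^ M)%N -> `|grid c| <= expR ((2 * a)^-1) * (b%:R `^ a) ^+ M.
  move=> cbM; have := expR_le_tail (grid c) ler01 a0; rewrite mul1r expr1n mul1r => H.
  apply: (@le_trans _ _ (expR `|grid c|)).
    by apply: le_trans (expR_ge1Dx _); rewrite lerDr.
  apply: (le_trans H); rewrite ler_wpM2l ?expR_ge0// -powRV_exprn//.
  rewrite le_powRN ?invr_gt0 ?(ltW a0)//.
  rewrite tail_geE -[X in X <= _]Phi_grid0 -Phi_gridM !(@ler_PhiE R (grid _)).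
  by rewrite !grid_mono.
have h1 := le_trans (ler_norm _) (bound (b ^ M)%N (leqnn _)).
have h2 : - grid 0 <= expR ((2 * a)^-1) * (b%:R `^ a) ^+ M.
  by apply: le_trans (bound 0%N (leq0n _)); rewrite -normrN ler_norm.
by rewrite -mulrA; lra.
Qed.

End gaussian_grid.

(** * Smolyak estimates on the Gaussian grid *)

Section smolyak_gaussian.
Context (R : realType) (d b M : nat) (b1 : (1 < b)%N) (M1 : (0 < M)%N).
Implicit Types (c : 'I_d -> nat) (z : 'cV[R]_d).
Context (f : 'cV[R]_d -> R) (B : R) (B0 : 0 <= B).
Notation grid := (@grid R b M).
Context (fB : mixed_bounded (grid 0) (grid (b ^ M)) (enum 'I_d) f B).

Let gmono (c c' : nat) : (c <= c' <= b ^ M)%N -> grid c <= grid c'.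
Proof. by case/andP => cc' _; exact: grid_mono. Qed.

Definition smolyak_cell (c : 'I_d -> nat) : R :=
  smolyak (fun j => node b M grid (c j)) (enum 'I_d) M f 0.

Definition rem_cell (c : 'I_d -> nat) : R :=
  smolyak_rem (fun j => level_length b M grid (c j)) (enum 'I_d) M.

Let level_length_ge0' (c k : nat) : 0 <= level_length b M grid c k.
Proof.
case: k => [//|k] /=; rewrite /cell_length subr_ge0; apply: grid_mono => //.
by rewrite leq_mul2r leqnSn orbT.
Qed.

Lemma rem_cell_ge0 c : 0 <= rem_cell c.
Proof. by apply: smolyak_rem_ge0 => j k; exact: level_length_ge0'. Qed.

Lemma smolyak_cell_error c z : (forall j, (c j < b ^ M)%N) ->
  (forall j, grid (c j) <= z j 0 <= grid (c j).+1) ->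
  `|f z - smolyak_cell c| <= B * rem_cell c.
Proof.
move=> cM cz.
have zb : inbox (grid 0) (grid (b ^ M)) z.
  move=> j; have /andP[h1 h2] := cz j.
  by rewrite (le_trans _ h1) ?(le_trans h2)//; apply: grid_mono.
(* All coordinates get frozen at nodes, so the base point is immaterial and 0 serves for the whole
   cell. *)
have -> : smolyak_cell c = smolyak (fun j => node b M grid (c j)) (enum 'I_d) M f z.
  apply: smolyak_ext => u v uv; congr f; apply/colP => i.
  by apply: uv; rewrite mem_enum.
apply: (smolyak_error (enum_uniq _) B0 fB zb (leqnn M)) => //.
- by move=> j k _; apply: node_range.
- by move=> j k kM; apply: node_step.
- by move=> j k kM; apply: node_dist.
Qed.

(** A point of the box in every cell, extreme ones included; comparing with [f] there bounds the
    Smolyak value when the sample itself lies outside the box. *)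
Let corner c : 'cV[R]_d := \col_j grid (c j).

Let corner_cell c j : grid (c j) <= corner c j 0 <= grid (c j).+1.
Proof. by rewrite mxE lexx grid_mono. Qed.

Let corner_box c : (forall j, (c j < b ^ M)%N) ->
  inbox (grid 0) (grid (b ^ M)) (corner c).
Proof. by move=> cM j; rewrite mxE !grid_mono// ltnW. Qed.

Lemma smolyak_cell_bound c : (forall j, (c j < b ^ M)%N) ->
  `|smolyak_cell c| <= B + B * rem_cell c.
Proof.
move=> cM; have := smolyak_cell_error cM (corner_cell c).
have [_ /(_ [::] (sub0seq _) _ (corner_box cM))/=] := fB.
rewrite -[X in _ -> _ -> X <= _]normrN => h1 h2.
have -> : - smolyak_cell c = (f (corner c) - smolyak_cell c) - f (corner c) by ring.
by rewrite (le_trans (ler_normB _ _))// addrC lerD.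
Qed.

Lemma smolyak_cell_rem_ge0 c : (forall z, 0 <= f z) -> (forall j, (c j < b ^ M)%N) ->
  0 <= smolyak_cell c + B * rem_cell c.
Proof.
move=> f0 cM; have := smolyak_cell_error cM (corner_cell c).
by rewrite ler_norml => /andP[_]; have := f0 (corner c); lra.
Qed.

Let total (c : 'I_d -> nat) : (forall j, (c j < b ^ M)%N) ->
  in_cell b M c (fun=> 0%N) (fun=> 0%N).
Proof. by move=> cM; apply/forallP => j; rewrite /coarse subn0 divn_small. Qed.

Lemma smolyak_cell_sum (I : finType) (w : I -> R) (c : I -> 'I_d -> nat) :
  net_weights b M w c ->
  \sum_i w i * smolyak_cell (c i) = smolyak_quad b M grid (enum 'I_d) M f 0.
Proof.
move=> nw; have [cM _] := nw.
have := @smolyak_exact _ _ _ _ b1 grid _ _ _ (enum 'I_d) M f 0 (fun=> 0%N) (fun=> 0%N) nw.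
rewrite sum_nat_const muln0 expr0 invr1 mul1r => <- //.
  by apply: eq_bigl => i; rewrite total.
exact: enum_uniq.
Qed.

Lemma rem_cell_sum (I : finType) (w : I -> R) (c : I -> 'I_d -> nat) (Lam : R) :
  1 <= Lam -> grid (b ^ M) - grid 0 <= Lam -> net_weights b M w c ->
  \sum_i w i * rem_cell (c i) <= b%:R ^- M * (M.+2%:R * b%:R * Lam) ^+ d.
Proof.
move=> Lam1 gLam nw; have [cM _] := nw.
have := @smolyak_rem_sum _ _ _ _ b1 grid gmono Lam Lam1 gLam _ _ _ (enum 'I_d) M
  (fun=> 0%N) (fun=> 0%N) nw (enum_uniq _).
rewrite sum_nat_const muln0 add0n size_enum_ord => H.
apply: le_trans (H _ _ _) => //.
by rewrite le_eqVlt; apply/orP; left; apply/eqP/eq_bigl => i; rewrite total.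
Qed.

End smolyak_gaussian.

(** * Uniform weights on the finest cells *)

Section uniform_cells.
Context (R : realType) (d b M : nat) (b1 : (1 < b)%N).

Let count_block (K B a : nat) : (0 < B)%N ->
  (\sum_(0 <= x < K * B | x %/ B == a) 1 = (a < K) * B)%N.
Proof.
move=> B0; elim: K => [|K IH]; first by rewrite mul0n big_geq.
rewrite mulSn addnC (@big_cat_nat _ _ _ (K * B)%N)//= ?leq_addr// IH.
rewrite big_nat_cond (eq_bigl (fun x => (K * B <= x < K * B + B) && (K == a)))%N; last first.
  move=> x; case: (boolP (_ <= x < _)%N) => //= /andP[x1 x2].
  congr (_ == a); rewrite -(subnKC x1) divnMDl// divn_small ?addn0//.
  by move: x1 x2; lia.
rewrite -big_nat_cond; case: (eqVneq K a) => [->|Ka].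
  by rewrite ltnn ltnS leqnn mul0n mul1n sum_nat_const_nat addKn muln1.
rewrite big_pred0 ?addn0 => [|x]; last by [].
by have -> : (a < K.+1)%N = (a < K)%N by move: Ka; lia.
Qed.

(** These are the Gaussian masses of the products of quantile cells; as they satisfy [net_weights],
    the Gaussian side gets the same Smolyak sum as a net. *)
Lemma uniform_net_weights :
  net_weights b M (fun _ : {ffun 'I_d -> 'I_(b ^ M)} => b%:R ^- M ^+ d : R)
    (fun c j => c j).
Proof.
have bR : 0 < b%:R :> R by rewrite ltr0n ltnW.
split=> [c j|r a rM ab]; first exact: ltn_ord.
pose F j (x : 'I_(b ^ M)) : R := (coarse b M (r j) x == a j)%:R * b%:R ^- M.
transitivity (\sum_(c : {ffun 'I_d -> 'I_(b ^ M)}) \prod_j F j (c j)).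
  rewrite [RHS](bigID (fun c : {ffun 'I_d -> 'I_(b ^ M)} => in_cell b M (fun j => c j) r a))/=.
  rewrite [X in _ = _ + X]big1 ?addr0 => [|c]; last first.
    rewrite negb_forall => /existsP[j cj]; rewrite (bigD1 j)//= /F (negbTE cj).
    by rewrite !mul0r.
  apply: eq_bigr => c /forallP ca.
  rewrite (eq_bigr (fun=> b%:R ^- M)) ?prodr_const ?card_ord// => j _.
  by rewrite /F ca mul1r.
rewrite -(bigA_distr_bigA F) -prodrXr -prodfV; apply: eq_bigr => j _.
have rjM : (r j <= M)%N by rewrite (leq_trans _ rM)// (bigD1 j)//= leq_addr.
rewrite -mulr_suml -natr_sum.
have -> : (\sum_(x < b ^ M) (coarse b M (r j) x == a j) = b ^ (M - r j))%N.
  rewrite -(big_mkord xpredT (fun x => (coarse b M (r j) x == a j) : nat)).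
  have -> : (b ^ M = b ^ r j * b ^ (M - r j))%N by rewrite -expnD subnKC.
  have B0 : (0 < b ^ (M - r j))%N by rewrite expn_gt0 ltnW.
  have H := count_block (b ^ r j) (a j) B0; rewrite ab mul1n in H.
  rewrite -[RHS]H [RHS]big_mkcond/=.
  by apply: eq_bigr => x _; rewrite /coarse; case: eqP.
rewrite natrX -[in b%:R ^- M](subnKC rjM) exprD.
by field; rewrite !expf_neq0// gt_eqF.
Qed.

End uniform_cells.

(** * Probabilities of scrambled digits *)

Section scrambling_probability.
Context (R : realType) (d b : nat) (b1 : (1 < b)%N).
Context (disp : measure_display) (Omega : measurableType disp).
Context (P : probability Omega R).
Context (Pi : 'I_d -> seq 'I_b -> Omega -> {perm 'I_b}) (nuPi : nested_uniform P Pi).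

Let bR : 0 < b%:R :> R. Proof. by rewrite ltr0n ltnW. Qed.

Let measurable_preimage_perm j s (r : seq {perm 'I_b}) :
  measurable (\big[setU/set0]_(sigma <- r) (Pi j s @^-1` [set sigma])).
Proof. by have [mPi _ _] := nuPi; apply: bigsetU_measurable => sigma _. Qed.

Let prob_preimage_perms j s (r : seq {perm 'I_b}) : uniq r ->
  P (\big[setU/set0]_(sigma <- r) (Pi j s @^-1` [set sigma])) =
  ((size r)%:R / (b`!)%:R)%:E.
Proof.
have [mPi pPi _] := nuPi.
elim: r => [|sg r IH] /=; first by rewrite big_nil measure0 mul0r.
move=> /andP[sgr ur]; rewrite big_cons.
transitivity (P (Pi j s @^-1` [set sg]) +
    P (\big[setU/set0]_(sigma <- r) (Pi j s @^-1` [set sigma])))%E; last first.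
  by rewrite IH// pPi -EFinD; congr EFin; rewrite -natr1 mulrDl mul1r addrC.
apply: measureU; [exact: mPi|exact: measurable_preimage_perm|].
rewrite -bigcup_seq; apply/seteqP; split=> // w /= [E1 [sg' /= sg'r E]].
by move: sgr; rewrite -E1 E sg'r.
Qed.

Let preimageE j s (x e : 'I_b) :
  Pi j s @^-1` [set sigma | sigma x = e] =
  \big[setU/set0]_(sigma <- enum [pred sigma : {perm 'I_b} | sigma x == e])
    (Pi j s @^-1` [set sigma]).
Proof.
rewrite -bigcup_seq; apply/seteqP; split=> w /=.
  by move=> E; exists (Pi j s w) => //=; rewrite mem_enum inE E.
by move=> [sg /=]; rewrite mem_enum inE => /eqP E ->.
Qed.

Let card_perm_point (x e : 'I_b) :
  (b * #|[pred sigma : {perm 'I_b} | sigma x == e]| = b`!)%N.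
Proof.
have inv e' : #|[pred sigma : {perm 'I_b} | sigma x == e']| =
    #|[pred sigma : {perm 'I_b} | sigma x == e]|.
  rewrite -!sum1_card (reindex_inj (mulIg (tperm e e')))/=.
  apply: eq_bigl => sg; rewrite !inE permM.
  by rewrite -[X in _ == X](tpermL e e') (inj_eq perm_inj).
rewrite -card_Sn -[RHS]sum1_card (partition_big (fun sigma : {perm 'I_b} => sigma x) xpredT)//=.
rewrite (eq_bigr (fun=> #|[pred sigma : {perm 'I_b} | sigma x == e]|)); last first.
  by move=> e' _; rewrite sum1_card -(inv e').
by rewrite sum_nat_const card_ord.
Qed.

Lemma prob_perm_point j s (x e : 'I_b) :
  measurable (Pi j s @^-1` [set sigma | sigma x = e]) /\
  P (Pi j s @^-1` [set sigma | sigma x = e]) = (b%:R^-1)%:E.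
Proof.
rewrite preimageE; split; first exact: measurable_preimage_perm.
rewrite prob_preimage_perms ?enum_uniq//; congr EFin.
rewrite -cardE.
have bf := card_perm_point x e.
have c0 : (#|[pred sigma : {perm 'I_b} | sigma x == e]|)%:R != 0 :> R.
  rewrite pnatr_eq0; apply/eqP => c0; move: bf; rewrite c0 muln0 => /esym/eqP.
  by rewrite -leqn0 leqNgt fact_gt0.
rewrite -bf natrM; field.
by rewrite c0 gt_eqF.
Qed.

(** A constant word is enough: extreme cells are those whose digits are all 0 or all [b - 1]. *)
Definition digits_event j (u : nat -> 'I_b) (k : nat) (e : 'I_b) : set Omega :=
  [set w | forall l, (l < k)%N -> scramble_digits (fun s => Pi j s w) u l = e].

Let digits_eventE j u k e : digits_event j u k e =
  \bigcap_(x in [set` [seq (j, mkseq u l) | l <- iota 0 k]])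
    (Pi x.1 x.2 @^-1` [set sigma | sigma (u (size x.2)) = e]).
Proof.
apply/seteqP; split=> w /=.
  move=> H x /= /mapP[l]; rewrite mem_iota /= => lk -> /=.
  by rewrite size_mkseq; exact: H.
move=> H l lk; have := H (j, mkseq u l); rewrite /= size_mkseq; apply.
by apply/mapP; exists l; rewrite // mem_iota.
Qed.

Lemma measurable_digits_event j u k e : measurable (digits_event j u k e).
Proof.
rewrite digits_eventE; apply: fin_bigcap_measurable; first exact: finite_seq.
by move=> x _; case: (prob_perm_point x.1 x.2 (u (size x.2)) e).
Qed.

(** The permutations involved are labelled by the prefixes of [u], distinct because their lengths
    are; independence then gives [k] factors [1 / b]. *)
Lemma prob_digits_event j u k e : P (digits_event j u k e) = (b%:R ^- k)%:E.
Proof.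
have [_ _ ind] := nuPi; rewrite digits_eventE ind; last first.
  rewrite map_inj_in_uniq ?iota_uniq// => l l' _ _ [E].
  by rewrite -(size_mkseq u l) E size_mkseq.
rewrite big_map -[X in iota 0 X]subn0 -/(index_iota 0 k) big_mkord.
rewrite (eq_bigr (fun=> (b%:R^-1)%:E)); last first.
  by move=> l _; case: (prob_perm_point j (mkseq u l) (u (size (mkseq u l))) e).
by rewrite prodEFin prodr_const card_ord exprVn.
Qed.

End scrambling_probability.

(** * Location of scrambled points *)

Section scrambled_points.
Context (R : realType) (b : nat) (b1 : (1 < b)%N).
Implicit Types (v : nat -> 'I_b).

Let bR : 0 < b%:R :> R. Proof. by rewrite ltr0n ltnW. Qed.

Definition extreme_word v k :=
  (word_value v k == 0%N) || (word_value v k == (b ^ k).-1).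

Let point v : R := Phi_inv (of_digits R v).

(** The spare level [k.+1] makes the comparison strict, which excludes a point sitting on the
    boundary between an extreme cell and its neighbour. *)
Lemma tail_extreme_word v k : (0 < k)%N -> tail (point v) <= b%:R ^- k.+1 ->
  extreme_word v k.
Proof.
move=> k0 tk; have bk : 0 < b%:R ^+ k :> R by rewrite exprn_gt0.
have bk1 : b%:R ^- k.+1 < b%:R ^- k :> R.
  by rewrite ltf_pV2 ?posrE ?exprn_gt0// ltr_eXn2l// ltr1n.
have u01 : 0 < of_digits R v < 1.
  (* Coordinates 0 and 1 are sent to the origin, whose tail is [1 / 2]; with [k > 0] this exceeds
     [b ^- k.+1]. *)
  apply: contraT => u01; move: tk; rewrite /point (Phi_inv_junk u01) /tail normr0 Phi0.
  have : b%:R ^- k.+1 < 2^-1 :> R.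
    rewrite ltf_pV2 ?posrE ?exprn_gt0// -natrX ltr_nat.
    apply: (@leq_trans (2 ^ k.+1)); last by rewrite leq_exp2r.
    by rewrite -{1}(expn1 2) ltn_exp2l.
  lra.
move: tk; rewrite tail_leE /point Phi_invK// /extreme_word.
have wlt := word_value_lt b1 v k; have ge := of_digits_ge b1 R v k.
have le := of_digits_le b1 R v k.
have bb : b%:R ^- k = 1 / b%:R ^+ k :> R by rewrite mul1r.
case/orP => h; apply/orP; [left|right].
  have : (word_value v k)%:R / b%:R ^+ k < 1 / b%:R ^+ k :> R by rewrite -bb; lra.
  by rewrite ltr_pM2r ?invr_gt0// (ltr_nat _ _ 1) ltnS leqn0.
have : ((b ^ k).-1)%:R / b%:R ^+ k < (word_value v k).+1%:R / b%:R ^+ k :> R.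
  have -> : ((b ^ k).-1)%:R / b%:R ^+ k = 1 - b%:R ^- k :> R.
    rewrite -subn1 natrB ?expn_gt0 ?(ltnW b1)// natrX mulrBl mul1r divff ?gt_eqF//.
  lra.
rewrite ltr_pM2r ?invr_gt0// ltr_nat ltnS => h2.
by rewrite eqn_leq h2 andbT; move: wlt; lia.
Qed.

Lemma extreme_wordP v k : extreme_word v k ->
  (forall l, (l < k)%N -> v l = Ordinal (ltnW b1)) \/
  (forall l, (l < k)%N -> v l = Ordinal (leq_trans (ltnSn _) (eq_leq (prednK (ltnW b1))))).
Proof.
rewrite /extreme_word -{1}(word_value_const0 b1 k) -(word_value_constp b1 k).
rewrite !(word_value_eq b1) => /orP[/allP H|/allP H]; [left|right] => l lk.
  by rewrite (eqP (H l _)) ?mem_iota//; exact: val_inj.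
by rewrite (eqP (H l _)) ?mem_iota//; exact: val_inj.
Qed.

Lemma scrambled_point_cell M v : (0 < M)%N -> ~~ extreme_word v M ->
  @grid R b M (word_value v M) <= point v <= @grid R b M (word_value v M).+1.
Proof.
move=> M0; rewrite negb_or => /andP[w0 wM]; have wlt := word_value_lt b1 v M.
have bM : 0 < b%:R ^+ M :> R by rewrite exprn_gt0.
have w1 : (0 < word_value v M < (b ^ M).-1)%N by move: w0 wM wlt; lia.
have u01 : 0 < of_digits R v < 1.
  rewrite (lt_le_trans _ (of_digits_ge b1 R v M)) ?divr_gt0 ?ltr0n ?lt0n//=.
  apply: le_lt_trans (of_digits_le b1 R v M) _.
  by rewrite ltr_pdivrMr// mul1r -natrX ltr_nat; move: w1; lia.
apply: grid_cell => //; rewrite /point Phi_invK//.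
by rewrite of_digits_ge ?of_digits_le.
Qed.

End scrambled_points.

(** * Two general inequalities *)

Lemma measure_bigsetU_le (R : realType) (dd : measure_display)
    (T : measurableType dd) (mu : {measure set T -> \bar R})
    (I : Type) (r : seq I) (A : I -> set T) :
  (forall i, measurable (A i)) ->
  (mu (\big[setU/set0]_(i <- r) A i) <= \sum_(i <- r) mu (A i))%E.
Proof.
move=> mA; elim: r => [|i r IH]; first by rewrite !big_nil measure0.
rewrite !big_cons (le_trans (measureU2 _ _ _))//; last by rewrite leeD2l.
by apply: bigsetU_measurable.
Qed.

(** Lagrange's identity: twice the defect is a double sum of squares. *)
Lemma sum_cauchy_schwarz (R : realFieldType) (I : finType) (x y : I -> R) :
  (\sum_i x i * y i) ^+ 2 <= (\sum_i x i ^+ 2) * (\sum_i y i ^+ 2).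
Proof.
have : 0 <= \sum_i \sum_j (x i * y j - x j * y i) ^+ 2.
  by apply: sumr_ge0 => i _; apply: sumr_ge0 => j _; exact: sqr_ge0.
have -> : \sum_i \sum_j (x i * y j - x j * y i) ^+ 2 =
    2 * ((\sum_i x i ^+ 2) * (\sum_i y i ^+ 2)) - 2 * (\sum_i x i * y i) ^+ 2.
  transitivity (\sum_i \sum_j (x i ^+ 2 * y j ^+ 2 + x j ^+ 2 * y i ^+ 2 -
      2 * (x i * y i * (x j * y j)))).
    by apply: eq_bigr => i _; apply: eq_bigr => j _; ring.
  under eq_bigr do rewrite sumrB big_split/=.
  rewrite sumrB big_split/=; congr (_ - _).
    rewrite [X in _ + X = _](_ : _ = (\sum_i x i ^+ 2) * (\sum_i y i ^+ 2)).
      rewrite [X in X + _ = _](_ : _ = (\sum_i x i ^+ 2) * (\sum_i y i ^+ 2)).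
        by ring.
      by rewrite mulr_suml; apply: eq_bigr => i _; rewrite mulr_sumr.
    rewrite mulrC mulr_suml; apply: eq_bigr => i _.
    by rewrite mulr_sumr; apply: eq_bigr => j _; rewrite mulrC.
  rewrite expr2 mulr_suml mulr_sumr; apply: eq_bigr => i _.
  by rewrite !mulr_sumr.
lra.
Qed.

(** * Mean square error for given growth constants *)

Section mean_square_error.

Let extreme_nat (n p : nat) : (n < p)%N -> ~~ (0 < n < p.-1)%N ->
  (n == 0%N) || (n == p.-1).
Proof. by lia. Qed.

Context (R : realType) (d b : nat) (b1 : (1 < b)%N) (d0 : (0 < d)%N).
Implicit Types (z : 'cV[R]_d).
Context (f : 'cV[R]_d -> R) (C a : R).
Context (f0 : forall z, 0 <= f z) (C0 : 0 < C) (a0 : 0 < a).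
Context (a_small : a * d%:R < 2^-1).
Context (df : mixed_derivable (enum 'I_d) f).
Context (fC : forall w, subseq w (enum 'I_d) -> forall z,
  `|mixed_partial w f z| <= C * \prod_(i < d) tail (z i 0) `^ (- a)).

(** Growth of the derivative bound per level: [Y] for one coordinate, [beta] for all [d]
    together. *)
Let Y : R := b%:R `^ a.
Let beta : R := Y ^+ d.

Let bR : 0 < b%:R :> R. Proof. by rewrite ltr0n ltnW. Qed.
Let bR1 : 1 < b%:R :> R. Proof. by rewrite ltr1n. Qed.

Let powR_b_gt1 (x : R) : 0 < x -> 1 < b%:R `^ x.
Proof.
move=> x0; have E1 : 1 `^ x = 1 :> R by rewrite powR1.
by rewrite -[ltLHS]E1 gt0_ltr_powR ?nnegrE// ltW.
Qed.

Let Y1 : 1 < Y. Proof. exact: powR_b_gt1. Qed.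
Let Y0 : 0 < Y. Proof. exact: lt_trans Y1. Qed.
Let beta_ge1 : 1 <= beta. Proof. by rewrite exprn_ege1// ltW. Qed.
Let beta0 : 0 < beta. Proof. exact: lt_le_trans beta_ge1. Qed.

Let betaE : beta = b%:R `^ (a * d%:R).
Proof. by rewrite powRrM powR_mulrn// powR_ge0. Qed.

(** The use of [a d < 1 / 2]: extreme level [k] has probability of order [b ^- k] and [f ^ 2] is
    there of order [beta ^ (2 k)], so the second moment converges. *)
Let beta2_lt : beta ^+ 2 < b%:R.
Proof.
rewrite betaE -powR_mulrn ?powR_ge0// -powRrM.
have {2}-> : b%:R = b%:R `^ (a * d%:R * 2) * b%:R `^ (1 - a * d%:R * 2) :> R.
  rewrite -powRD ?(gt_eqF bR) ?implybT//.
  by rewrite addrC subrK powRr1// ltW.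
have h : 0 < 1 - a * d%:R * 2 by move: a_small; lra.
by rewrite ltr_pMr ?powR_gt0// powR_b_gt1.
Qed.

Let beta_lt : beta < b%:R.
Proof. by apply: le_lt_trans beta2_lt; rewrite expr2 ler_peMl// ltW. Qed.

Let prod_tail_le z k : (forall i, b%:R ^- k <= tail (z i 0)) ->
  \prod_(i < d) tail (z i 0) `^ (- a) <= beta ^+ k.
Proof.
move=> zk; rewrite /beta exprAC -[X in _ <= _ ^+ X]card_ord -prodr_const.
apply: ler_prod => i _; by rewrite powR_ge0/= -powRV_exprn// le_powRN ?invr_gt0 ?exprn_gt0 ?(ltW a0).
Qed.

Notation B M := (C * beta ^+ M).
Notation grid := (@grid R).

Let B_ge0 M : 0 <= B M. Proof. by rewrite mulr_ge0 ?exprn_ge0// ltW. Qed.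

Let f_bounded M : (0 < M)%N ->
  mixed_bounded (grid b M 0) (grid b M (b ^ M)) (enum 'I_d) f (B M).
Proof.
move=> M0; split=> // w we z zb; apply: le_trans (fC we z) _.
by rewrite ler_wpM2l ?(ltW C0)// prod_tail_le// => i; exact: inbox_tail zb.
Qed.

Let bernoulli M : 1 + M%:R * (Y - 1) <= Y ^+ M.
Proof.
elim: M => [|M IH]; first by rewrite mul0r addr0 expr0.
have h : 0 <= M%:R * (Y - 1) * (Y - 1) by rewrite !mulr_ge0 ?ler0n ?subr_ge0 ?(ltW Y1).
have : (1 + M%:R * (Y - 1)) * Y <= Y ^+ M * Y by rewrite ler_wpM2r// ltW.
rewrite -exprSr -natr1; lra.
Qed.

Let linear_le_exp M : M.+2%:R <= (2 + (Y - 1)^-1) * Y ^+ M.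
Proof.
have y0 : 0 < Y - 1 by rewrite subr_gt0.
have -> : M.+2%:R = M%:R * (Y - 1) * (Y - 1)^-1 + 2 :> R.
  by rewrite mulfK ?gt_eqF// -addn2 natrD.
have := bernoulli M; set p := Y ^+ M; set n := M%:R * (Y - 1) => np.
have p1 : 1 <= p by rewrite exprn_ege1// ltW.
rewrite mulrDl addrC; apply: lerD; first lra.
by rewrite mulrC ler_wpM2l ?invr_ge0 ?(ltW y0)//; lra.
Qed.

Let E := expR ((2 * a)^-1) : R.
Let K1 := C * ((2 + (Y - 1)^-1) * b%:R * (2 * E + 1)) ^+ d.

Let K1_ge0 : 0 <= K1.
Proof.
rewrite mulr_ge0 ?(ltW C0)// exprn_ge0// !mulr_ge0 ?(ltW bR)//.
  by rewrite addr_ge0// invr_ge0 subr_ge0 ltW.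
by rewrite addr_ge0// mulr_ge0// expR_ge0.
Qed.

(** The exponent 3 counts [B M], the [d] factors [M.+2] (absorbed by [linear_le_exp]) and the [d]
    factors [Lam], each worth one [beta ^ M]. *)
Let rem_sum_le M (I : finType) (w : I -> R) (c : I -> 'I_d -> nat) : (0 < M)%N ->
  net_weights b M w c ->
  B M * \sum_i w i * rem_cell R b M (c i) <= K1 * (beta ^+ 3 / b%:R) ^+ M.
Proof.
move=> M0 nw; have YM1 : 1 <= Y ^+ M by rewrite exprn_ege1// ltW.
have E0 : 0 <= E by exact: expR_ge0.
pose Lam := (2 * E + 1) * Y ^+ M.
have Lam1 : 1 <= Lam by rewrite mulr_ege1//; lra.
have gLam : grid b M (b ^ M) - grid b M 0 <= Lam :> R.
  apply: le_trans (grid_width b1 M0 a0) _; rewrite -/E -/Y ler_wpM2r ?(le_trans _ YM1)//.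
  by rewrite lerDl.
apply: le_trans (ler_wpM2l (B_ge0 M) (rem_cell_sum b1 M0 Lam1 gLam nw)) _.
set X := (2 + (Y - 1)^-1).
have XL : (M.+2%:R * b%:R * Lam) ^+ d <= (X * b%:R * (2 * E + 1)) ^+ d * (beta ^+ M) ^+ 2.
  have -> : (X * b%:R * (2 * E + 1)) ^+ d * (beta ^+ M) ^+ 2 =
      ((X * Y ^+ M) * b%:R * ((2 * E + 1) * Y ^+ M)) ^+ d.
    by rewrite /beta (exprAC Y d M) -exprM mulnC exprM -exprMn; congr (_ ^+ _); ring.
  have L0 : 0 <= Lam := le_trans ler01 Lam1.
  have X0 : 0 <= M.+2%:R * b%:R * Lam by rewrite mulr_ge0// mulr_ge0// ler0n.
  have XL : M.+2%:R * b%:R * Lam <= X * Y ^+ M * b%:R * Lam.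
    by rewrite ler_wpM2r// ler_wpM2r ?(ltW bR)// linear_le_exp.
  by rewrite lerXn2r ?nnegrE// (le_trans X0 XL).
have bM0 : 0 <= b%:R ^- M :> R by rewrite invr_ge0 exprn_ge0// ltW.
apply: le_trans (ler_wpM2l (B_ge0 M) (ler_wpM2l bM0 XL)) _.
rewrite /K1 -/X le_eqVlt; apply/orP; left; apply/eqP.
rewrite expr_div_n (exprAC beta 3 M); move: (beta ^+ M) => p; field.
by rewrite expf_neq0// gt_eqF.
Qed.

Let Q M : R := smolyak_quad b M (grid b M) (enum 'I_d) M f 0.

Let tailmin z : exists i : 'I_d, forall l, tail (z i 0) <= tail (z l 0).
Proof.
have i0 : 'I_d := Ordinal d0.
by case: (@arg_minP _ _ _ i0 xpredT (fun i => tail (z i 0)) isT) => i _ H; exists i => l; exact: H.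
Qed.

(** Charging every factor to the smallest tail reduces the extreme region to one-dimensional
    integrals, with exponent [a d]. *)
Let prod_tail_le_min z i : (forall l, tail (z i 0) <= tail (z l 0)) ->
  \prod_(l < d) tail (z l 0) `^ (- a) <= tail (z i 0) `^ (- (a * d%:R)).
Proof.
move=> zi; rewrite -mulNr powRrM powR_mulrn ?powR_ge0//.
rewrite -[X in _ <= _ ^+ X]card_ord -prodr_const; apply: ler_prod => l _.
by apply/andP; split; [exact: powR_ge0|apply: le_powRN => //; [exact: ltW|exact: tail_gt0]].
Qed.

Let kap := a * d%:R.
Let kap01 : 0 < kap < 1.
Proof. by apply/andP; split; [rewrite mulr_gt0// ltr0n|move: a_small; rewrite /kap; lra]. Qed.

Let K2 := d%:R * (2 * C * (beta * 2 / (1 - beta / b%:R))).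

Let gauss_error M : (0 < M)%N ->
  `|gaussian_integral f - Q M| <= (K1 + K2) * (beta ^+ 3 / b%:R) ^+ M.
Proof.
move=> M0.
pose A (c : {ffun 'I_d -> 'I_(b ^ M)}) : R := smolyak_cell b M f (fun j => c j).
pose Rem (c : {ffun 'I_d -> 'I_(b ^ M)}) : R := B M * rem_cell R b M (fun j => c j).
(* The factor 2: in an extreme cell both [f] and, up to [Rem], the Smolyak value are at most [C]
   times a power of the smallest tail. *)
pose psi x : R := 2 * C * tail_power b M kap x.
pose tau : R := 2 * C * (b%:R `^ kap * 2 * (b%:R `^ kap / b%:R) ^+ M / (1 - b%:R `^ kap / b%:R)).
have fB := f_bounded M0.
have cM (c : {ffun 'I_d -> 'I_(b ^ M)}) j : (c j < b ^ M)%N by exact: ltn_ord.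
have uw := @uniform_net_weights R d b M b1.
have QE : Q M = (\sum_c A c) * b%:R ^- M ^+ d.
  rewrite /Q -(smolyak_cell_sum b1 f uw) mulr_suml.
  by apply: eq_bigr => c _; rewrite mulrC.
have RE : (\sum_c Rem c) * b%:R ^- M ^+ d <= K1 * (beta ^+ 3 / b%:R) ^+ M.
  apply: le_trans (rem_sum_le M0 uw); rewrite le_eqVlt; apply/orP; left; apply/eqP.
  by rewrite /Rem mulr_suml mulr_sumr; apply: eq_bigr => c _; ring.
have tauE : d%:R * tau <= K2 * (beta ^+ 3 / b%:R) ^+ M.
  rewrite /tau -betaE /K2.
  have -> : d%:R * (2 * C * (beta * 2 * (beta / b%:R) ^+ M / (1 - beta / b%:R))) =
    d%:R * (2 * C * (beta * 2 / (1 - beta / b%:R))) * (beta / b%:R) ^+ M by ring.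
  rewrite ler_wpM2l//.
    rewrite !mulr_ge0 ?(ltW C0) ?(ltW beta0)// invr_ge0 subr_ge0.
    by rewrite ler_pdivrMr// mul1r ltW.
  have h0 : 0 <= beta / b%:R by rewrite divr_ge0// ltW.
  have h : beta / b%:R <= beta ^+ 3 / b%:R.
    rewrite ler_wpM2r ?invr_ge0 ?(ltW bR)//.
    by rewrite -{1}(expr1 beta) ler_weXn2l.
  by rewrite lerXn2r ?nnegrE// (le_trans h0 h).
rewrite QE mulrDl; apply: le_trans (lerD RE tauE).
apply: (@gaussian_integral_quadrature _ _ _ _ b1 f A Rem psi tau) => //.
- apply: measurable_funM => //; exact: measurable_tail_power.
- by move=> x; rewrite mulr_ge0 ?tail_power_ge0// mulr_ge0// ltW.
- by move=> c; rewrite mulr_ge0 ?rem_cell_ge0.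
- by move=> c; exact: smolyak_cell_rem_ge0.
- move=> x; set z := \col_j tnth x j; set c := tuple_cell M b1 x.
  have cE j : c j = cell_of b M (z j 0) :> nat by rewrite ffunE mxE.
  have psi0 x' : 0 <= psi x' by rewrite mulr_ge0 ?tail_power_ge0// mulr_ge0// ltW.
  have [/forallP good|] := boolP [forall j, (0 < c j < (b ^ M).-1)%N].
    apply: (@le_trans _ _ (Rem c)); last by rewrite lerDl sumr_ge0.
    apply: smolyak_cell_error => // j; apply: grid_cell => //.
    have /eqP := cE j; rewrite eq_sym cell_of_eq// !natrX => /andP[-> /ltW ->]//.
  rewrite negb_forall => /existsP[j0 cj0].
  have [i zi] := tailmin z.
  (* The smallest tail is at most that of the extreme coordinate [j0], so the cut-off in
     [tail_power] does not act at [i]. *)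
  have tM : tail (z i 0) <= b%:R ^- M.
    apply: le_trans (zi j0) _; apply: extreme_cell_tail => //.
    by rewrite -cE; exact: (extreme_nat (cM c j0) cj0).
  have tpE : tail_power b M kap (z i 0) = tail (z i 0) `^ (- kap).
    by rewrite /tail_power tM.
  have fz : `|f z| <= C * tail_power b M kap (z i 0).
    apply: le_trans (fC (sub0seq _) z) _.
    by rewrite ler_wpM2l ?(ltW C0)// tpE prod_tail_le_min.
  have BM : B M <= C * tail_power b M kap (z i 0).
    rewrite ler_wpM2l ?(ltW C0)// tpE betaE -/kap -powRV_exprn//.
    by apply: le_powRN => //; [case/andP: kap01 => /ltW|exact: tail_gt0].
  have Ac : `|A c| <= B M + Rem c by exact: smolyak_cell_bound.
  have psii : psi (tnth x i) <= \sum_l psi (tnth x l).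
    rewrite [leRHS](bigD1 i isT) lerDl; apply: sumr_ge0 => l _; exact: psi0.
  have zE : z i 0 = tnth x i by rewrite mxE.
  apply: le_trans (ler_normB _ _) _; move: psii; rewrite {1}/psi -zE; lra.
- rewrite /tau /psi EFinM.
  rewrite (eq_integral (fun x : measurableTypeR R => (2 * C)%:E * (tail_power b M kap x * normal_pdf 0 1 x)%:E)%E); last first.
    by move=> x _; rewrite -mulrA EFinM.
  rewrite ge0_integralZl_EFin//.
  + by rewrite lee_wpmul2l ?integral_tail_power// lee_fin mulr_ge0// ltW.
  + by move=> x _; rewrite lee_fin mulr_ge0 ?tail_power_ge0 ?normal_pdf_ge0.
  + apply/measurable_EFinP; apply: measurable_funM; last exact: measurable_normal_pdf.
    exact: measurable_tail_power.
  + by rewrite mulr_ge0// ltW.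
Qed.

Let e0 : 'I_b := Ordinal (ltnW b1).
Let e1 : 'I_b := Ordinal (leq_trans (ltnSn _) (eq_leq (prednK (ltnW b1)))).

Let coord_count (I : finType) (w0 : R) (c : I -> 'I_d -> nat) M j e :
  net_weights b M (fun=> w0) c -> (e < b ^ M)%N ->
  w0 * \sum_i (c i j == e)%:R = b%:R ^- M.
Proof.
move=> [cM wc] eM.
have r0 : \sum_(i < d) 0%N = 0%N by rewrite sum_nat_const muln0.
have := wc (set_at (fun=> 0%N) j M) (set_at (fun=> 0%N) j e).
rewrite sum_set_at// r0 add0n leqnn => <- //; last first.
  by move=> i; rewrite /set_at; case: ifP.
rewrite mulr_sumr [RHS]big_mkcond/=; apply: eq_bigr => i _.
have -> : in_cell b M (c i) (set_at (fun=> 0%N) j M) (set_at (fun=> 0%N) j e) = (c i j == e).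
  apply/forallP/eqP => [/(_ j)|ce k]; rewrite /set_at.
    by rewrite eqxx /coarse subnn divn1 => /eqP.
  case: (eqVneq k j) => [->|_]; first by rewrite /coarse subnn divn1 ce.
  by rewrite /coarse subn0 divn_small.
by case: eqP; rewrite ?mulr1 ?mulr0.
Qed.

Let K3 := 4 * d%:R * ((4 * C ^+ 2 * beta ^+ 4) * (2 * d%:R) / (1 - beta ^+ 2 / b%:R)).

Section one_net.
Context (t m : nat) (tm : (t < m)%N) (aa : 'I_(b ^ m) -> 'cV[R]_d).
Context (disp : measure_display) (Omega : measurableType disp).
Context (P : probability Omega R) (Pi : 'I_d -> seq 'I_b -> Omega -> {perm 'I_b}).
Context (net : is_net t aa) (nuPi : nested_uniform P Pi).

Let M := (m - t)%N.
Let M0 : (0 < M)%N. Proof. by rewrite subn_gt0. Qed.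

Let v w i j := scrambled_digit b1 aa (fun j s => Pi j s w) i j.
Let z w i : 'cV[R]_d :=
  map_mx (@Phi_inv R) (scramble (ltnW b1) (fun j s => Pi j s w) (aa i)).
Let c w i j := scrambled_word b1 aa (fun j s => Pi j s w) i j M.
Let bad w i := [exists j, extreme_word (v w i j) M].
(** The error allowance at a bad point, which may lie outside the box: [f] is kept as it is, while
    the Smolyak value is at most [B M] up to its remainder. *)
Let T w i : R := if bad w i then `|f (z w i)| + B M else 0.

Let zE w i j : z w i j 0 = Phi_inv (of_digits R (v w i j)).
Proof. by rewrite !mxE. Qed.

Let nw w : net_weights b M (fun=> b%:R ^- m : R) (c w).
Proof. exact: scramble_net_weights net. Qed.

Let T_ge0 w i : 0 <= T w i.
Proof. by rewrite /T; case: ifP => // _; rewrite addr_ge0. Qed.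

Let point_error w i :
  `|f (z w i) - smolyak_cell b M f (c w i)| <= B M * rem_cell R b M (c w i) + T w i.
Proof.
have [cM _] := nw w; rewrite /T; case: ifPn => [_|].
  have := smolyak_cell_bound b1 M0 (B_ge0 M) (f_bounded M0) (cM i) => h.
  by rewrite (le_trans (ler_normB _ _))// [leRHS]addrCA lerD2l addrC.
rewrite negb_exists => /forallP good; rewrite addr0.
apply: (smolyak_cell_error b1 M0 (B_ge0 M) (f_bounded M0)) => // j.
by rewrite zE; exact: (scrambled_point_cell R b1 M0 (good j)).
Qed.

Let bad_count w : b%:R ^- m * \sum_i (bad w i)%:R <= 2 * d%:R * b%:R ^- M :> R.
Proof.
have bM0 : (0 < b ^ M)%N by rewrite expn_gt0 ltnW.
have bM1 : ((b ^ M).-1 < b ^ M)%N by rewrite prednK.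
have -> : 2 * d%:R * b%:R ^- M = \sum_(j < d) (b%:R ^- M + b%:R ^- M) :> R.
  by rewrite sumr_const card_ord -[RHS]mulr_natl; ring.
rewrite (eq_bigr (fun j => b%:R ^- m * \sum_i (c w i j == 0%N)%:R +
    b%:R ^- m * \sum_i (c w i j == (b ^ M).-1)%:R)); last first.
  by move=> j _; rewrite !(coord_count _ (nw w)).
rewrite (eq_bigr (fun j => b%:R ^- m *
    \sum_i ((c w i j == 0%N)%:R + (c w i j == (b ^ M).-1)%:R))); last first.
  by move=> j _; rewrite -mulrDr big_split.
rewrite -mulr_sumr ler_wpM2l ?invr_ge0 ?exprn_ge0 ?(ltW bR)//.
rewrite exchange_big; apply: ler_sum => i _.
have nn j : 0 <= (c w i j == 0%N)%:R + (c w i j == (b ^ M).-1)%:R :> R.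
  by rewrite addr_ge0.
rewrite /bad; case: existsP => [[j ej]|_]; last by apply: sumr_ge0 => j _; exact: nn.
rewrite (bigD1 j isT); apply: (@le_trans _ _ ((c w i j == 0%N)%:R + (c w i j == (b ^ M).-1)%:R)).
  case/orP: ej => ej; rewrite /c /scrambled_word ej.
    by rewrite lerDl.
  by rewrite lerDr.
by rewrite lerDl; apply: sumr_ge0 => k _; exact: nn.
Qed.

(** Cauchy-Schwarz against the indicator of the bad points. Their number yields one factor [b ^- M];
    the second needed for the rate comes from the expectation of [T ^ 2]. *)
Let tail_sum_sq w :
  (b%:R ^- m * \sum_i T w i) ^+ 2 <=
  b%:R ^- m * (2 * d%:R * b%:R ^- M) * \sum_i T w i ^+ 2.
Proof.
have bm0 : 0 <= b%:R ^- m :> R by rewrite invr_ge0 exprn_ge0// ltW.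
have TE : \sum_i T w i = \sum_i (bad w i)%:R * T w i.
  by apply: eq_bigr => i _; rewrite /T; case: (bad w i); rewrite ?mul1r ?mul0r.
have S0 : 0 <= \sum_i T w i ^+ 2 by apply: sumr_ge0 => i _; exact: sqr_ge0.
have := sum_cauchy_schwarz (fun i => (bad w i)%:R : R) (T w); rewrite -TE.
have -> : \sum_i ((bad w i)%:R : R) ^+ 2 = \sum_i (bad w i)%:R.
  by apply: eq_bigr => i _; case: (bad w i); rewrite ?expr1n ?expr0n.
move=> cs; rewrite exprMn expr2 -[leLHS]mulrA -[leRHS]mulrA ler_wpM2l//.
apply: le_trans (ler_wpM2l bm0 cs) _; rewrite mulrA ler_wpM2r//.
Qed.

Let qmc w := QMC_estimate (fun i => scramble (ltnW b1) (fun j s => Pi j s w) (aa i)) f.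

(** Holds for each [w]. The net side costs [K1], the Gaussian side [K1 + K2]; the random part is
    confined to [T]. *)
Let estimate_error w :
  (qmc w - gaussian_integral f) ^+ 2 <=
  2 * ((2 * K1 + K2) * (beta ^+ 3 / b%:R) ^+ M) ^+ 2 +
  2 * (b%:R ^- m * (2 * d%:R * b%:R ^- M)) * \sum_i T w i ^+ 2.
Proof.
have bm0 : 0 <= b%:R ^- m :> R by rewrite invr_ge0 exprn_ge0// ltW.
set rho := (beta ^+ 3 / b%:R) ^+ M.
have h1 : `|qmc w - Q M| <= K1 * rho + b%:R ^- m * \sum_i T w i.
  have -> : qmc w - Q M = \sum_i b%:R ^- m * (f (z w i) - smolyak_cell b M f (c w i)).
    rewrite /qmc /QMC_estimate natrX /Q -(smolyak_cell_sum b1 f (nw w)) mulr_sumr -sumrB.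
    by apply: eq_bigr => i _; rewrite mulrBr.
  apply: le_trans (ler_norm_sum _ _ _) _.
  apply: le_trans (lerD (rem_sum_le M0 (nw w)) (lexx _)).
  rewrite !mulr_sumr -big_split/=; apply: ler_sum => i _.
  rewrite normrM ger0_norm// (mulrCA (B M)) -mulrDr ler_wpM2l//.
have h2 : `|qmc w - gaussian_integral f| <=
    (2 * K1 + K2) * rho + b%:R ^- m * \sum_i T w i.
  have -> : qmc w - gaussian_integral f = (qmc w - Q M) - (gaussian_integral f - Q M).
    by ring.
  apply: le_trans (ler_normB _ _) _; have := gauss_error M0; rewrite -/rho.
  by move: h1; lra.
rewrite -real_normK ?num_real//.
have := tail_sum_sq w; set S := b%:R ^- m * _ in h2 *; set D := (2 * K1 + K2) * rho in h2 *.
move=> h3; apply: (@le_trans _ _ (2 * D ^+ 2 + 2 * S ^+ 2)).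
  apply: (@le_trans _ _ ((D + S) ^+ 2)); first by rewrite lerXn2r ?nnegrE// (le_trans _ h2).
  by rewrite -subr_ge0 (_ : _ - _ = (D - S) ^+ 2) ?sqr_ge0//; ring.
by rewrite lerD2l -[X in _ <= X]mulrA ler_wpM2l.
Qed.

Let u i j := digit (ltnW b1) (aa i j 0).

Let extreme_event i k : set Omega := \big[setU/set0]_(j <- enum 'I_d)
  (digits_event Pi j (u i j) k e0 `|` digits_event Pi j (u i j) k e1).

Let measurable_extreme_event i k : measurable (extreme_event i k).
Proof.
by apply: bigsetU_measurable => j _; apply: measurableU;
  exact: (measurable_digits_event b1 nuPi).
Qed.

Let prob_extreme_event i k : (P (extreme_event i k) <= (2 * d%:R * b%:R ^- k)%:E)%E.
Proof.
apply: le_trans (measure_bigsetU_le _ _ _) _.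
  by move=> j; apply: measurableU; exact: (measurable_digits_event b1 nuPi).
apply: (@le_trans _ _ (\sum_(j <- enum 'I_d) (b%:R ^- k + b%:R ^- k)%:E)%E).
  apply: lee_sum => j _; apply: le_trans (measureU2 _ _ _) _.
  - exact: (measurable_digits_event b1 nuPi).
  - exact: (measurable_digits_event b1 nuPi).
  by rewrite EFinD; apply: leeD; rewrite le_eqVlt; apply/orP; left; apply/eqP;
    exact: (prob_digits_event b1 nuPi).
rewrite sumEFin lee_fin big_enum sumr_const card_ord -[leLHS]mulr_natl.
by rewrite -mulr2n -[_ *+ 2]mulr_natl mulrA (mulrC d%:R).
Qed.

Let extreme_word_event w i j k : extreme_word (v w i j) k -> extreme_event i k w.
Proof.
move=> ew; rewrite /extreme_event -bigcup_seq; exists j; first by rewrite /= mem_enum.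
by have [H|H] := extreme_wordP b1 ew; [left|right] => l lk; exact: H.
Qed.

(** Assigns to each bad point an extreme level. Both parts of [T] are at most [C beta ^ k.+2], and
    squaring their sum gives [4 C ^ 2 beta ^ 4] in front of [beta ^ (2 k)]. *)
Let tail_level w i : 0 < T w i ^+ 2 -> exists k, [/\ (M <= k)%N, extreme_event i k w &
  T w i ^+ 2 <= 4 * C ^+ 2 * beta ^+ 4 * (beta ^+ 2) ^+ k].
Proof.
rewrite /T; case: ifPn => [|_]; last by rewrite expr0n ltxx.
move=> /existsP[j0 bad0] _.
suff [k [Mk Ek fk]] : exists k, [/\ (M <= k)%N, extreme_event i k w &
    `|f (z w i)| <= C * beta ^+ k.+2].
  exists k; split=> //.
  have BM : B M <= C * beta ^+ k.+2.
    by rewrite ler_wpM2l ?(ltW C0)// ler_weXn2l// (leq_trans Mk)// -addn2 leq_addr.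
  have -> : 4 * C ^+ 2 * beta ^+ 4 * (beta ^+ 2) ^+ k = (2 * (C * beta ^+ k.+2)) ^+ 2.
    have betak : beta ^+ k.+2 = beta ^+ k * beta ^+ 2 by rewrite -exprD addn2.
    by rewrite (exprAC beta 2 k) betak; move: (beta ^+ k) (beta) => p q; ring.
  rewrite lerXn2r ?nnegrE ?addr_ge0//; last lra.
  by apply: mulr_ge0.
have [i0 zi] := tailmin (z w i).
(* The level found is lowered by one, the spare level that [tail_extreme_word] asks for. If the
   smallest tail exceeds [b ^- M.+1], badness itself supplies level [M]. *)
have [tM|tM] := leP (tail (z w i i0 0)) (b%:R ^- M.+1).
  have [k] := level_exists b1 (tail_gt0 _) tM; case: k => [//|k] Mk /andP[k1 k2].
  exists k; split => //.
    apply: (@extreme_word_event _ _ i0); apply: (@tail_extreme_word R _ b1).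
      by apply: leq_trans M0 _.
    by rewrite -zE.
  apply: le_trans (fC (sub0seq _) _) _; rewrite ler_wpM2l ?(ltW C0)//.
  by apply: prod_tail_le => l; apply: le_trans (zi l); exact: ltW.
exists M; split => //; first exact: extreme_word_event bad0.
apply: le_trans (fC (sub0seq _) _) _; rewrite ler_wpM2l ?(ltW C0)//.
apply: (@le_trans _ _ (beta ^+ M.+1)); last by rewrite ler_weXn2l.
by apply: prod_tail_le => l; apply: le_trans (zi l); exact: ltW.
Qed.

Let tail_dominated i : exists H : Omega -> \bar R, [/\ measurable_fun setT H,
  forall w, (0 <= H w)%E, forall w, ((T w i ^+ 2)%:E <= H w)%E &
  (\int[P]_w H w <= (4 * C ^+ 2 * beta ^+ 4 * (2 * d%:R) *
    (beta ^+ 2 / b%:R) ^+ M / (1 - beta ^+ 2 / b%:R))%:E)%E].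
Proof.
have bb : 0 < beta ^+ 2 < b%:R by rewrite exprn_gt0.
have dd0 : 0 <= 2 * d%:R :> R by rewrite mulr_ge0.
have CC0 : 0 <= 4 * C ^+ 2 * beta ^+ 4.
  apply: mulr_ge0; last by apply: exprn_ge0; exact: ltW.
  by apply: mulr_ge0 => //; exact: sqr_ge0.
have PE k : (M <= k)%N ->
    (\int[P]_w (\1_(extreme_event i k) w * 1)%:E <= (2 * d%:R * b%:R ^- k)%:E)%E.
  move=> _; rewrite (eq_integral (fun w => (\1_(extreme_event i k) w)%:E)); last first.
    by move=> w _; rewrite mulr1.
  rewrite integral_indic// setIT; exact: prob_extreme_event.
have m1 : measurable_fun [set: Omega] (fun=> 1 : R) by exact: measurable_cst.
have one_ge0 (w : Omega) : 0 <= (fun=> 1 : R) w by exact: ler01.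
have [H [mH H0 TH intH]] := layer_cake_dominated bb dd0 CC0 m1 one_ge0
  (measurable_extreme_event i) PE (fun w => sqr_ge0 (T w i))
  (fun w => @tail_level w i).
by exists H; split => // w; have := TH w; rewrite mulr1.
Qed.

Lemma scrambled_net_mse :
  ('E_P[fun w => ((qmc w - gaussian_integral f) ^+ 2)%R] <=
   ((2 * (2 * K1 + K2) ^+ 2 + K3) * (beta ^+ 3 / b%:R) ^+ M ^+ 2)%:E)%E.
Proof.
have bm0 : 0 <= b%:R ^- m :> R by rewrite invr_ge0 exprn_ge0// ltW.
have bM0 : 0 <= b%:R ^- M :> R by rewrite invr_ge0 exprn_ge0// ltW.
have /choice[H HP] := tail_dominated.
pose D := 2 * ((2 * K1 + K2) * (beta ^+ 3 / b%:R) ^+ M) ^+ 2.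
pose q : R := 2 * (b%:R ^- m * (2 * d%:R * b%:R ^- M)).
have D0 : 0 <= D by rewrite mulr_ge0// sqr_ge0.
have q0 : 0 <= q by rewrite !mulr_ge0.
have mH i : measurable_fun setT (H i) by case: (HP i).
have H0 i w : (0 <= H i w)%E by case: (HP i).
have SH0 w : (0 <= \sum_i H i w)%E by apply: sume_ge0 => i _.
have mSH : measurable_fun setT (fun w => \sum_i H i w)%E.
  by apply: emeasurable_sum => i.
rewrite unlock; apply: (@le_trans _ _ (\int[P]_w (D%:E + q%:E * \sum_i H i w))%E).
  apply: ge0_le_lower_integral => w; first by rewrite lee_fin sqr_ge0.
  apply: (@le_trans _ _ (D + q * \sum_i T w i ^+ 2)%:E).
    by rewrite lee_fin; exact: estimate_error.
  rewrite EFinD leeD2l// EFinM lee_wpmul2l ?lee_fin// -sumEFin.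
  by apply: lee_sum => i _; case: (HP i).
rewrite ge0_integralD//; last 2 first.
- by move=> w _; rewrite mule_ge0.
- exact: measurable_funeM.
have ID : (\int[P]_w D%:E = D%:E)%E by have := expectation_cst P D; rewrite unlock.
rewrite ID ge0_integralZl_EFin//.
rewrite ge0_integral_sum//.
set X := 4 * C ^+ 2 * beta ^+ 4 * (2 * d%:R) * (beta ^+ 2 / b%:R) ^+ M /
  (1 - beta ^+ 2 / b%:R).
apply: (@le_trans _ _ (D%:E + q%:E * \sum_(i < b ^ m) X%:E)%E).
  rewrite leeD2l// lee_wpmul2l ?lee_fin//; apply: lee_sum => i _.
  by case: (HP i).
rewrite sumEFin sumr_const card_ord -EFinM -EFinD lee_fin mulrDl.
apply: lerD.
  by rewrite /D exprMn mulrA.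
(* The [b ^ m] points cancel [b ^- m]; of the two remaining factors [b ^- M], one comes from
   counting bad points and one from the probability of extreme levels. *)
have -> : q * (X *+ (b ^ m)) = K3 * (beta ^+ 2 / b%:R ^+ 2) ^+ M.
  rewrite /q /X /K3 -[X in _ * X]mulr_natl natrX !expr_div_n -(exprM b%:R) mulnC exprM.
  by field; rewrite !expf_neq0 ?gt_eqF// subr_gt0.
have K30 : 0 <= K3.
  have iv : 0 <= (1 - beta ^+ 2 / b%:R)^-1.
    by rewrite invr_ge0 subr_ge0 ler_pdivrMr// mul1r ltW.
  have c4 : 0 <= 4 * C ^+ 2 * beta ^+ 4.
    apply: mulr_ge0; last by apply: exprn_ge0; exact: ltW.
    by apply: mulr_ge0 => //; exact: sqr_ge0.
  apply: mulr_ge0; first exact: mulr_ge0.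
  by apply: mulr_ge0 => //; apply: mulr_ge0 => //; exact: mulr_ge0.
have -> : (beta ^+ 3 / b%:R) ^+ M ^+ 2 = ((beta ^+ 3) ^+ 2 / b%:R ^+ 2) ^+ M.
  by rewrite exprAC expr_div_n.
have h0 : 0 <= beta ^+ 2 / b%:R ^+ 2 by rewrite divr_ge0// sqr_ge0.
have h : beta ^+ 2 / b%:R ^+ 2 <= (beta ^+ 3) ^+ 2 / b%:R ^+ 2.
  by rewrite ler_wpM2r ?invr_ge0 ?sqr_ge0// -exprM ler_weXn2l.
by rewrite ler_wpM2l// lerXn2r ?nnegrE// (le_trans h0 h).
Qed.

End one_net.

(** [K] is chosen before [t], [m], the net and the probability space, which makes the implied
    constant uniform in them. *)
Lemma exists_mse_bound : exists K : R, forall t m, (t < m)%N ->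
  forall (aa : 'I_(b ^ m) -> 'cV[R]_d)
    (disp : measure_display) (Omega : measurableType disp)
    (P : probability Omega R) (Pi : 'I_d -> seq 'I_b -> Omega -> {perm 'I_b}),
  is_net t aa -> nested_uniform P Pi ->
  ('E_P[fun w => ((QMC_estimate
      (fun i => scramble (ltnW b1) (fun j s => Pi j s w) (aa i)) f -
      gaussian_integral f) ^+ 2)%R] <=
   (K * ((b%:R `^ (a * d%:R)) ^+ 3 / b%:R) ^+ (m - t) ^+ 2)%:E)%E.
Proof.
exists (2 * (2 * K1 + K2) ^+ 2 + K3) => t m tm aa disp Omega P Pi net nuPi.
by rewrite -betaE; exact: scrambled_net_mse.
Qed.

End mean_square_error.

(** * Uniform constants and the final rate *)

Lemma slow_mixed_partials_bound (R : realType) (d : nat) (f : 'cV[R]_d -> R)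
    (a : R) : 0 < a ->
  (forall w, subseq w (enum 'I_d) -> slow (mixed_partial w f)) ->
  exists2 C : R, 0 < C & forall w, subseq w (enum 'I_d) -> forall z,
    `|mixed_partial w f z| <= C * \prod_(i < d) tail (z i 0) `^ (- a).
Proof.
move=> a0 sf.
have bound (v : {set 'I_d}) : exists C : R, 0 < C /\ forall z,
    `|mixed_partial (enum v) f z| <= C * \prod_(i < d) tail (z i 0) `^ (- a).
  have [|C C0 fC] := sf (enum v) _ a a0; last by exists C.
  by rewrite {1}/enum_mem -enumT filter_subseq.
have /choice[C CP] := bound.
(* Subsequences of the enumeration correspond to the finitely many subsets, so one constant per
   subset can be summed. *)
exists (\sum_v C v) => [|w we z].
  rewrite (bigD1 [set x : 'I_d | true]%SET isT) ltr_pwDl ?(proj1 (CP _))// sumr_ge0// => v _.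
  by rewrite ltW// (proj1 (CP v)).
pose v := [set x in w]%SET.
have vw : enum v = w.
  rewrite [RHS](elimT (subseq_uniqP (enum_uniq 'I_d)) we).
  by rewrite {1}/enum_mem -enumT; apply: eq_filter => x; rewrite /= inE.
rewrite -{1}vw (le_trans (proj2 (CP v) z))//.
rewrite ler_wpM2r ?prodr_ge0// => [i _|]; first exact: powR_ge0.
rewrite (bigD1 v isT) lerDl sumr_ge0// => u _.
by rewrite ltW// (proj1 (CP u)).
Qed.

(** Passing from base [b ^ (m - t)] to [N = b ^ m] costs a factor depending on [t] but not on
    [m]. *)
Lemma powR_rate (R : realType) (b t m : nat) (kap eps : R) :
  (1 < b)%N -> (t <= m)%N -> 3 * kap <= eps ->
  ((b%:R `^ kap) ^+ 3 / b%:R) ^+ (m - t) <=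
  b%:R `^ (- t%:R * (- 1 + eps)) * (b ^ m)%:R `^ (- 1 + eps).
Proof.
move=> b1 tm keps.
have bR : 0 < b%:R :> R by rewrite ltr0n ltnW.
have bR1 : 1 <= b%:R :> R by rewrite ler1n ltnW.
have -> : (b%:R `^ kap) ^+ 3 / b%:R = b%:R `^ (- 1 + 3 * kap) :> R.
  rewrite -powR_mulrn ?powR_ge0// -powRrM -[X in _ / X]powRr1 ?(ltW bR)//.
  rewrite -powRN -powRD ?(gt_eqF bR) ?implybT//; congr powR; ring.
rewrite -powR_mulrn ?powR_ge0// -powRrM natrX -powR_mulrn ?(ltW bR)// -powRrM.
rewrite -powRD ?(gt_eqF bR) ?implybT//.
apply: ler_powR => //; rewrite natrB//.
have tmR : t%:R <= m%:R :> R by rewrite ler_nat.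
have : 0 <= (m%:R - t%:R) * (eps - 3 * kap) by rewrite mulr_ge0 ?subr_ge0.
lra.
Qed.

Theorem corollary3p6 (R : realType) (d b t : nat)
    (d0 : (0 < d)%N) (b1 : (1 < b)%N)
    (G : 'cV[R]_d -> R) (mu0 mu : 'cV[R]_d) (Sigma L : 'M[R]_d) :
  (forall x, 0 <= G x) ->
  covariance_matrix Sigma ->
  L *m L^T = Sigma ->
  (forall lambda : R, eigenvalue Sigma lambda -> 1 <= lambda) ->
  mixed_smooth (fun z => G (mu + L *m z)) ->
  QMC_friendly (fun z => G (mu + L *m z)) ->
  forall eps : R, 0 < eps ->
  exists C : R, \forall m \near \oo,
  forall (a : 'I_(b ^ m) -> 'cV[R]_d)
         (disp : measure_display) (Omega : measurableType disp)
         (P : probability Omega R)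
         (Pi : 'I_d -> seq 'I_b -> Omega -> {perm 'I_b}),
  is_net t a ->
  nested_uniform P Pi ->
  let GIS := IS_integrand G mu0 mu Sigma L in
  let u w i := scramble (ltnW b1) (fun j s => Pi j s w) (a i) in
  ('E_P[fun w => ((QMC_estimate (u w) GIS - gaussian_integral GIS) ^+ 2)%R]
     `^ (2^-1)%R <= (C * (b ^ m)%:R `^ (- 1 + eps))%R%:E)%E.
Proof.
move=> G0 _ LS S1 sG qG eps eps0.
set f := IS_integrand G mu0 mu Sigma L.
have f0 z : 0 <= f z by rewrite mulr_ge0// mulr_ge0 ?powR_ge0 ?expR_ge0.
have [df sf] := mslow_mixed_partial (IS_integrand_mslow mu0 LS S1 sG qG).
have dR : 0 < d%:R :> R by rewrite ltr0n.
(* [eps / 3] meets the exponent 3 of [beta] in the rate; [1 / 3] is a value below the threshold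
   [1 / 2] for second moments. *)
pose kap := Num.min (eps / 3) 3^-1.
have kap0 : 0 < kap by rewrite lt_min divr_gt0//= invr_gt0.
have keps : 3 * kap <= eps.
  have h : kap <= eps / 3 by rewrite ge_min lexx.
  by move: h; lra.
pose a := kap / d%:R.
have a0 : 0 < a by rewrite divr_gt0.
have adE : a * d%:R = kap by rewrite divfK// gt_eqF.
have a_small : a * d%:R < 2^-1.
  have h : kap <= 3^-1 by rewrite ge_min lexx orbT.
  by rewrite adE; move: h; lra.
have [C C0 fC] := slow_mixed_partials_bound a0 sf.
have [K KP] := exists_mse_bound b1 d0 f0 C0 a0 a_small df fC.
(* Taking [m > t] makes the level [m - t] positive, as the grid requires. *)
exists (Num.sqrt K * b%:R `^ (- t%:R * (- 1 + eps))); exists t.+1 => // m /= tm.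
move=> aa disp Omega P Pi net nuPi.
have mse := KP t m tm aa disp Omega P Pi net nuPi; rewrite adE in mse.
set rho := _ ^+ (m - t) in mse.
have rho0 : 0 <= rho by rewrite exprn_ge0// divr_ge0// exprn_ge0// powR_ge0.
have E0 : (0 <= 'E_P[fun w => ((QMC_estimate
    (fun i => scramble (ltnW b1) (fun j s => Pi j s w) (aa i)) f -
    gaussian_integral f) ^+ 2)%R])%E.
  by rewrite unlock; apply: integral_ge0 => w _; rewrite lee_fin sqr_ge0.
have K0 : 0 <= K * rho ^+ 2 by rewrite -lee_fin (le_trans E0 mse).
apply: (@le_trans _ _ ((K * rho ^+ 2)%:E `^ 2^-1)%E).
  by apply: gt0_ler_poweR; rewrite ?in_itv/= ?leey ?andbT ?lee_fin// invr_ge0.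
rewrite poweR_EFin lee_fin powR12_sqrt//.
(* The sign of [K] is not recorded; were it negative, both square roots would be 0. *)
have [K0'|Kneg] := leP 0 K; last first.
  rewrite (ler0_sqrtr (ltW Kneg)) !mul0r.
  rewrite ler0_sqrtr//; rewrite mulr_le0_ge0 ?sqr_ge0// ltW//.
rewrite sqrtrM// sqrtr_sqr (ger0_norm rho0) -mulrA ler_wpM2l ?sqrtr_ge0//.
by apply: powR_rate => //; exact: ltnW.
Qed.
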